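(* Let $\alpha$, $\{f^\varepsilon\}_{\varepsilon>0}$, $m_o^\varepsilon$ and the traveling wave pairs $(q^\varepsilon,c^\varepsilon)$, $(q^{\varepsilon,\delta},c^{\varepsilon,\delta})$ satisfy all the standing assumptions listed in the context. Let $g:\mathbb{R}^n\to[-1,1]$ be a continuous function such that the sets $\Gamma_o=\{g=0\}$, $\Omega_o^+=\{g>0\}$, $\Omega_o^-=\{g<0\}$ are nonempty. Let $u^\varepsilon$ be the unique solution of $$u^\varepsilon_t-\Delta u^\varepsilon+\varepsilon^{-2}f^\varepsilon(u^\varepsilon,x)=0\ \text{ in }\mathbb{R}^n\times(0,+\infty),\qquad u^\varepsilon(x,0)=g(x)\ \text{ in }\mathbb{R}^n.$$ Let $d_o$ be the signed distance to $\Gamma_o$ which is positive in $\Omega_o^+$ and negative in $\Omega_o^-$. Suppose that $u$ is a unique, continuous viscosity solution of $$u_t+F(Du,D^2u)+\alpha(x)|Du|=0\ \text{ in }\mathbb{R}^n\times(0,+\infty),\qquad u(x,0)=d_o(x),$$ where $F(p,X)=-\operatorname{tr}\big[\big(I-\tfrac{p}{|p|}\otimes\tfrac{p}{|p|}\big)X\big]$, and that the comparison principle holds for this problem. Then, as $\varepsilon\to0$, $$u^\varepsilon\to1\ \text{ in }\{(x,t):u(x,t)>0\},\qquad u^\varepsilon\to-1\ \text{ in }\{(x,t):u(x,t)<0\},$$ locally uniformly (in these subsets of $\mathbb{R}^n\times(0,+\infty)$). If in addition the no-interior condition $\{(x,t):u(x,t)=0\}=\partial\{(x,t):u(x,t)>0\}=\partial\{(x,t):u(x,t)<0\}$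 holds, then, as $\varepsilon\to0$, $u^\varepsilon\to1$ in $\{u>0\}$ and $u^\varepsilon\to-1$ in the complement of $\overline{\{u>0\}}$, locally uniformly.
   Context: Constants below are independent of $\varepsilon$ unless dependence is displayed; $\varepsilon>0$ is a small parameter; $\rho,\gamma\in(0,1)$, $k\in[0,1)$; $D,D^2$ acting on $q^\varepsilon$ denote derivatives in $x$. Limit velocity. $\tilde\Gamma\subset\mathbb{R}^n$ is an oriented, closed, smooth hypersurface, $\tilde d$ a signed distance function from $\tilde\Gamma$; $n_1,n_2:\mathbb{R}^n\to[\rho,+\infty)$ are bounded and locally Lipschitz with $n_1<n_2$ everywhere; $\alpha$ is measurable with $\alpha(x)=n_1(x)$ if $\tilde d(x)<0$, $\alpha(x)=n_2(x)$ if $\tilde d(x)>0$, $\alpha(x)\in[n_1(x),n_2(x)]$ if $\tilde d(x)=0$. $\alpha^*,\alpha_*$ are the upper and lower semicontinuous envelopes of $\alpha$. Viscosity solutions (in the sense of Ishii). A locally bounded $u$ is a viscosity subsolution of $u_t+F(Du,D^2u)+\alpha(x)|Du|=0$ if its upper semicontinuous envelope satisfies $u_t+F_*(Du,D^2u)+\alpha_*(x)|Du|\le0$ in the viscosity sense, a supersolution if its lower semicontinuous envelope satisfies $u_t+F^*(Du,D^2u)+\alpha^*(x)|Du|\ge0$ in the viscosity sense ($F_*,F^*$ the semicontinuous envelopes of $F$, needed at $p=0$), and a solution if both. Comparison principle: if $v$ is a bounded upper semicontinuous subsolution and $w$ a bounded lower semicontinuous supersolution with $v(\cdot,0)\le w(\cdot,0)$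 on $\mathbb{R}^n$, then $v\le w$. Nonlinearity. $f^\varepsilon\in C^2(\mathbb{R}\times\mathbb{R}^n)$ satisfies: (1) for every $x$, $f^\varepsilon(\cdot,x)$ has exactly three zeroes $-1,m_o^\varepsilon(x),1$, with $0<m_o^\varepsilon(x)<1-\rho$; $f^\varepsilon(\cdot,x)>0$ in $(-1,m_o^\varepsilon(x))\cup(1,+\infty)$ and $<0$ in $(-\infty,-1)\cup(m_o^\varepsilon(x),1)$; $f^\varepsilon_q(q,x)\ge\gamma$ for all $q\le-1+\gamma$ or $q\ge1-\gamma$ and all $x$; $f^\varepsilon_{qq}(-1,x)<0<f^\varepsilon_{qq}(1,x)$. Moreover $m_o^\varepsilon\to0^+$ locally uniformly: for every compact $K_1\subset\mathbb{R}^n$ and $\sigma>0$ there is $\varepsilon_\sigma>0$ with $m_o^\varepsilon(x)\in(0,\sigma]$ for $\varepsilon\le\varepsilon_\sigma$, $x\in K_1$. (2) For every compact $K\subset\mathbb{R}$ there are constants $C,C_1,C_2>0$ such that for $(q,x)\in K\times\mathbb{R}^n$, $1\le i,j\le n$: $|f^\varepsilon_q|,|f^\varepsilon_{qq}|\le C$, $|f^\varepsilon_{x_i}|,|f^\varepsilon_{x_iq}|\le C_1\varepsilon^{-(k-1)}$, $|f^\varepsilon_{x_ix_j}|\le C_2\varepsilon^{-(2k-1)}$. (3) For every compact $K_1\subset\mathbb{R}^n$ and small $\sigma>0$ there are $\overline f,\underline f\in C^2(\mathbb{R}\times\mathbb{R}^n)$ with the same bistable structure (1),(2) (possibly other constants,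 no convergence requirement), with zeroes $\{-1,\sigma,1\}$ and $\{-1,0,1\}$ respectively, such that $\underline f\le f^\varepsilon\le\overline f$ for all $x\in K_1$, $q\in[-1,1]$ and $\varepsilon$ sufficiently small. Traveling waves. For each $x$, $(q^\varepsilon(\cdot,x),c^\varepsilon(x))$ is the unique pair with $q^\varepsilon_{rr}+c^\varepsilon(x)q^\varepsilon_r=f^\varepsilon(q^\varepsilon,x)$ for $r\in\mathbb{R}$, $q^\varepsilon(\mp\infty,x)=\mp1$, $q^\varepsilon(0,x)=m_o^\varepsilon(x)$; one has $q^\varepsilon_r>0$. It is assumed that: (4) there are $a,b>0$ with $\inf_xq^\varepsilon(r,x)\ge1-ae^{-br}$ as $r\to+\infty$ and $\sup_xq^\varepsilon(r,x)\le-1+ae^{br}$ as $r\to-\infty$; (5) $q^\varepsilon_r(r,x)\ge K(x,\bar r)>0$ for $x\in\mathbb{R}^n$, $|r|\le\bar r$, and $\sup_{(r,x)}[(1+|r|)q^\varepsilon_r+(1+|r|^2)q^\varepsilon_{rr}]<+\infty$; (6) for each compact $K_1\subset\mathbb{R}^n$ there are $M_1,M_2>0$ with $|Dq^\varepsilon|,|Dq^\varepsilon_r|\le M_1\varepsilon^{-(k-1)}$, $|D^2q^\varepsilon|\le M_2\varepsilon^{-(2k-1)}$ for $x\in K_1$, $r\in\mathbb{R}$. (7) There is $\bar\delta>0$ such that for $\delta\in[-\bar\delta,\bar\delta]$ the function $f^{\varepsilon,\delta}=f^\varepsilon+\varepsilon\delta$ has properties similar to those of $f^\varepsilon$, with exactly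 three zeroes $m_-^{\varepsilon,\delta}(x)<m_o^{\varepsilon,\delta}(x)<m_+^{\varepsilon,\delta}(x)$; the corresponding unique traveling wave pair $(q^{\varepsilon,\delta},c^{\varepsilon,\delta})$, solving $q^{\varepsilon,\delta}_{rr}+c^{\varepsilon,\delta}(x)q^{\varepsilon,\delta}_r=f^{\varepsilon,\delta}(q^{\varepsilon,\delta},x)$, $q^{\varepsilon,\delta}(\pm\infty,x)=m_\pm^{\varepsilon,\delta}(x)$, $q^{\varepsilon,\delta}(0,x)=m_o^{\varepsilon,\delta}(x)$, $q^{\varepsilon,\delta}_r>0$, satisfies the analogues of (4)–(6) (with $m_\pm^{\varepsilon,\delta}$ in place of $\pm1$); and there is $M>0$ independent of $\varepsilon,\delta$ with $\sup_x[|c^\varepsilon-c^{\varepsilon,\delta}|+|1-m_+^{\varepsilon,\delta}|+|1+m_-^{\varepsilon,\delta}|]\le M|\delta|\varepsilon$. (8) $0<2\rho\le n_1(x)<c^\varepsilon(x)/\varepsilon<n_2(x)\le2(1-\rho)$ for all $x$, and $c^\varepsilon/\varepsilon\to\alpha$ locally uniformly off $\tilde\Gamma$ as $\varepsilon\to0$. *)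

(* Defs.v *)
From HB Require Import structures.
From mathcomp Require Import all_boot all_order all_algebra.
From mathcomp Require Import all_classical all_reals all_analysis.

Set Implicit Arguments.
Unset Strict Implicit.
Unset Printing Implicit Defensive.

Import Order.TTheory GRing.Theory Num.Theory.
Import numFieldNormedType.Exports.

Local Open Scope ring_scope.
Local Open Scope classical_set_scope.

(* Points of R^n are row vectors.  The norm that the library puts on 'rV[R]_n
   is the sup norm; it is used for the topology only, and the Euclidean norm
   is [enorm] below. *)

Section Euclidean.
Context {R : realType}.

(* Euclidean norm of a vector, Frobenius norm of a matrix. *)
Definition enorm (m n : nat) (A : 'M[R]_(m, n)) : R :=
  Num.sqrt (\sum_i \sum_j A i j ^+ 2).

Definition dist (n : nat) (x : 'rV[R]_n) (A : set 'rV[R]_n) : R :=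
  inf [set enorm (x - y) | y in A].

Definition e_ (n : nat) (i : 'I_n) : 'rV[R]_n := delta_mx 0 i.

Definition grad (n : nat) (h : 'rV[R]_n -> R) (x : 'rV[R]_n) : 'rV[R]_n :=
  \row_i 'D_(e_ i) h x.

Definition hess (n : nat) (h : 'rV[R]_n -> R) (x : 'rV[R]_n) : 'M[R]_n :=
  \matrix_(i, j) 'D_(e_ i) ('D_(e_ j) h) x.

(* h is of class C^k on the open set U; on a finite dimensional space it is
   equivalent to quantify over all directions v or over those of a basis. *)
Fixpoint Ck_on (V : normedModType R) (U : set V) (k : nat) (h : V -> R) : Prop :=
  (forall z, U z -> {for z, continuous h}) /\
  (if k is k'.+1 then
     forall v, (forall z, U z -> derivable h z v) /\ Ck_on U k' ('D_v h)
   else True).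

(* Uniform convergence as e -> 0+ on the compact subsets of A. *)
Definition cvg_loc_unif (T : topologicalType) (A : set T)
    (v : R -> T -> R) (l : T -> R) : Prop :=
  forall K : set T, compact K -> K `<=` A -> {uniform K, v @ 0^'+ --> l}.

Definition locally_lipschitz (n : nat) (h : 'rV[R]_n -> R) : Prop :=
  forall x : 'rV[R]_n, exists2 U : set 'rV[R]_n, nbhs x U & [lipschitz h y | y in U].

End Euclidean.

Section Measurability.
Context {R : realType} {n : nat}.

(* [ball (x i) (r i)] is the open cube of centre x i and side 2 r i. *)
Definition lebesgue_null (N : set 'rV[R]_n) : Prop :=
  forall eta : R, 0 < eta ->
  exists (x : nat -> 'rV[R]_n) (r : nat -> R),
    [/\ forall i, 0 <= r i,
        N `<=` \bigcup_i ball (x i) (r i)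
      & forall m, \sum_(i < m) (2 * r i) ^+ n <= eta].

(* The sigma-algebra generated by the open and the null sets is that of the
   Lebesgue measurable sets. *)
Definition lebesgue_measurable_fun (h : 'rV[R]_n -> R) : Prop :=
  measurable_fun setT
    (h : g_sigma_algebraType [set A | open A \/ lebesgue_null A] -> R).

End Measurability.

Section Hypersurfaces.
Context {R : realType} {n : nat}.
Implicit Types (G P N : set 'rV[R]_n) (d : 'rV[R]_n -> R).

Definition signed_distance G P N d : Prop :=
  [/\ forall x, G x -> d x = 0,
      forall x, P x -> d x = dist x G
    & forall x, N x -> d x = - dist x G].

(* G is a smooth hypersurface, closed and without boundary, with complement
   the disjoint union of the open sets P and N, and oriented by the unit normal
   pointing into P; h is a local defining function compatible with the
   orientation.  G is not required to be bounded. *)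
Record oriented_closed_hypersurface G P N : Prop := {
  och_nonempty : G !=set0;
  och_closed : closed G;
  och_open : open P /\ open N;
  och_partition : P `&` N = set0 /\ P `|` N = ~` G;
  och_smooth : forall p, G p -> exists h : 'rV[R]_n -> R,
    [/\ forall k, Ck_on setT k h,
        grad h p <> 0
      & \forall z \near p, [/\ G z <-> h z = 0,
                               P z <-> 0 < h z
                             & N z <-> h z < 0]] }.

Record limit_velocity (rho : R) G P N d (n1 n2 alpha : 'rV[R]_n -> R) : Prop := {
  lv_hypersurface : oriented_closed_hypersurface G P N;
  lv_distance : signed_distance G P N d;
  lv_ge : forall x, rho <= n1 x /\ rho <= n2 x;
  lv_bounded : [bounded n1 x | x in setT] /\ [bounded n2 x | x in setT];
  lv_lipschitz : locally_lipschitz n1 /\ locally_lipschitz n2;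
  lv_lt : forall x, n1 x < n2 x;
  lv_measurable : lebesgue_measurable_fun alpha;
  lv_neg : forall x, d x < 0 -> alpha x = n1 x;
  lv_pos : forall x, 0 < d x -> alpha x = n2 x;
  lv_zero : forall x, d x = 0 -> n1 x <= alpha x <= n2 x }.

End Hypersurfaces.

Section Viscosity.
Context {R : realType}.

(* Semicontinuous envelopes of a function defined on D, at a point of the
   closure of D.  Neighbourhoods contain their centre, so x itself counts
   when it lies in D. *)
Definition usc_env (T : topologicalType) (D : set T) (h : T -> R) (x : T)
  : \bar R := limf_esup (fun y => (h y)%:E) (within D (nbhs x)).
Definition lsc_env (T : topologicalType) (D : set T) (h : T -> R) (x : T)
  : \bar R := limf_einf (fun y => (h y)%:E) (within D (nbhs x)).

Definition usc_on (T : topologicalType) (D : set T) (h : T -> R) : Prop :=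
  forall x, D x -> usc_env D h x = (h x)%:E.
Definition lsc_on (T : topologicalType) (D : set T) (h : T -> R) : Prop :=
  forall x, D x -> lsc_env D h x = (h x)%:E.

Context {n : nat}.
Implicit Types (alpha g : 'rV[R]_n -> R) (u v w phi : 'rV[R]_n * R -> R).
Implicit Types (z : 'rV[R]_n * R).

(* R^n x [0, +oo[ and R^n x ]0, +oo[ *)
Definition Q0 : set ('rV[R]_n * R) := [set z | 0 <= z.2].
Definition Qpos : set ('rV[R]_n * R) := [set z | 0 < z.2].

Definition dt u z : R := derive1 (fun s => u (z.1, s)) z.2.
Definition grad_x u z : 'rV[R]_n := grad (fun y => u (y, z.2)) z.1.
Definition hess_x u z : 'M[R]_n := hess (fun y => u (y, z.2)) z.1.

(* F is only meaningful on [Fdom]: its value at p = 0 is junk, and is ignored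
   by the envelopes below. *)
Definition F (pX : 'rV[R]_n * 'M[R]_n) : R :=
  let e := (enorm pX.1)^-1 *: pX.1 in
  - \tr ((1%:M - e^T *m e) *m pX.2).
Definition Fdom : set ('rV[R]_n * 'M[R]_n) :=
  [set pX | pX.1 <> 0 /\ pX.2^T = pX.2].

Definition locally_bounded u : Prop :=
  forall z, Q0 z -> bounded_near u (within Q0 (nbhs z)).

Definition viscosity_sub alpha u : Prop :=
  locally_bounded u /\
  forall phi z0, Ck_on Qpos 2 phi -> Qpos z0 ->
    (\forall z \near z0,
      usc_env Q0 u z - (phi z)%:E <= usc_env Q0 u z0 - (phi z0)%:E)%E ->
    ((dt phi z0)%:E + lsc_env Fdom F (grad_x phi z0, hess_x phi z0)
      + lsc_env setT alpha z0.1 * (enorm (grad_x phi z0))%:E <= 0)%E.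

Definition viscosity_super alpha u : Prop :=
  locally_bounded u /\
  forall phi z0, Ck_on Qpos 2 phi -> Qpos z0 ->
    (\forall z \near z0,
      lsc_env Q0 u z0 - (phi z0)%:E <= lsc_env Q0 u z - (phi z)%:E)%E ->
    (0 <= (dt phi z0)%:E + usc_env Fdom F (grad_x phi z0, hess_x phi z0)
      + usc_env setT alpha z0.1 * (enorm (grad_x phi z0))%:E)%E.

Definition viscosity_sol alpha u : Prop :=
  viscosity_sub alpha u /\ viscosity_super alpha u.

Definition comparison_principle alpha : Prop :=
  forall v w,
    [bounded v z | z in Q0] -> usc_on Q0 v -> viscosity_sub alpha v ->
    [bounded w z | z in Q0] -> lsc_on Q0 w -> viscosity_super alpha w ->
    (forall x, v (x, 0) <= w (x, 0)) ->
    forall z, Q0 z -> v z <= w z.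

Definition continuous_viscosity_sol alpha g u : Prop :=
  [/\ {within Q0, continuous u},
      viscosity_sol alpha u
    & forall x, u (x, 0) = g x].

Definition C21 u : Prop :=
  forall z, Qpos z ->
    [/\ derivable (fun s => u (z.1, s)) z.2 1,
        forall i, derivable (fun y => u (y, z.2)) z.1 (e_ i),
        forall i j, derivable ('D_(e_ i) (fun y => u (y, z.2))) z.1 (e_ j)
      & [/\ {for z, continuous (dt u)},
            {for z, continuous (grad_x u)}
          & {for z, continuous (hess_x u)}]].

(* Bounded classical solutions: the class in which the Cauchy problem is
   well posed. *)
Definition reaction_diffusion_sol (eps : R) (f : R -> 'rV[R]_n -> R) g u
  : Prop :=
  [/\ {within Q0, continuous u} /\ [bounded u z | z in Q0],
      C21 u,
      forall z, Qpos z ->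
        dt u z - \tr (hess_x u z) + eps ^- 2 * f (u z) z.1 = 0
    & forall x, u (x, 0) = g x].

End Viscosity.

Section Nonlinearity.
Context {R : realType} {n : nat}.
Implicit Types (f : R -> 'rV[R]_n -> R) (zm zo zp : 'rV[R]_n -> R).

Definition d_q f (q : R) (x : 'rV[R]_n) : R := derive1 (f ^~ x) q.

Definition class_C2 f : Prop := Ck_on setT 2 (fun z : R * 'rV[R]_n => f z.1 z.2).

Definition bistable (gamma : R) f zm zo zp : Prop :=
  forall x,
  [/\ zm x < zo x < zp x,
      forall q, f q x = 0 <-> [\/ q = zm x, q = zo x | q = zp x],
      forall q, zm x < q < zo x \/ zp x < q -> 0 < f q x,
      forall q, q < zm x \/ zo x < q < zp x -> f q x < 0
    & (forall q, q <= zm x + gamma \/ zp x - gamma <= q ->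
         gamma <= d_q f q x) /\
      d_q (d_q f) (zm x) x < 0 < d_q (d_q f) (zp x) x].

Definition derivative_bounds (k eps : R) (K : set R) (C C1 C2 : R) f : Prop :=
  forall q x, K q ->
    `|d_q f q x| <= C /\ `|d_q (d_q f) q x| <= C /\
    (forall i, `|grad (f q) x 0 i| <= C1 * eps `^ (- (k - 1)) /\
               `|grad (d_q f q) x 0 i| <= C1 * eps `^ (- (k - 1))) /\
    (forall i j, `|hess (f q) x i j| <= C2 * eps `^ (- (2 * k - 1))).

(* The nonlinearities bounding f from above and below do not depend on eps,
   hence the value 1 for eps in their derivative bounds. *)
Definition barrier (k : R) f (zo : R) : Prop :=
  [/\ class_C2 f,
      exists2 gamma : R, 0 < gamma < 1 &
        bistable gamma f (cst (-1)) (cst zo) (cst 1)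
    & forall K, compact K -> exists C C1 C2 : R,
        [/\ 0 < C, 0 < C1, 0 < C2 & derivative_bounds k 1 K C C1 C2 f]].

Record nonlinearity (eps0 rho gamma k : R) (f : R -> R -> 'rV[R]_n -> R)
    (mo : R -> 'rV[R]_n -> R) : Prop := {
  nl_C2 : forall eps, 0 < eps < eps0 -> class_C2 (f eps);
  nl_bistable : forall eps, 0 < eps < eps0 ->
    bistable gamma (f eps) (cst (-1)) (mo eps) (cst 1);
  nl_mo : forall eps, 0 < eps < eps0 -> forall x, 0 < mo eps x < 1 - rho;
  nl_mo_cvg : forall K1, compact K1 -> forall sigma : R, 0 < sigma ->
    \forall eps \near 0^'+, forall x, K1 x -> 0 < mo eps x <= sigma;
  nl_bounds : forall K, compact K -> exists C C1 C2 : R,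
    [/\ 0 < C, 0 < C1, 0 < C2 & forall eps, 0 < eps < eps0 ->
        derivative_bounds k eps K C C1 C2 (f eps)];
  nl_barriers : forall K1, compact K1 ->
    \forall sigma \near 0^'+, exists fup flow : R -> 'rV[R]_n -> R,
    [/\ barrier k fup sigma, barrier k flow 0
      & \forall eps \near 0^'+, forall x q, K1 x -> -1 <= q <= 1 ->
          flow q x <= f eps q x <= fup q x] }.

End Nonlinearity.

Section Waves.
Context {R : realType} {n : nat}.

(* (q, c) = (p.1, p.2) joins the zeroes zm and zp of h. *)
Definition travelling_wave (h : R -> R) (zm zo zp : R) (p : (R -> R) * R)
  : Prop :=
  let q := p.1 in let c := p.2 in
  [/\ forall r, derivable q r 1 /\ derivable (derive1 q) r 1,
      forall r, derive1n 2 q r + c * derive1 q r = h (q r),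
      q r @[r --> -oo] --> zm,
      q r @[r --> +oo] --> zp
    & q 0 = zo].

(* Estimates for a family of profiles q i, i \in D, with constants independent
   of i; the i-th profile joins mm i x to mp i x, and eps i is the value of the
   small parameter attached to i. *)
Record wave_estimates (k : R) (I : Type) (D : set I) (eps : I -> R)
    (mm mp : I -> 'rV[R]_n -> R) (q : I -> R -> 'rV[R]_n -> R) : Prop := {
  we_C2 : forall i, D i -> class_C2 (q i);
  we_tails : exists a b r0 : R,
    [/\ 0 < a, 0 < b & forall i x, D i ->
        (forall r, r0 <= r -> mp i x - a * expR (- (b * r)) <= q i r x) /\
        (forall r, r <= - r0 -> q i r x <= mm i x + a * expR (b * r))];
  we_slope : exists Kr : 'rV[R]_n -> R -> R,
    forall x rbar, 0 < Kr x rbar /\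
      forall i r, D i -> `|r| <= rbar -> Kr x rbar <= d_q (q i) r x;
  we_decay : exists B : R, forall i r x, D i ->
    (1 + `|r|) * d_q (q i) r x + (1 + `|r| ^+ 2) * d_q (d_q (q i)) r x <= B;
  we_space : forall K1, compact K1 -> exists M1 M2 : R,
    [/\ 0 < M1, 0 < M2 & forall i x r, D i -> K1 x ->
        [/\ enorm (grad (q i r) x) <= M1 * eps i `^ (- (k - 1)),
            enorm (grad (d_q (q i) r) x) <= M1 * eps i `^ (- (k - 1))
          & enorm (hess (q i r) x) <= M2 * eps i `^ (- (2 * k - 1))]] }.

Record waves (eps0 k : R) (f : R -> R -> 'rV[R]_n -> R)
    (mo : R -> 'rV[R]_n -> R)
    (q : R -> R -> 'rV[R]_n -> R) (c : R -> 'rV[R]_n -> R) : Prop := {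
  w_unique : forall eps x, 0 < eps < eps0 ->
    unique (travelling_wave (f eps ^~ x) (-1) (mo eps x) 1)
           (q eps ^~ x, c eps x);
  w_increasing : forall eps r x, 0 < eps < eps0 -> 0 < d_q (q eps) r x;
  w_estimates :
    wave_estimates k [set eps : R | 0 < eps < eps0] id
      (fun _ => cst (-1)) (fun _ => cst 1) q }.

(* Families indexed by eps, then by delta.  The perturbed nonlinearities share
   the derivatives of f, so that only their zeroes and the bistable structure
   have to be specified. *)
Record perturbed_waves (eps0 dbar k : R) (f : R -> R -> 'rV[R]_n -> R)
    (c : R -> 'rV[R]_n -> R) (mm mo mp : R -> R -> 'rV[R]_n -> R)
    (q : R -> R -> R -> 'rV[R]_n -> R) (cd : R -> R -> 'rV[R]_n -> R)
  : Prop := {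
  pw_bistable : exists2 gamma : R, 0 < gamma < 1 &
    forall eps delta, 0 < eps < eps0 -> `|delta| <= dbar ->
      bistable gamma (fun s x => f eps s x + eps * delta)
        (mm eps delta) (mo eps delta) (mp eps delta);
  pw_unique : forall eps delta x, 0 < eps < eps0 -> `|delta| <= dbar ->
    unique (fun p => travelling_wave (fun s => f eps s x + eps * delta)
                       (mm eps delta x) (mo eps delta x) (mp eps delta x) p /\
                     forall r, 0 < derive1 p.1 r)
           (q eps delta ^~ x, cd eps delta x);
  pw_estimates :
    wave_estimates k
      [set i : R * R | 0 < i.1 < eps0 /\ `|i.2| <= dbar] fst
      (fun i => mm i.1 i.2) (fun i => mp i.1 i.2) (fun i => q i.1 i.2);
  pw_close : exists2 M : R, 0 < M &
    forall eps delta x, 0 < eps < eps0 -> `|delta| <= dbar ->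
      `|c eps x - cd eps delta x| + `|1 - mp eps delta x|
        + `|1 + mm eps delta x| <= M * `|delta| * eps }.

End Waves.

(* Main.v *)
(** Let S be the set of points of R^n x (0, +oo) near which u^eps is eventually at least 1 - gamma.
    Comparing u^eps with q^{eps,delta}(psi / eps, x), for psi a normalized quadratic front, shows that
    the function equal to 1 on S and to -1 elsewhere is a supersolution of the geometric equation; where
    the gradient of the test function vanishes, sliding the test function reduces to a nondegenerate
    contact point.  Since -1 + u / (1 + |u|) is a subsolution, and the fast initial generation of the
    interface orders the two functions at t = 0, the comparison principle gives {u > 0} in S; stability of
    the zero 1 of f^eps then improves 1 - gamma to convergence to 1 on compact subsets.  The symmetry
    (f, u^eps, alpha) |-> (- f (- q), - u^eps, - alpha) exchanges the two phases. *)

(* Normalizing a front usually means replacing it by its signed distance function. Here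
   [psi * (1 - |D psi|^2)] only has to be nonnegative: along the wave, [f + eps * delta] has the
   sign opposite to that of the wave variable, so the defect of unit gradient then has the
   favourable sign. An explicit algebraic [psi] achieves this. The perturbation by [delta] serves
   twice. It leaves room of order [delta / eps], against which the errors due to the dependence of
   the profile on [x], of order [eps^(1-k) / eps], are negligible; and it lowers the right end state
   of the wave below [1 - theta * eps]. A barrier therefore has to be started where [u^eps] is
   already that close to 1, whereas settled points only give [1 - gamma]. The gap is closed within a
   time of order [eps] by comparison with an ordinary differential equation, whose error is
   exponentially small and travels at a speed of order [1 / eps]. *)
Require Import Defs.
From HB Require Import structures.
From mathcomp Require Import all_boot all_order all_algebra.
From mathcomp Require Import all_classical all_reals all_analysis.
From mathcomp Require Import ring lra.

Set Implicit Arguments.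
Unset Strict Implicit.
Unset Printing Implicit Defensive.

Import Order.TTheory GRing.Theory Num.Theory Num.Def.
Import numFieldNormedType.Exports.

Local Open Scope ring_scope.
Local Open Scope classical_set_scope.

(** * One-variable calculus and the parabolic maximum principle *)

Section OneVariable.
Context {R : realType}.
Implicit Types (f g h : R -> R) (x y a b : R).

Lemma is_derive_add f g x a b : is_derive x 1 f a -> is_derive x 1 g b ->
  is_derive x 1 (fun s => f s + g s) (a + b).
Proof. by move=> df dg; exact: (is_deriveD df dg). Qed.

Lemma is_derive_sub f g x a b : is_derive x 1 f a -> is_derive x 1 g b ->
  is_derive x 1 (fun s => f s - g s) (a - b).
Proof. by move=> df dg; exact: (is_deriveB df dg). Qed.

Lemma is_derive_mul f g x a b : is_derive x 1 f a -> is_derive x 1 g b ->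
  is_derive x 1 (fun s => f s * g s) (a * g x + f x * b).
Proof.
move=> df dg; have H := is_deriveM df dg; apply: (is_derive_eq H).
by rewrite /GRing.scale /= addrC mulrC.
Qed.

Lemma is_derive_cstM k f x a : is_derive x 1 f a ->
  is_derive x 1 (fun s => k * f s) (k * a).
Proof. by move=> df; exact: (is_deriveZ k df). Qed.

Lemma is_derive_val f x a b : is_derive x 1 f a -> a = b -> is_derive x 1 f b.
Proof. by move=> df <-. Qed.

Lemma is_derive_idr x : is_derive x 1 (fun s : R => s) 1.
Proof. exact: is_derive_id. Qed.

Lemma is_derive_linear k x : is_derive x 1 (fun s : R => k * s) k.
Proof.
rewrite -[X in is_derive _ _ _ X]mulr1.
by apply: is_derive_cstM; exact: is_derive_idr.
Qed.

Lemma is_derive_comp f g x a b : is_derive (g x) 1 f a -> is_derive x 1 g b ->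
  is_derive x 1 (fun s => f (g s)) (a * b).
Proof. by move=> df dg; exact: (is_derive1_comp df dg). Qed.

Lemma is_derive_cts f x a : is_derive x 1 f a -> {for x, continuous f}.
Proof. by case=> df _; exact/differentiable_continuous/derivable1_diffP. Qed.

Lemma is_derive_inv f x a : is_derive x 1 f a -> f x != 0 ->
  is_derive x 1 (fun s => (f s)^-1) (- (f x) ^- 2 * a).
Proof.
move=> [df <-] f0; have := DeriveDef (derivableV f0 df) (deriveV f0 df).
by rewrite /GRing.scale.
Qed.

Lemma mean_value f f' a b :
  (forall x, Num.min a b <= x <= Num.max a b -> is_derive x 1 f (f' x)) ->
  exists2 c : R, Num.min a b <= c <= Num.max a b & f b - f a = f' c * (b - a).
Proof.
wlog ab : a b / a <= b => [H|].
  case/orP: (le_total a b) => [ab|ba]; first exact: H.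
  rewrite minC maxC => df; have [c cab e] := H b a ba df.
  by exists c => //; rewrite -opprB e -mulrN opprB.
rewrite (min_idPl ab) (max_idPr ab) => df.
have [||c] := @MVT_segment R f f' a b ab.
- by move=> x; rewrite in_itv /= => /andP[ax xb]; apply: df; rewrite !ltW.
- apply: derivable_within_continuous => x; rewrite in_itv /= => xab.
  by have [] := df _ xab.
by rewrite in_itv /= => cab e; exists c.
Qed.

Lemma mean_value0 f f' b :
  (forall c : R, `|c| <= `|b| -> is_derive c 1 f (f' c)) ->
  exists2 c : R, `|c| <= `|b| & f b - f 0 = f' c * b.
Proof.
have H (c : R) : Num.min 0 b <= c <= Num.max 0 b -> `|c| <= `|b|.
  case/orP: (le_total 0 b) => b0.
    rewrite (min_idPl b0) (max_idPr b0) => /andP[c1 c2].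
    by rewrite !ger0_norm.
  rewrite (min_idPr b0) (max_idPl b0) => /andP[c1 c2].
  by rewrite !ler0_norm // lerN2.
move=> df; have [|c /H cb E] := @mean_value f f' 0 b.
  by move=> c /H /df.
by exists c => //; rewrite E subr0.
Qed.

Lemma derive_ge0_le f f' a b : a <= b ->
  (forall x, a <= x <= b -> is_derive x 1 f (f' x)) ->
  (forall x, a <= x <= b -> 0 <= f' x) -> f a <= f b.
Proof.
move=> ab df f0; have [|c cab] := @mean_value f f' a b.
  by rewrite (min_idPl ab) (max_idPr ab).
rewrite (min_idPl ab) (max_idPr ab) in cab.
by move=> e; rewrite -subr_ge0 e mulr_ge0 ?subr_ge0 ?f0.
Qed.

(** One-variable trace of a second order expansion. The second derivative is asked for at 0 only,
    which is what the second derivative test uses and what slices of [C21] functions provide. *)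
Definition jet2 h (d1 d2 : R) := exists h1 : R -> R,
  [/\ \forall s \near (0 : R), is_derive s (1 : R) h (h1 s), h1 0 = d1 & is_derive (0 : R) (1 : R) h1 d2].

Lemma jet2_sub h g d1 d2 e1 e2 : jet2 h d1 d2 -> jet2 g e1 e2 ->
  jet2 (fun s => h s - g s) (d1 - e1) (d2 - e2).
Proof.
move=> [h1 [dh <- d2h]] [g1 [dg <- d2g]]; exists (fun s => h1 s - g1 s).
split=> //; last exact: is_derive_sub.
by near=> s; apply: is_derive_sub; near: s.
Unshelve. all: end_near. Qed.

Lemma jet2_cstM k h d1 d2 : jet2 h d1 d2 ->
  jet2 (fun s => k * h s) (k * d1) (k * d2).
Proof.
move=> [h1 [dh <- d2h]]; exists (fun s => k * h1 s).
split=> //; last exact: is_derive_cstM.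
by near=> s; apply: is_derive_cstM; near: s.
Unshelve. all: end_near. Qed.

Lemma near0_itv (P : R -> Prop) : (\forall s \near (0 : R), P s) ->
  exists2 e : R, 0 < e & forall s : R, `|s| < e -> P s.
Proof.
move=> /nbhs_ballP[e /= e0 He]; exists e => // s se; apply: He.
by rewrite /ball /= sub0r normrN.
Qed.

Lemma small_lt2 a b : 0 < a -> 0 < b -> exists m : R, [/\ 0 < m, m < a & m < b].
Proof.
move=> a0 b0; exists (Num.min a b / 2).
have m0 : 0 < Num.min a b by rewrite lt_min a0.
split; first by rewrite divr_gt0.
  by rewrite ltr_pdivrMr // gt_min; apply/orP; left; lra.
by rewrite ltr_pdivrMr // gt_min; apply/orP; right; lra.
Qed.

(** A positive [d2] makes [h1 s / s] positive near 0, hence [h] strictly larger somewhere to the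
    right of 0. *)
Lemma jet2_max h d1 d2 : jet2 h d1 d2 -> (\forall s \near (0 : R), h s <= h 0) ->
  d1 = 0 /\ d2 <= 0.
Proof.
move=> [h1 [dh h10 d2h]] hmax.
have [e e0 He] : exists2 e : R, 0 < e & forall s : R, `|s| < e ->
    is_derive s (1 : R) h (h1 s) /\ h s <= h 0.
  by apply: near0_itv; apply: filterI.
have d10 : d1 = 0.
  rewrite -h10.
  have [df <-] : is_derive (0 : R) (1 : R) h (h1 0) by apply: (He 0 _).1; rewrite normr0.
  have : is_derive (0 : R) (1 : R) h 0.
    apply: (@derive1_at_max R h (- e) e) => [|t|| t]; rewrite ?in_itv /=.
    - lra.
    - by rewrite -ltr_norml => /He[[]].
    - lra.
    - by rewrite -ltr_norml => /He[].
  by move=> ?; rewrite derive_val.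
split=> //; rewrite leNgt; apply/negP => d20.
have [e' e'0 He'] : exists2 e : R, 0 < e & forall s : R, `|s| < e -> s != 0 ->
    0 < h1 s / s.
  have [dd dE] := d2h.
  have /cvgr_gt/(_ _ d20) : (fun s : R => s^-1 *: (h1 (s *: (1 : R) + 0) - h1 0))
      @ 0^' --> d2.
    by move: dE dd; rewrite /derive /derivable => <- /cvg_ex[l lP]; rewrite (cvg_lim _ lP).
  rewrite near_withinE => /near0_itv[e' e'0 He']; exists e' => // s se s0.
  by have := He' s se s0; rewrite /GRing.scale /= mulr1 addr0 h10 d10 subr0 mulrC.
(* Monotonicity on [[0, m / 2]] is only weak because [h1] vanishes at 0; the strict gain comes from
   the mean value theorem on [[m / 2, m]]. *)
have [m [m0 me me']] := small_lt2 e0 e'0.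
have hm : m / 2 <= m by lra.
have [] := @mean_value h h1 (m / 2) m.
  move=> x; rewrite (min_idPl hm) (max_idPr hm).
  by move=> xm; apply: (He x _).1; rewrite ger0_norm; lra.
move=> c; rewrite (min_idPl hm) (max_idPr hm).
move=> cm E; have h1c : 0 < h1 c.
  have c0 : 0 < c by lra.
  have := He' c; rewrite gtr0_norm // => /(_ ltac:(lra) (lt0r_neq0 c0)) hc.
  by rewrite -(divfK (lt0r_neq0 c0) (h1 c)) mulr_gt0.
have hm2 : h 0 <= h (m / 2).
  apply: (@derive_ge0_le h h1); first lra.
    by move=> x xm; apply: (He x _).1; rewrite ger0_norm; lra.
  move=> x /andP[x0 xm]; have [->|xn0] := eqVneq x 0; first by rewrite h10 d10.
  have xp : 0 < x by rewrite lt_def xn0.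
  have := He' x; rewrite gtr0_norm // => /(_ ltac:(lra) xn0).
  by move=> /ltW/(mulr_ge0 (ltW xp)); rewrite mulrC divfK.
have : h m <= h 0 by apply: (He m _).2; rewrite gtr0_norm.
suff : h (m / 2) < h m by lra.
by rewrite -subr_gt0 E mulr_gt0 //; lra.
Qed.

(** The one-sided condition is that of a maximum reached at the final time of a cylinder. *)
Lemma derive_left_max h x d e : is_derive x 1 h d -> 0 < e ->
  (forall s, x - e < s <= x -> h s <= h x) -> 0 <= d.
Proof.
move=> [dd dE] e0 hmax; rewrite leNgt; apply/negP => d0.
have /cvgr_lt/(_ _ d0) : (fun s : R => s^-1 *: (h (s *: (1 : R) + x) - h x))
      @ 0^' --> d.
  by move: dE dd; rewrite /derive /derivable => <- /cvg_ex[l lP]; rewrite (cvg_lim _ lP).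
rewrite near_withinE => /near0_itv[e' e'0 He'].
have [m [m0 me me']] := small_lt2 e0 e'0.
have := He' (- m); rewrite normrN gtr0_norm // => /(_ me' ltac:(by rewrite oppr_eq0 gt_eqF)).
rewrite /GRing.scale /= mulr1 invrN mulNr oppr_lt0.
have : h (- m + x) <= h x by apply: hmax; lra.
rewrite -subr_le0 => H /lt_le_trans /(_ (mulr_ge0_le0 (ltW _) H)).
by rewrite invr_gt0 m0 ltxx => /(_ isT).
Qed.

End OneVariable.

Section ParabolicMaximumPrinciple.
Context {R : realType} {n : nat}.
Implicit Types (x y : 'rV[R]_n) (r t : R) (z : 'rV[R]_n * R).

(** Closed balls of the sup norm, written by coordinates: compactness is that of a product of
    segments, and a single coordinate can be moved on its own. *)
Definition cube x r : set 'rV[R]_n := [set y | forall i, `|y 0 i - x 0 i| <= r].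

Definition cyl x r t0 t1 : set ('rV[R]_n * R) :=
  [set z | cube x r z.1 /\ t0 <= z.2 <= t1].

Lemma cube_compact x r : compact (cube x r).
Proof.
have := @rV_compact R n (fun i => `[x 0 i - r, x 0 i + r]%classic)
  (fun i => @segment_compact R _ _).
congr compact; apply/seteqP; split=> y /= yP i.
  by have := yP i; rewrite /= in_itv /= ler_distl.
by have := yP i; rewrite /= in_itv /= ler_distl.
Qed.

Lemma cyl_compact x r t0 t1 : compact (cyl x r t0 t1).
Proof.
have := compact_setX (@cube_compact x r) (@segment_compact R t0 t1).
by congr compact; apply/seteqP; split=> z; rewrite /cyl /= in_itv.
Qed.

Lemma add_e_E x i s j : (x + s *: e_ i) 0 j = x 0 j + s * (i == j)%:R.
Proof. by rewrite !mxE eqxx /= eq_sym. Qed.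

Lemma coord_cvg i z : (fun z : 'rV[R]_n * R => z.1 0 i) @ z --> z.1 0 i.
Proof.
apply: (@cvg_comp _ _ _ fst (fun x : 'rV[R]_n => x 0 i) (nbhs z) (nbhs z.1)).
  exact: cvg_fst.
exact: coord_continuous.
Qed.

Lemma cube_line x y r i : (forall j, `|y 0 j - x 0 j| < r) ->
  \forall s \near (0 : R), cube x r (y + s *: e_ i).
Proof.
move=> yr; have e0 : 0 < r - `|y 0 i - x 0 i| by rewrite subr_gt0.
apply: filterS (nbhs0_le e0) => s se j; rewrite add_e_E.
have [<-|_] := eqVneq i j; last by rewrite mulr0 addr0 ltW.
by rewrite mulr1 addrAC (le_trans (ler_normD _ _)) // -lerBrDl.
Qed.

(** At a maximum of [exp (- (L + 1) t) * w] the time derivative gives [(L + 1) * w <= a], while the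
    second derivatives have nonpositive sum; with [a - \sum_i b2 i <= L * w] this is impossible for
    [w > 0]. The hypothesis concerns only the points where [w > 0], and includes that they lie off
    the parabolic boundary. *)
Lemma parabolic_max x0 r t0 t1 (L : R) (w : 'rV[R]_n * R -> R) :
  {within cyl x0 r t0 t1, continuous w} ->
  (forall z, cyl x0 r t0 t1 z -> 0 < w z ->
    [/\ forall i, `|z.1 0 i - x0 0 i| < r, t0 < z.2 &
     exists a (b1 b2 : 'I_n -> R),
      [/\ is_derive z.2 1 (fun t => w (z.1, t)) a,
          forall i, jet2 (fun s => w (z.1 + s *: e_ i, z.2)) (b1 i) (b2 i)
        & a - \sum_i b2 i <= L * w z]]) ->
  forall z, cyl x0 r t0 t1 z -> w z <= 0.
Proof.
move=> cw Hw z cz; rewrite leNgt; apply/negP => wz0.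
pose E (t : R) := expR (- (L + 1) * t).
have [|||p] := @compact_EVT_max _ R (fun z => E z.2 * w z) (cyl x0 r t0 t1).
- by exists z.
- exact: cyl_compact.
- move=> p; apply: cvgM; last exact: cw.
  apply: continuous_subspaceT => {p} p.
  apply: (continuous_comp (g := E)); first exact: cvg_snd.
  apply: continuous_comp; last exact: continuous_expR.
  exact: mulrl_continuous.
rewrite inE => cp pmax.
have E0 t : 0 < E t by exact: expR_gt0.
have wp0 : 0 < w p.
  have := pmax z; rewrite inE => /(_ cz) /(lt_le_trans (mulr_gt0 (E0 _) wz0)).
  by rewrite pmulr_rgt0.
have [pr tp [a [b1 [b2 [da db Hab]]]]] := Hw p cp wp0.
have b2le0 i : b2 i <= 0.
  have [|_ //] := @jet2_max R _ (b1 i) (b2 i) (db i).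
  have := @cube_line _ _ _ i pr; apply: filterS => s cs.
  have := pmax (p.1 + s *: e_ i, p.2); rewrite inE => /(_ _).
  rewrite /= ler_pM2l // scale0r addr0 -surjective_pairing; apply.
  by split=> //=; case: cp.
have : 0 <= E p.2 * (a - (L + 1) * w p).
  apply: (@derive_left_max R (fun t => E t * w (p.1, t)) p.2 _ (p.2 - t0)).
  - have dE : is_derive p.2 1 E (E p.2 * (- (L + 1))).
      apply: (@is_derive_comp R expR (fun t => - (L + 1) * t)).
      exact: is_derive_linear.
    apply: (is_derive_val (is_derive_mul dE da)).
    by rewrite -surjective_pairing; ring.
  - by rewrite subr_gt0.
  - move=> s; rewrite subKr => /andP[ts sp].
    have := pmax (p.1, s); rewrite inE -surjective_pairing; apply.
    case: cp => cp /andP[_ pt1]; split=> //=; rewrite (ltW ts) /=.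
    exact: le_trans pt1.
rewrite pmulr_rge0 // subr_ge0 => aL.
have : \sum_i b2 i <= 0 by apply: sumr_le0.
lra.
Qed.

End ParabolicMaximumPrinciple.

(** * Second order calculus *)

Section DirectionalDerivatives.
Context {R : realType}.

(** Differentiability without division: the inequality also holds at [s = 0], so that expansions can
    be combined on full neighbourhoods. *)
Lemma is_derive_epsP (f : R -> R) (x d : R) :
  is_derive x 1 f d <->
  forall e : R, 0 < e -> \forall s \near (0 : R), `|f (x + s) - f x - d * s| <= e * `|s|.
Proof.
have E (s : R) : s != 0 ->
    `|d - s^-1 *: (f (s *: (1 : R) + x) - f x)| = `|f (x + s) - f x - d * s| / `|s|.
  move=> s0; rewrite /GRing.scale /= mulr1 (addrC s x) -normfV -normrM -normrN.
  by congr `|_|; field.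
split=> [[dd dE] e e0|H].
  have /cvgrPdist_le/(_ _ e0) : (fun s : R => s^-1 *: (f (s *: (1 : R) + x) - f x))
      @ 0^' --> d.
    by move: dE dd; rewrite /derive /derivable => <- /cvg_ex[l lP]; rewrite (cvg_lim _ lP).
  rewrite near_withinE; apply: filterS => s sP.
  have [->|s0] := eqVneq s 0; first by rewrite addr0 subrr mulr0 subr0 normr0 mulr0.
  by have := sP s0; rewrite E // ler_pdivrMr ?normr_gt0.
suff cv : (fun s : R => s^-1 *: (f (s *: (1 : R) + x) - f x)) @ 0^' --> d.
  by apply: DeriveDef; [apply/cvg_ex; exists d|exact: cvg_lim].
apply/cvgrPdist_le => e e0; rewrite near_withinE.
apply: filterS (H e e0) => s sP s0.
by rewrite E // ler_pdivrMr ?normr_gt0.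
Qed.

Lemma near0_normM (k r : R) : 0 < r -> \forall s \near (0 : R), `|s| * k < r.
Proof.
have : (fun s : R => `|s| * k) @ (0 : R) --> `|0 : R| * k.
  by apply: cvgM; [exact: norm_continuous|exact: cvg_cst].
by rewrite normr0 mul0r => /cvgr_lt; apply.
Qed.

Context {V : normedModType R}.
Implicit Types (h : V -> R) (U : set V) (z v w : V).

Lemma is_derive_line h z v (s : R) : derivable h (z + s *: v) v ->
  is_derive s 1 (fun s => h (z + s *: v)) ('D_v h (z + s *: v)).
Proof.
have E : (fun t : R => t^-1 *: (h (t *: v + (z + s *: v)) - h (z + s *: v))) =
  (fun t : R => t^-1 *: (h (z + (t *: (1 : R) + s) *: v) - h (z + s *: v))).
  apply/funext => t; congr (_ *: (h _ - _)).
  have -> : t *: (1 : R) = t by exact: mulr1.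
  by rewrite scalerDl addrCA.
by move=> dh; apply: DeriveDef; rewrite /derivable /derive /= -E.
Qed.

Lemma near_ball z (P : V -> Prop) : (\forall y \near z, P y) ->
  exists2 r : R, 0 < r & forall y, `|y - z| < r -> P y.
Proof.
move=> /nbhs_ballP[r /= r0 rP]; exists r => // y yz; apply: rP.
by rewrite -ball_normE /= distrC.
Qed.

Lemma derivable_derive_line U h z v : open U -> U z ->
  (forall z, U z -> derivable h z v) ->
  \forall s \near (0 : R), is_derive s (1 : R) (fun s => h (z + s *: v)) ('D_v h (z + s *: v)).
Proof.
move=> oU Uz dh.
have [r r0 rP] := near_ball (open_nbhs_nbhs (conj oU Uz)).
apply: filterS (near0_normM `|v| r0) => s sr; apply: is_derive_line; apply: dh; apply: rP.
by rewrite addrAC subrr add0r normrZ.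
Qed.

(* The chain rule is only needed along the curves [z + rho s *: v + s *: w];
   it follows from the mean value theorem in the direction [v]. *)
Lemma C1_curve U h z v w (rho : R -> R) (rho' : R) :
  open U -> U z -> Ck_on U 1 h -> rho 0 = 0 -> is_derive (0 : R) (1 : R) rho rho' ->
  is_derive (0 : R) (1 : R) (fun s => h (z + rho s *: v + s *: w))
    (rho' * 'D_v h z + 'D_w h z).
Proof.
move=> oU Uz [ch dh] rho0 drho; apply/is_derive_epsP => e e0.
have [dv [cv _]] := dh v; have [dw _] := dh w.
set D := 'D_v h z in cv *; set a := `|D|; set b := `|rho'|.
have e30 : 0 < e / 3 by lra.
pose e1 := e / 3 / (b + 1); have b1 : 0 < b + 1 by exact: ltr_wpDl (normr_ge0 _) ltr01.
have e10 : 0 < e1 by rewrite divr_gt0.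
pose e2 := Num.min 1 (e / 3 / (a + 1)); have a1 : 0 < a + 1 by exact: ltr_wpDl (normr_ge0 _) ltr01.
have e20 : 0 < e2 by rewrite lt_min ltr01 divr_gt0.
have [r r0 rP] : exists2 r : R, 0 < r & forall y, `|y - z| < r ->
    U y /\ `|'D_v h y - D| <= e1.
  have /cvgrPdist_le/(_ _ e10) cvz := cv z Uz.
  apply: near_ball; apply: filterS2 (open_nbhs_nbhs (conj oU Uz)) cvz => y Uy.
  by rewrite distrC.
have rho_near := (is_derive_epsP rho 0 rho').1 drho e2 e20.
have w_near : \forall s \near (0 : R), `|h (z + s *: w) - h z - 'D_w h z * s| <= e / 3 * `|s|.
  have := derivable_derive_line oU Uz dw => /nbhs_singleton; rewrite scale0r addr0.
  move=> /is_derive_epsP /(_ _ e30); apply: filterS => s.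
  by rewrite add0r scale0r addr0.
have small := near0_normM (`|w| + (b + 1) * `|v|) r0.
apply: filterS3 rho_near w_near small => s.
rewrite !add0r rho0 subr0 !scale0r !addr0 => rho_s w_s sr.
have rho_le : `|rho s| <= (b + 1) * `|s|.
  have -> : rho s = (rho s - rho' * s) + rho' * s by ring.
  apply: (le_trans (ler_normD _ _)); rewrite normrM mulrDl mul1r addrC lerD2l.
  apply: (le_trans rho_s); rewrite ler_piMl //.
  by rewrite /e2 ge_min lexx.
have inU c : `|c| <= `|rho s| -> U (z + s *: w + c *: v) /\
    `|'D_v h (z + s *: w + c *: v) - D| <= e1.
  move=> cr; apply: rP; rewrite -(addrA z) [z + _]addrC addrK.
  apply: le_lt_trans sr; apply: (le_trans (ler_normD _ _)); rewrite !normrZ.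
  rewrite mulrDr lerD2l mulrA ler_wpM2r // mulrC.
  exact: le_trans rho_le.
have [|c cr E] := @mean_value0 R (fun c => h (z + s *: w + c *: v))
    (fun c => 'D_v h (z + s *: w + c *: v)) (rho s).
  by move=> c cr; apply: is_derive_line; apply: dv; apply: (inU c _).1.
have [_ Dc] := inU c cr; move: E; rewrite scale0r addr0 => E.
set Y := 'D_v h _ in E Dc; clearbody Y.
have -> : h (z + rho s *: v + s *: w) - h z - (rho' * D + 'D_w h z) * s =
   ((Y - D) * rho s + D * (rho s - rho' * s)) + (h (z + s *: w) - h z - 'D_w h z * s).
  have -> : h (z + rho s *: v + s *: w) = Y * rho s + h (z + s *: w).
    by rewrite (addrAC z) -E subrK.
  by ring.
have -> : e * `|s| = (e / 3 * `|s| + e / 3 * `|s|) + e / 3 * `|s| by field.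
apply: (le_trans (ler_normD _ _)); apply: lerD => //.
apply: (le_trans (ler_normD _ _)); apply: lerD; rewrite normrM.
  have -> : e / 3 * `|s| = e1 * ((b + 1) * `|s|) by rewrite /e1; field; rewrite gt_eqF.
  exact: ler_pM.
apply: (@le_trans _ _ (a * (e / 3 / (a + 1) * `|s|))).
  rewrite ler_wpM2l //; apply: (le_trans rho_s); rewrite ler_wpM2r //.
  by rewrite /e2 ge_min lexx orbT.
rewrite mulrA ler_wpM2r // mulrCA ger_pMr // ler_pdivrMr //; lra.
Qed.

End DirectionalDerivatives.

Section SecondOrder.
Context {R : realType} {V : normedModType R}.
Implicit Types (h : V -> R) (U : set V) (z v w : V).

Lemma Ck_onW U h : Ck_on U 2 h -> Ck_on U 1 h.
Proof.
case=> ch dh; split=> // v; have [dv [cv _]] := dh v.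
by split=> //; split.
Qed.

Lemma Ck_onD U h v : Ck_on U 2 h -> Ck_on U 1 ('D_v h).
Proof. by case=> _ /(_ v)[]. Qed.

(** [Ck_on] only speaks of directional derivatives; their linearity in the direction follows from
    their continuity, through [C1_curve] with [rho s = k * s]. *)
Lemma C1_derive_linear U h z v w (k : R) : open U -> U z -> Ck_on U 1 h ->
  'D_(k *: v + w) h z = k * 'D_v h z + 'D_w h z.
Proof.
move=> oU Uz Ch; have dk : is_derive (0 : R) (1 : R) (fun s => k * s) k.
  exact: is_derive_linear.
have H1 := @C1_curve R V U h z v w (fun s => k * s) k oU Uz Ch (mulr0 k) dk.
have [_ /(_ (k *: v + w))[dkvw _]] := Ch.
have /nbhs_singleton H2 := derivable_derive_line oU Uz dkvw.
rewrite scale0r addr0 in H2.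
have E : (fun s : R => h (z + s *: (k *: v + w))) =
    (fun s => h (z + (k * s) *: v + s *: w)).
  by apply/funext => s; rewrite scalerDr scalerA addrA mulrC.
by rewrite E in H2; rewrite -(@derive_val _ _ _ _ _ _ _ H2) -(@derive_val _ _ _ _ _ _ _ H1).
Qed.

Lemma C1_derive0 U h z : open U -> U z -> Ck_on U 1 h -> 'D_0 h z = 0.
Proof.
move=> oU Uz Ch; have := @C1_derive_linear U h z 0 0 1 oU Uz Ch.
by rewrite scaler0 addr0 mul1r => /eqP; rewrite -subr_eq0 opprD addNKr oppr_eq0 => /eqP.
Qed.

Lemma C1_derive_sum U h z (I : finType) (k : I -> R) (v : I -> V) w :
  open U -> U z -> Ck_on U 1 h ->
  'D_(\sum_i k i *: v i + w) h z = \sum_i k i * 'D_(v i) h z + 'D_w h z.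
Proof.
move=> oU Uz Ch; elim: (index_enum I) => [|i r IH].
  by rewrite !big_nil !add0r.
by rewrite !big_cons -!addrA (C1_derive_linear _ _ _ oU Uz Ch) IH.
Qed.

(** Two mean value theorems, in [v] and then in [w], express the second difference by the mixed
    derivative at an intermediate point. The difference is symmetric in [v] and [w], hence so is the
    limit. *)
Lemma mixed_difference U h z v w (e : R) : open U -> U z -> Ck_on U 2 h -> 0 < e ->
  \forall s \near (0 : R),
   `|h (z + s *: v + s *: w) - h (z + s *: v) - h (z + s *: w) + h z
     - s ^+ 2 * 'D_w ('D_v h) z| <= e * s ^+ 2.
Proof.
move=> oU Uz Ch e0; have [_ /(_ v)[dv Cv]] := Ch.
have [_ /(_ w)[dw [cw _]]] := Cv.
have /cvgrPdist_le/(_ _ e0) cwz := cw z Uz.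
have [r r0 rP] := near_ball (filterI (open_nbhs_nbhs (conj oU Uz)) cwz).
apply: filterS (near0_normM (`|v| + `|w|) r0) => s sr.
have inb (a b : R) : `|a| <= `|s| -> `|b| <= `|s| ->
    U (z + a *: v + b *: w) /\ `|'D_w ('D_v h) z - 'D_w ('D_v h) (z + a *: v + b *: w)| <= e.
  move=> sa sb; apply: rP; rewrite -(addrA z) [z + _]addrC addrK.
  apply: le_lt_trans sr; apply: (le_trans (ler_normD _ _)); rewrite !normrZ.
  by rewrite mulrDr lerD // ler_wpM2r.
have [|c cs E1] := @mean_value0 R
    (fun a => h (z + s *: w + a *: v) - h (z + a *: v))
    (fun a => 'D_v h (z + s *: w + a *: v) - 'D_v h (z + a *: v)) s.
  move=> c cs; apply: is_derive_sub; apply: is_derive_line; apply: dv.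
    by rewrite (addrAC z); have [] := inb c s cs (lexx _).
  by have [] := inb c 0 cs ltac:(by rewrite normr0); rewrite scale0r addr0.
have [|d ds E2] := @mean_value0 R
    (fun b => 'D_v h (z + c *: v + b *: w))
    (fun b => 'D_w ('D_v h) (z + c *: v + b *: w)) s.
  move=> d ds; apply: is_derive_line; apply: dw.
  by have [] := inb c d cs ds.
have [_ He] := inb c d cs ds.
move: E1 E2; rewrite !scale0r !addr0 (addrAC z (s *: w)) => E1 E2.
rewrite (addrAC z (s *: w)) in E1.
have -> : h (z + s *: v + s *: w) - h (z + s *: v) - h (z + s *: w) + h z =
    s ^+ 2 * 'D_w ('D_v h) (z + c *: v + d *: w).
  transitivity (h (z + s *: v + s *: w) - h (z + s *: v) - (h (z + s *: w) - h z)).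
    by ring.
  by rewrite E1 E2; ring.
move: He; move: ('D_w ('D_v h) _) ('D_w ('D_v h) z) => X Y He.
have s20 : 0 <= s ^+ 2 by exact: sqr_ge0.
by rewrite -mulrBr normrM (ger0_norm s20) mulrC distrC; apply: ler_wpM2r.
Qed.

Lemma derive_symmetric U h z v w : open U -> U z -> Ck_on U 2 h ->
  'D_v ('D_w h) z = 'D_w ('D_v h) z.
Proof.
move=> oU Uz Ch; apply/eqP; rewrite -subr_eq0 -normr_le0; apply/ler_addgt0Pl => e e0.
rewrite addr0; have e20 : 0 < e / 2 by lra.
have /near0_itv[r1 r10 rP1] := mixed_difference v w oU Uz Ch e20.
have /near0_itv[r2 r20 rP2] := mixed_difference w v oU Uz Ch e20.
have [s [s0 sr1 sr2]] := small_lt2 r10 r20.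
have H1 := rP1 s ltac:(by rewrite gtr0_norm).
have H2 := rP2 s ltac:(by rewrite gtr0_norm).
have s20 : 0 < s ^+ 2 by rewrite exprn_gt0.
rewrite (addrAC z (s *: w)) in H2; move: H1 H2.
move: ('D_v ('D_w h) z) ('D_w ('D_v h) z) (h _) (h _) (h _) (h _) => A B d c b a.
move: (s ^+ 2) s20 => S S0 H1 H2.
rewrite -(ler_pM2r S0) -[X in _ * X <= _](gtr0_norm S0) -normrM.
have -> : (A - B) * S = (a - b - c + d - S * B) - (a - c - b + d - S * A) by ring.
apply: (le_trans (ler_normB _ _)).
have -> : e * S = e / 2 * S + e / 2 * S by field.
exact: lerD.
Qed.

Lemma second_derive_sum U h z (I : finType) (k : I -> R) (v : I -> V) (W := \sum_i k i *: v i) :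
  open U -> U z -> Ck_on U 2 h ->
  'D_W ('D_W h) z = \sum_i \sum_j k i * k j * 'D_(v i) ('D_(v j) h) z.
Proof.
move=> oU Uz Ch.
have lin g : Ck_on U 1 g -> 'D_W g z = \sum_i k i * 'D_(v i) g z.
  move=> Cg; have := C1_derive_sum k v 0 oU Uz Cg.
  by rewrite addr0 (C1_derive0 oU Uz Cg) addr0.
rewrite lin; last exact: Ck_onD.
rewrite exchange_big /=; apply: eq_bigr => j _.
rewrite (derive_symmetric _ _ oU Uz Ch) lin; last exact: Ck_onD.
by rewrite mulr_sumr; apply: eq_bigr => i _; rewrite mulrA (mulrC (k j)).
Qed.

(** The bound is integrated twice through monotonicity. A lower expansion suffices, since the test
    functions will be bounded from above off the settled set. *)
Lemma taylor_lower U h z W (m : R) : open U -> Ck_on U 2 h ->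
  (forall s : R, 0 <= s <= 1 -> U (z + s *: W) /\ m <= 'D_W ('D_W h) (z + s *: W)) ->
  h z + 'D_W h z + m / 2 <= h (z + W).
Proof.
move=> oU Ch H; have [_ /(_ W)[dW [_ /(_ W)[dWW _]]]] := Ch.
have Us (s : R) : 0 <= s <= 1 -> U (z + s *: W) by move=> /H[].
pose g1 s := 'D_W h (z + s *: W).
have dg1 (s : R) : 0 <= s <= 1 -> is_derive s 1 g1 ('D_W ('D_W h) (z + s *: W)).
  by move=> s01; apply: is_derive_line; apply: dWW; exact: Us.
have g1_ge (s : R) : 0 <= s <= 1 -> 0 <= g1 s - g1 0 - m * s.
  move=> /andP[s0 s1].
  have := @derive_ge0_le R (fun s => g1 s - m * s)
    (fun s => 'D_W ('D_W h) (z + s *: W) - m) 0 s s0.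
  rewrite mulr0 subr0 => H1; suff : g1 0 <= g1 s - m * s by lra.
  apply: H1 => x /andP[x0 xs]; have x01 : 0 <= x <= 1 by rewrite x0 (le_trans xs).
    by apply: is_derive_sub; [exact: dg1|exact: is_derive_linear].
  by rewrite subr_ge0; case: (H x x01).
have := @derive_ge0_le R (fun s => h (z + s *: W) - g1 0 * s - m / 2 * s ^+ 2)
    (fun s => g1 s - g1 0 - m * s) 0 1 ler01.
rewrite scale0r scale1r addr0 !mulr0 expr0n /= mulr0 !mulr1 expr1n mulr1 !subr0.
have g10 : g1 0 = 'D_W h z by rewrite /g1 scale0r addr0.
move=> H1; suff : h z <= h (z + W) - g1 0 - m / 2.
  by rewrite -g10; move: (h z) (h (z + W)) (g1 0) => a b c; lra.
apply: H1 => x x01; last exact: g1_ge.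
apply: is_derive_sub.
  apply: is_derive_sub; last exact: is_derive_linear.
  by apply: is_derive_line; apply: dW; exact: Us.
apply: (is_derive_val (is_derive_cstM (m / 2) (is_derive_mul (is_derive_idr x) (is_derive_idr x)))).
by rewrite mul1r mulr1; field.
Qed.

End SecondOrder.

Section CurveJets.
Context {R : realType}.

Lemma is_derive_at0 (f : R -> R) (x d : R) :
  is_derive (0 : R) (1 : R) (fun s => f (x + s)) d <-> is_derive x 1 f d.
Proof.
rewrite !is_derive_epsP; split=> H e e0; have := H e e0; apply: filterS => s;
  by rewrite add0r addr0.
Qed.

(** Chain rule for profiles [q (rho s) (x + s e_i)]: [v] is the direction of the wave variable and
    [w] that of the coordinate. *)
Lemma C2_curve_jet2 (V : normedModType R) (h : V -> R) (z v w : V) (rho : R -> R)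
    (r1 r2 : R) : Ck_on setT 2 h -> rho 0 = 0 -> jet2 rho r1 r2 ->
  jet2 (fun s => h (z + rho s *: v + s *: w)) (r1 * 'D_v h z + 'D_w h z)
    (r1 ^+ 2 * 'D_v ('D_v h) z + 2 * r1 * 'D_v ('D_w h) z + r2 * 'D_v h z
     + 'D_w ('D_w h) z).
Proof.
move=> Ch rho0 [rho1 [drho rho10 drho1]].
pose gam s := z + rho s *: v + s *: w.
have gam0 : gam 0 = z by rewrite /gam rho0 !scale0r !addr0.
have dgam (g : V -> R) (s : R) : Ck_on setT 1 g -> is_derive s 1 rho (rho1 s) ->
    is_derive s 1 (fun s => g (gam s)) (rho1 s * 'D_v g (gam s) + 'D_w g (gam s)).
  move=> Cg ds; apply/is_derive_at0.
  have -> : (fun t => g (gam (s + t))) =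
      (fun t => g (gam s + (rho (s + t) - rho s) *: v + t *: w)).
    apply/funext => t; congr g; rewrite /gam scalerBl scalerDl.
    rewrite -!addrA; congr (z + _).
    set a := rho s *: v; set b := s *: w; set c := _ *: v; set d := t *: w.
    by rewrite (addrCA b c) (addrCA a c) (addrCA b (- a)) (addrA a (- a)) subrr add0r.
  apply: (@C1_curve R V setT) => //; first exact: openT.
    by rewrite addr0 subrr.
  have dc : is_derive (0 : R) (1 : R) (fun _ => rho s) 0 by exact: is_derive_cst.
  apply: (is_derive_val (is_derive_sub _ dc) (subr0 _)).
  exact/is_derive_at0.
have d0 := nbhs_singleton drho.
exists (fun s => rho1 s * 'D_v h (gam s) + 'D_w h (gam s)); split.
- by near=> s; apply: dgam; [exact: Ck_onW|near: s].
- by rewrite gam0 rho10.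
- have dv := dgam _ 0 (Ck_onD v Ch) d0; have dw := dgam _ 0 (Ck_onD w Ch) d0.
  apply: (is_derive_val (is_derive_add (is_derive_mul drho1 dv) dw)).
  rewrite gam0 rho10 (derive_symmetric w v openT _ Ch) //.
  by move: ('D_v _ _) ('D_v _ _) ('D_v _ _) ('D_w _ _) => a b c d; ring.
Unshelve. all: end_near. Qed.

Lemma C2_jet2 (V : normedModType R) (U : set V) (h : V -> R) (z v : V) :
  open U -> U z -> Ck_on U 2 h ->
  jet2 (fun s => h (z + s *: v)) ('D_v h z) ('D_v ('D_v h) z).
Proof.
move=> oU Uz [_ /(_ v)[dv [_ /(_ v)[dvv _]]]].
exists (fun s => 'D_v h (z + s *: v)); split.
- exact: derivable_derive_line oU Uz dv.
- by rewrite scale0r addr0.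
- by have /nbhs_singleton := derivable_derive_line oU Uz dvv; rewrite scale0r addr0.
Qed.

End CurveJets.

Section SpaceTime.
Context {R : realType} {n : nat}.
Implicit Types (u phi : 'rV[R]_n * R -> R) (z : 'rV[R]_n * R).

Let ex (i : 'I_n) : 'rV[R]_n * R := (e_ i, 0).
Let et : 'rV[R]_n * R := (0, 1).

(** The difference quotients coincide, so the identity holds whether or not the derivatives
    exist. *)
Lemma derive_slice u (x v : 'rV[R]_n) (t : R) :
  'D_v (fun y => u (y, t)) x = 'D_((v, 0 : R)) u (x, t).
Proof.
have E : (fun s : R => s^-1 *: (u (s *: v + x, t) - u (x, t))) =
    (fun s : R => s^-1 *: (u (s *: (v, 0 : R) + (x, t)) - u (x, t))).
  apply/funext => s; congr (_ *: (u (_, _) - _)).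
  by rewrite /= scaler0 add0r.
exact: (congr1 (fun f => lim (f @ 0^')) E).
Qed.

Lemma dtE u z : dt u z = 'D_et u z.
Proof.
rewrite /dt derive1E; case: z => x t /=.
have E : (fun s : R => s^-1 *: (u (x, s *: (1 : R) + t) - u (x, t))) =
    (fun s : R => s^-1 *: (u (s *: et + (x, t)) - u (x, t))).
  apply/funext => s; congr (_ *: (u (_, _) - _)).
  by rewrite /= scaler0 add0r.
exact: (congr1 (fun f => lim (f @ 0^')) E).
Qed.

Lemma grad_xE u z i : grad_x u z 0 i = 'D_(ex i) u z.
Proof.
by rewrite mxE; have := derive_slice u z.1 (e_ i) z.2; rewrite -surjective_pairing.
Qed.

Lemma hess_xE u z i j : hess_x u z i j = 'D_(ex i) ('D_(ex j) u) z.
Proof.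
rewrite mxE [X in 'D_(e_ i) X _](_ : _ = fun y => 'D_(ex j) u (y, z.2)).
  have := derive_slice ('D_(ex j) u) z.1 (e_ i) z.2.
  by rewrite -surjective_pairing.
by apply/funext => y; exact: derive_slice.
Qed.

Lemma open_Qpos : open (@Qpos R n).
Proof.
have -> : @Qpos R n = snd @^-1` [set t | 0 < t] by [].
by apply: open_comp; [move=> ? _; exact: cvg_snd|exact: open_gt].
Qed.

Lemma near_Qpos z : Qpos z -> \forall y \near z, Qpos y.
Proof. by move=> Qz; apply: open_nbhs_nbhs; split; [exact: open_Qpos|]. Qed.

Lemma hess_x_sym u z : Ck_on Qpos 2 u -> Qpos z -> (hess_x u z)^T = hess_x u z.
Proof.
move=> Cu Qz; apply/matrixP => i j; rewrite mxE !hess_xE.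
by apply: (derive_symmetric _ _ _ Qz Cu); exact: open_Qpos.
Qed.

Lemma C21_jet2 u z i : C21 u -> Qpos z ->
  jet2 (fun s => u (z.1 + s *: e_ i, z.2)) (grad_x u z 0 i) (hess_x u z i i).
Proof.
move=> Cu Qz; exists (fun s => 'D_(e_ i) (fun y => u (y, z.2)) (z.1 + s *: e_ i)); split.
- near=> s; apply: (@is_derive_line R _ (fun y => u (y, z.2))).
  by case: (Cu (z.1 + s *: e_ i, z.2) Qz) => _ du _ _; exact: du.
- by rewrite scale0r addr0 mxE.
- rewrite mxE -[X in 'D__ _ X]addr0 -[X in _ + X](scale0r (e_ i)).
  apply: (@is_derive_line R _ ('D_(e_ i) (fun y => u (y, z.2)))).
  by rewrite scale0r addr0; case: (Cu z Qz) => _ _ du _; exact: du.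
Unshelve. all: end_near. Qed.

Lemma C21_dt u z : C21 u -> Qpos z ->
  is_derive z.2 1 (fun t => u (z.1, t)) (dt u z).
Proof. by move=> Cu /Cu[du _ _ _]; apply: DeriveDef => //; rewrite /dt derive1E. Qed.

End SpaceTime.

Section ParabolicTaylor.
Context {R : realType} {n : nat}.
Implicit Types (phi : 'rV[R]_n * R -> R) (z : 'rV[R]_n * R).

Definition quad (X : 'M[R]_n) (x y : 'rV[R]_n) : R :=
  \sum_i \sum_j x 0 i * X i j * y 0 j.

Definition dotv (x y : 'rV[R]_n) : R := \sum_i x 0 i * y 0 i.

Lemma dotv_ge0 (x : 'rV[R]_n) : 0 <= dotv x x.
Proof. by apply: sumr_ge0 => i _; rewrite -expr2 sqr_ge0. Qed.

Lemma sqr_le_dotv (x : 'rV[R]_n) i : x 0 i ^+ 2 <= dotv x x.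
Proof.
rewrite /dotv (bigD1 i) //= -expr2 lerDl; apply: sumr_ge0 => j _.
by rewrite -expr2 sqr_ge0.
Qed.

Lemma sum2_ord_recl (G : 'I_n.+1 -> 'I_n.+1 -> R) :
  \sum_i \sum_j G i j = G ord0 ord0 + \sum_i G ord0 (lift ord0 i)
    + \sum_i G (lift ord0 i) ord0
    + \sum_i \sum_j G (lift ord0 i) (lift ord0 j).
Proof.
rewrite big_ord_recl [X in X + _ = _]big_ord_recl -!addrA; do 2 congr (_ + _).
by rewrite -big_split /=; apply: eq_bigr => i _; rewrite big_ord_recl.
Qed.

(** The mixed terms [t * x_i] are absorbed by a small multiple of the squares of the [x_i] and a
    large multiple of [t ^+ 2]; the index [ord0] stands for time. *)
Lemma quadratic_bound (A : 'I_n.+1 -> 'I_n.+1 -> R) (t kap : R) (x : 'rV[R]_n)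
    (k : 'I_n.+1 -> R) :
  (forall i j, A i j = A j i) -> k ord0 = t -> (forall i, k (lift ord0 i) = x 0 i) ->
  0 < kap ->
  (\sum_i \sum_j x 0 i * A (lift ord0 i) (lift ord0 j) * x 0 j) / 2
    - kap * dotv x x
    - ((\sum_i A ord0 (lift ord0 i) ^+ 2) / kap + `|A ord0 ord0| + kap) * t ^+ 2
  <= (\sum_i \sum_j k i * k j * A i j - kap * (dotv x x + t ^+ 2)) / 2.
Proof.
move=> symA k0 kl kap0; set Q := \sum_i \sum_j _ * _ * x 0 j.
pose B i : R := A ord0 (lift ord0 i).
have -> : \sum_i \sum_j k i * k j * A i j =
    t ^+ 2 * A ord0 ord0 + 2 * (\sum_i t * x 0 i * B i) + Q.
  rewrite sum2_ord_recl k0 (eq_bigr (fun i => t * x 0 i * B i)) //; last first.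
    by move=> i _; rewrite kl.
  rewrite [X in _ + X + _](eq_bigr (fun i => t * x 0 i * B i)) //; last first.
    by move=> i _; rewrite kl symA (mulrC _ t).
  rewrite [X in _ + X = _](_ : _ = Q).
    by move: (\sum_i t * _ * _) (A _ _) Q => s a q; ring.
  by apply: eq_bigr => i _; apply: eq_bigr => j _; rewrite !kl mulrAC.
have : 0 <= \sum_i (kap / 2 * (x 0 i * x 0 i) + t * x 0 i * B i + t ^+ 2 / kap * B i ^+ 2).
  apply: sumr_ge0 => i _; move: (x 0 i) (B i) => a b.
  have -> : kap / 2 * (a * a) + t * a * b + t ^+ 2 / kap * b ^+ 2 =
    (kap * a + t * b) ^+ 2 / (2 * kap) + (t * b) ^+ 2 / (2 * kap).
    by field; rewrite gt_eqF.
  have k2 : 0 <= 2 * kap by rewrite mulr_ge0 // ltW.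
  by apply: addr_ge0; apply: divr_ge0 => //; exact: sqr_ge0.
rewrite !big_split /= -!mulr_sumr -/(dotv x x).
have := ler_norm (- A ord0 ord0); rewrite normrN; have := normr_ge0 (A ord0 ord0).
have := sqr_ge0 t; have := dotv_ge0 x.
have -> : t ^+ 2 / kap * \sum_i B i ^+ 2 = (\sum_i B i ^+ 2) / kap * t ^+ 2 by ring.
rewrite -/(\sum_i B i ^+ 2).
move: (dotv x x) (t ^+ 2) (A ord0 ord0) (`|A ord0 ord0|) (\sum_i _ * B _) ((\sum_i B i ^+ 2) / kap) Q.
move=> d T a aA s1 s2 q d0 T0 aA0 aAa H.
rewrite -subr_ge0.
have -> : (T * a + 2 * s1 + q - kap * (d + T)) / 2 - (q / 2 - kap * d - (s2 + aA + kap) * T) =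
  (kap / 2 * d + s1 + s2 * T) + (kap * T / 2 + T * (aA + a) / 2 + aA * T / 2) by field.
rewrite addr_ge0 // !addr_ge0 // divr_ge0 // mulr_ge0 ?(ltW kap0) //.
lra.
Qed.

Lemma rV_norm_lt (x : 'rV[R]_n) (r : R) : 0 < r ->
  (`|x| < r) <-> (forall i, `|x 0 i| < r).
Proof.
move=> r0; have -> : `|x| = \big[Num.max/0]_ij `|x ij.1 ij.2| := mx_normrE x.
split=> [/bigmax_ltP[_ H] i|H]; first exact: (H (0, i)).
by apply/bigmax_ltP; split=> // -[a i] _; rewrite ord1.
Qed.

(** Time matters to first order only, so [t ^+ 2] may carry a large constant, whereas the spatial
    loss [kap] must be arbitrarily small: it alters the Hessian. *)
Lemma parabolic_taylor phi z (kap : R) : Ck_on Qpos 2 phi -> Qpos z -> 0 < kap ->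
  exists K r : R, [/\ 0 <= K, 0 < r & forall (x : 'rV[R]_n) (t : R),
    (forall i, `|x 0 i| < r) -> `|t| < r ->
    phi z + t * dt phi z + dotv (grad_x phi z) x + quad (hess_x phi z) x x / 2
      - kap * dotv x x - K * t ^+ 2 <= phi (z.1 + x, z.2 + t)].
Proof.
move=> Cphi Qz kap0.
pose v (i : 'I_n.+1) : 'rV[R]_n * R :=
  if unlift ord0 i is Some j then (e_ j, 0) else (0, 1).
pose A i j y : R := 'D_(v i) ('D_(v j) phi) y.
have cA i j : {for z, continuous (A i j)}.
  by case: Cphi => _ /(_ (v j))[_ [_ /(_ (v i))[_ [cA _]]]]; exact: cA.
have [N [N0 NE]] : exists N : R, 0 < N /\ forall a : R, a *+ n.+1 = a * N.
  by exists n.+1%:R; split=> [|a]; [rewrite ltr0n|rewrite mulr_natr].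
(* Each of the [(n + 1)^2] second derivatives may vary by [kap / (n + 1)^2]. *)
pose del := kap / N ^+ 2.
have del0 : 0 < del by rewrite divr_gt0 // exprn_gt0.
have [r1 r10 rP1] := near_ball (open_nbhs_nbhs (conj open_Qpos Qz)).
have [r2 r20 rP2] : exists2 r : R, 0 < r & forall y, `|y - z| < r ->
    forall i j, `|A i j z - A i j y| <= del.
  apply: near_ball.
  apply: (@filter_forall _ _ (fun i y => forall j, `|A i j z - A i j y| <= del) (nbhs z)) => i.
  apply: (@filter_forall _ _ (fun j y => `|A i j z - A i j y| <= del) (nbhs z)) => j.
  by have /cvgrPdist_le/(_ _ del0) := cA i j.
have [r [r0 rr1 rr2]] := small_lt2 r10 r20.
pose B (i : 'I_n) : R := A ord0 (lift ord0 i) z.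
exists ((\sum_i B i ^+ 2) / kap + `|A ord0 ord0 z| + kap), r; split=> //.
  rewrite !addr_ge0 ?(ltW kap0) // divr_ge0 ?(ltW kap0) //.
  by apply: sumr_ge0 => i _; rewrite sqr_ge0.
move=> x t xr tr.
pose k (i : 'I_n.+1) : R := if unlift ord0 i is Some j then x 0 j else t.
pose S := dotv x x + t ^+ 2.
have kk i j : `|k i * k j| <= S.
  have k2 a : k a ^+ 2 <= S.
    rewrite /k /S; case: (unlift ord0 a) => [b|]; last by rewrite lerDr dotv_ge0.
    by apply: (le_trans (sqr_le_dotv x b)); rewrite lerDl sqr_ge0.
  rewrite normrM; have := k2 i; have := k2 j; rewrite /S; have := sqr_ge0 (`|k i| - `|k j|).
  rewrite sqrrB !real_normK ?num_real //.
  move: (`|k i| * `|k j|) (k i ^+ 2) (k j ^+ 2) (dotv x x + t ^+ 2) => a b c d.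
  by rewrite mulr2n; lra.
have vkE : \sum_i k i *: v i = (x, t).
  rewrite big_ord_recl /k /v unlift_none.
  under eq_bigr do rewrite liftK.
  have -> : \sum_(i < n) x 0 i *: (e_ i, 0 : R) = (x, 0).
    have : forall s : seq 'I_n, \sum_(i <- s) x 0 i *: (e_ i, 0 : R) =
        (\sum_(i <- s) x 0 i *: e_ i, 0).
      elim=> [|i s IH]; first by rewrite !big_nil.
      by rewrite !big_cons IH; congr pair; rewrite /= scaler0 addr0.
    by move=> ->; rewrite -row_sum_delta.
  apply/pair_equal_spec; split=> /=; first by rewrite scaler0 add0r.
  by rewrite addr0; exact: mulr1.
have k0 : k ord0 = t by rewrite /k unlift_none.
have kl i : k (lift ord0 i) = x 0 i by rewrite /k liftK.
have inr (s : R) : 0 <= s <= 1 -> `|z + s *: (x, t) - z| < r.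
  move=> /andP[s0 s1]; rewrite addrC addKr; rewrite prod_normE /= gt_max.
  have sr a : `|a| < r -> `|s * a| < r.
    by move=> ar; rewrite normrM (ger0_norm s0); apply: le_lt_trans ar; rewrite ler_piMl.
  apply/andP; split; last exact: sr.
  by apply/rV_norm_lt => // i; rewrite mxE; exact: sr.
have -> : (z.1 + x, z.2 + t) = z + (x, t) by [].
pose m := \sum_i \sum_j k i * k j * A i j z - kap * S.
have := @taylor_lower R _ Qpos phi z (x, t) m open_Qpos Cphi.
have D1 : 'D_(x, t) phi z = t * dt phi z + dotv (grad_x phi z) x.
  have := C1_derive_sum k v 0 open_Qpos Qz (Ck_onW Cphi).
  rewrite addr0 vkE (C1_derive0 open_Qpos Qz (Ck_onW Cphi)) addr0 => ->.
  rewrite big_ord_recl /k /v unlift_none dtE; congr (_ + _).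
  by rewrite /dotv; apply: eq_bigr => i _; rewrite liftK grad_xE mulrC.
have symA i j : A i j z = A j i z by exact: (derive_symmetric _ _ open_Qpos Qz Cphi).
have mE := @quadratic_bound _ t kap x k symA k0 kl kap0.
have QE : quad (hess_x phi z) x x =
    \sum_i \sum_j x 0 i * A (lift ord0 i) (lift ord0 j) z * x 0 j.
  apply: eq_bigr => i _; apply: eq_bigr => j _.
  by rewrite hess_xE /A /v !liftK.
rewrite -QE in mE.
move=> H; apply: le_trans (H _); last first.
  move=> s s01; have sin := inr s s01; split.
    by apply: rP1; apply: lt_trans sin rr1.
  rewrite -vkE (second_derive_sum k v open_Qpos _ Cphi); last first.
    by rewrite vkE; apply: rP1; apply: lt_trans sin rr1.
  rewrite /m lerBlDl -lerBlDr -sumrB.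
  have -> : kap * S = \sum_(i < n.+1) \sum_(j < n.+1) S * del.
    rewrite !sumr_const card_ord !NE /del; field.
    by rewrite gt_eqF.
  apply: ler_sum => i _; rewrite -sumrB; apply: ler_sum => j _.
  rewrite vkE -mulrBr; apply: (le_trans (ler_norm _)); rewrite normrM.
  by apply: ler_pM => //; apply: rP2; apply: lt_trans sin rr2.
rewrite D1; move: mE.
move: ((\sum_i B i ^+ 2) / kap + _ + kap) => K.
move: (phi z) (t * dt phi z) (dotv _ x) (quad _ x x / 2) (kap * dotv x x) (m / 2) (_ * t ^+ 2).
move=> a b c d e f g H1; lra.
Qed.

End ParabolicTaylor.

Lemma cvg_fun2 {R : realType} {U V : topologicalType} {T : Type} (F : set_system T)
    {FF : Filter F} (g : U * V -> R) (a : T -> U) (b : T -> V) a0 b0 :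
  a @ F --> a0 -> b @ F --> b0 -> {for (a0, b0), continuous g} ->
  g (a t, b t) @[t --> F] --> g (a0, b0).
Proof.
move=> ca cb cg.
have cab : (fun t => (a t, b t)) @ F --> nbhs (a0, b0) by exact: cvg_pair.
exact: cvg_comp cab cg.
Qed.

(** * Barriers from travelling waves *)

Section Barriers.
Context {R : realType} {n : nat}.
Implicit Types (f : R -> R -> 'rV[R]_n -> R) (Q Qr Qrr : R -> R -> 'rV[R]_n -> R).
Implicit Types (C : R -> 'rV[R]_n -> R) (ue : R -> 'rV[R]_n * R -> R).
Implicit Types (x y : 'rV[R]_n) (z : 'rV[R]_n * R).

(* Profiles of the nonlinearity raised by [eps * delta]: composed with a function
   [psi / eps] whose level sets move slowly enough, they are subsolutions with
   room of order [delta / eps].  They stay below [1 - theta * eps]. *)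
Record barrier_wave (eps0 gamma delta theta : R) f Q Qr Qrr C : Prop := {
  bw_eq : forall (eps r : R) x, 0 < eps < eps0 ->
    Qrr eps r x + C eps x * Qr eps r x = f eps (Q eps r x) x + eps * delta;
  bw_ge0 : forall (eps r : R) x, 0 < eps < eps0 -> 0 <= Qr eps r x;
  bw_sign : forall (eps r : R) x, 0 < eps < eps0 ->
    (0 <= r -> f eps (Q eps r x) x + eps * delta <= 0) /\
    (r <= 0 -> 0 <= f eps (Q eps r x) x + eps * delta);
  bw_le : forall (eps r : R) x, 0 < eps < eps0 -> Q eps r x <= 1 - theta * eps;
  bw_left : forall c : R, 0 < c -> \forall eps \near 0^'+, forall (r : R) x,
    r <= - c / eps -> Q eps r x <= -1;
  bw_right : forall c : R, 0 < c -> \forall eps \near 0^'+, forall (r : R) x,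
    c / eps <= r -> 1 - gamma <= Q eps r x;
  bw_time : forall (eps : R) x (rho : R -> R) (t d : R), 0 < eps < eps0 ->
    is_derive t 1 rho d ->
    is_derive t 1 (fun s => Q eps (rho s) x) (Qr eps (rho t) x * d);
  bw_space : forall (K : set 'rV[R]_n) (G eta : R), compact K -> 0 < eta ->
    \forall eps \near 0^'+, forall x i (rho : R -> R) (r1 r2 : R), K x ->
      jet2 rho r1 r2 -> `|r1| <= G / eps ->
      exists d1 d2 : R, jet2 (fun s => Q eps (rho s) (x + s *: e_ i)) d1 d2 /\
        Qrr eps (rho 0) x * r1 ^+ 2 + Qr eps (rho 0) x * r2 - eta / eps <= d2;
  bw_cont : forall eps : R, 0 < eps < eps0 ->
    continuous (fun p : R * 'rV[R]_n => Q eps p.1 p.2) }.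

(* What the proof uses of the data; it also holds for [- f (- q)], [- ue] and
   [- alpha], which exchanges the two phases. *)
Record phase_model (eps0 gamma : R) f ue (beta : 'rV[R]_n -> R) : Prop := {
  pm_eps0 : 0 < eps0;
  pm_gamma : 0 < gamma < 1;
  pm_range : forall (eps : R) z, 0 < eps < eps0 -> Q0 z -> -1 <= ue eps z <= 1;
  pm_cont : forall eps : R, 0 < eps < eps0 -> {within Q0, continuous (ue eps)};
  pm_C21 : forall eps : R, 0 < eps < eps0 -> C21 (ue eps);
  pm_eq : forall (eps : R) z, 0 < eps < eps0 -> Qpos z ->
    dt (ue eps) z - \tr (hess_x (ue eps) z) + eps ^- 2 * f eps (ue eps z) z.1 = 0;
  pm_lipschitz : exists2 L : R, 0 < L & forall (eps : R) x (q q' : R), 0 < eps < eps0 ->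
    -1 <= q <= 1 -> -1 <= q' <= 1 -> `|f eps q x - f eps q' x| <= L * `|q - q'|;
  pm_stable : forall (eps : R) x (q : R), 0 < eps < eps0 -> 1 - gamma <= q <= 1 ->
    f eps q x <= - (gamma * (1 - q));
  pm_reaction : forall (K : set 'rV[R]_n) (s s' : R), compact K -> 0 < s -> s' < 1 ->
    exists2 mu : R, 0 < mu & \forall eps \near 0^'+, forall x (q : R), K x ->
      s <= q <= s' -> f eps q x <= - mu;
  pm_wave : forall x0 (b : R), (usc_env setT beta x0 < b%:E)%E ->
    exists delta theta Q Qr Qrr C r,
    [/\ 0 < delta, 0 < theta, 0 < r, barrier_wave eps0 gamma delta theta f Q Qr Qrr C
      & \forall eps \near 0^'+, forall x, cube x0 r x -> C eps x <= eps * b];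
  pm_wave_global : exists delta theta Q Qr Qrr C b,
    [/\ 0 < delta, 0 < theta, 0 < b, barrier_wave eps0 gamma delta theta f Q Qr Qrr C
      & forall (eps : R) x, 0 < eps < eps0 -> C eps x <= eps * b] }.

Lemma near_eps (eps0 : R) : 0 < eps0 -> \forall eps \near 0^'+, 0 < eps < eps0.
Proof.
move=> e0; near=> eps; apply/andP; split; near: eps; first exact: nbhs_right_gt.
exact: nbhs_right_lt.
Unshelve. all: end_near. Qed.

(** Follows from [(y / 2) ^+ 2 <= exp y] with [y = k / eps]. *)
Lemma expR_small (a k theta : R) : 0 < k -> 0 < theta ->
  \forall eps \near (0 : R)^'+, a * expR (- (k / eps)) <= theta * eps.
Proof.
move=> k0 th0; have a1 : 0 < `|a| + 1 by rewrite ltr_wpDl.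
have e10 : 0 < theta * k ^+ 2 / (4 * (`|a| + 1)).
  by rewrite divr_gt0 ?mulr_gt0 ?exprn_gt0.
apply: filterS (near_eps e10) => eps /andP[eps0 epsl].
have x0 : 0 < k / eps by rewrite divr_gt0.
have y0 : 0 < k / eps / 2 by rewrite divr_gt0.
have H : (k / eps / 2) ^+ 2 <= expR (k / eps).
  have -> : expR (k / eps) = expR (k / eps / 2) ^+ 2.
    by rewrite -expRM_natl; congr expR; field; rewrite gt_eqF.
  rewrite ler_sqr ?nnegrE ?expR_ge0 ?(ltW y0) //.
  by apply: ltW; apply: lt_le_trans (expR_ge1Dx _); rewrite ltrDr.
apply: (@le_trans _ _ ((`|a| + 1) * (k / eps / 2) ^- 2)).
  rewrite expRN; apply: (@le_trans _ _ ((`|a| + 1) * (expR (k / eps))^-1)).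
    rewrite ler_wpM2r ?invr_ge0 ?expR_ge0 //.
    by apply: (le_trans (ler_norm _)); rewrite lerDl.
  by rewrite ler_wpM2l ?(ltW a1) // lef_pV2 ?posrE ?expR_gt0 ?exprn_gt0.
have -> : (`|a| + 1) * (k / eps / 2) ^- 2 = eps * (4 * (`|a| + 1) / k ^+ 2 * eps).
  by field; rewrite !gt_eqF.
rewrite mulrC ler_wpM2r ?(ltW eps0) //.
have -> : theta = 4 * (`|a| + 1) / k ^+ 2 * (theta * k ^+ 2 / (4 * (`|a| + 1))).
  by field; rewrite !gt_eqF.
rewrite ler_wpM2l ?(ltW epsl) // divr_ge0 ?sqr_ge0 //.
Qed.

Lemma cube_boundary x0 r y : cube x0 r y ->
  ~ (exists i, `|y 0 i - x0 0 i| = r) -> forall i, `|y 0 i - x0 0 i| < r.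
Proof.
move=> cy nb i; rewrite lt_neqAle cy andbT; apply/eqP => E.
by apply: nb; exists i.
Qed.

Lemma cyl_Q0 x0 r t0 t1 : 0 <= t0 -> cyl x0 r t0 t1 `<=` Q0.
Proof. by move=> t00 z [_ /andP[tz _]]; rewrite /Q0 /=; exact: le_trans tz. Qed.

(** For a given wave, the threshold in [eps] depends on [K], [G] and [c] but not on the cylinder or
    on [psi], so that a whole family of barriers can share it. Where [Q (psi / eps) > ue], both
    values lie in [[-1, 1]], and the Lipschitz constant of [f] controls the reaction term in the
    form that [parabolic_max] demands. *)
Lemma wave_barrier eps0 gamma f ue beta delta theta Q Qr Qrr C (K : set 'rV[R]_n)
    (b G c : R) :
  phase_model eps0 gamma f ue beta ->
  barrier_wave eps0 gamma delta theta f Q Qr Qrr C -> 0 < delta -> 0 < theta ->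
  compact K -> 0 < c ->
  \forall eps \near 0^'+, (forall x, K x -> C eps x <= eps * b) ->
  forall x0 r t0 t1 (psi psit : 'rV[R]_n * R -> R) (psi1 psi2 : 'I_n -> 'rV[R]_n * R -> R),
  cube x0 r `<=` K -> 0 <= t0 -> {within cyl x0 r t0 t1, continuous psi} ->
  (forall z, cyl x0 r t0 t1 z -> (forall i, `|z.1 0 i - x0 0 i| < r) -> t0 < z.2 ->
   [/\ is_derive z.2 1 (fun t => psi (z.1, t)) (psit z),
       forall i, jet2 (fun s => psi (z.1 + s *: e_ i, z.2)) (psi1 i z) (psi2 i z),
       forall i, `|psi1 i z| <= G,
       0 <= psi z * (1 - \sum_i psi1 i z ^+ 2)
     & psit z - \sum_i psi2 i z + b * \sum_i psi1 i z ^+ 2 <= 0]) ->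
  (forall z, cyl x0 r t0 t1 z -> (exists i, `|z.1 0 i - x0 0 i| = r) \/ z.2 = t0 ->
     psi z <= - c \/ 1 - theta * eps <= ue eps z) ->
  forall z, cyl x0 r t0 t1 z -> Q eps (psi z / eps) z.1 <= ue eps z.
Proof.
move=> pm bw delta0 theta0 cK c0.
have [L L0 lipf] := pm_lipschitz pm.
(* The errors of the [n] coordinates add up to at most [delta / eps], which is the room left by the
   perturbed wave. *)
have eta0 : 0 < delta / n.+1%:R by rewrite divr_gt0.
apply: filterS3 (near_eps (pm_eps0 pm)) (bw_left bw c0) (bw_space bw G cK eta0).
move=> eps epsr Hleft Hspace HC x0 r t0 t1 psi psit psi1 psi2 sub t00 cpsi Hpsi Hbd z cz.
have /andP[e0 _] := epsr.
suff : Q eps (psi z / eps) z.1 - ue eps z <= 0 by rewrite subr_le0.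
pose w (y : 'rV[R]_n * R) : R := Q eps (psi y / eps) y.1 - ue eps y.
apply: (@parabolic_max R n x0 r t0 t1 (L / eps ^+ 2) w) cz.
  move=> y; apply: cvgB; last first.
    apply: (continuous_subspaceW (cyl_Q0 t00)); exact: (pm_cont pm epsr).
  apply: (@cvg_fun2 R R 'rV[R]_n _ (nbhs_subspace y) _ (fun p => Q eps p.1 p.2)
    (fun t => psi t / eps) (fun t => t.1) (psi y / eps) y.1).
  - by apply: cvgM; [exact: cpsi|exact: cvg_cst].
  - by apply: continuous_subspaceT => ?; exact: cvg_fst.
  - exact: (bw_cont bw epsr).
move=> y cy; rewrite /w subr_gt0 => wy.
have Qy := cyl_Q0 t00 cy.
have nbd : ~ ((exists i, `|y.1 0 i - x0 0 i| = r) \/ y.2 = t0).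
  move=> /(Hbd y cy)[le|le].
    have := Hleft (psi y / eps) y.1; rewrite ler_pM2r ?invr_gt0 // => /(_ le).
    have /andP[] := pm_range pm epsr Qy; move: wy.
    by move: (Q _ _ _) (ue _ _) => a b'; lra.
  by have := bw_le bw (psi y / eps) y.1 epsr; move: le wy;
    move: (Q _ _ _) (ue _ _) => a b'; lra.
have yr := cube_boundary cy.1 (fun h => nbd (or_introl h)).
have yt : t0 < y.2.
  rewrite lt_neqAle eq_sym; apply/andP; split; last by case: cy => _ /andP[].
  by apply/eqP => h; apply: nbd; right.
have Qpy : Qpos y by exact: le_lt_trans yt.
have [dpsi jpsi gpsi spsi hpsi] := Hpsi y cy yr yt.
have Ky : K y.1 by apply: sub; case: cy.
have jw i : exists d1 d2 : R,
    jet2 (fun s => Q eps (psi (y.1 + s *: e_ i, y.2) / eps) (y.1 + s *: e_ i)) d1 d2 /\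
    Qrr eps (psi y / eps) y.1 * (psi1 i y / eps) ^+ 2
      + Qr eps (psi y / eps) y.1 * (psi2 i y / eps) - delta / n.+1%:R / eps <= d2.
  have je : jet2 (fun s => psi (y.1 + s *: e_ i, y.2) / eps) (psi1 i y / eps) (psi2 i y / eps).
    by have := jet2_cstM eps^-1 (jpsi i); rewrite !(mulrC eps^-1);
      under eq_fun do rewrite mulrC.
  have [|d1 [d2 [jd le]]] := Hspace y.1 i _ _ _ Ky je.
    by rewrite normrM (gtr0_norm (_ : 0 < eps^-1)) ?invr_gt0 // ler_pM2r ?invr_gt0.
  by exists d1, d2; split=> //; move: le; rewrite /= scale0r addr0 -surjective_pairing.
have [d1 /choice [d2 Hd]] := choice jw.
split=> //.
exists (Qr eps (psi y / eps) y.1 * (psit y / eps) - dt (ue eps) y),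
  (fun i => d1 i - grad_x (ue eps) y 0 i), (fun i => d2 i - hess_x (ue eps) y i i).
split.
- apply: is_derive_sub; last exact: (C21_dt (pm_C21 pm epsr) Qpy).
  have dq : is_derive y.2 1 (fun t => psi (y.1, t) / eps) (psit y / eps).
    by under eq_fun do rewrite mulrC; rewrite mulrC; exact: is_derive_cstM.
  by have := bw_time bw y.1 epsr dq; rewrite /= -surjective_pairing.
- move=> i; apply: jet2_sub; first exact: (Hd i).1.
  exact: (C21_jet2 i (pm_C21 pm epsr) Qpy).
rewrite sumrB.
have E := pm_eq pm epsr Qpy; have trE : \tr (hess_x (ue eps) y) = \sum_i hess_x (ue eps) y i i by [].
have := bw_eq bw (psi y / eps) y.1 epsr.
have := bw_ge0 bw (psi y / eps) y.1 epsr.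
have [spos sneg] := bw_sign bw (psi y / eps) y.1 epsr.
have Crange := HC y.1 Ky.
have sumd : Qrr eps (psi y / eps) y.1 / eps ^+ 2 * (\sum_i psi1 i y ^+ 2)
     + Qr eps (psi y / eps) y.1 / eps * (\sum_i psi2 i y) - delta / eps <= \sum_i d2 i.
  apply: le_trans (ler_sum _ (fun i _ => (Hd i).2)).
  rewrite !big_split /= !mulr_sumr; apply: lerD; first apply: lerD.
  - rewrite le_eqVlt; apply/orP; left; apply/eqP; apply: eq_bigr => i _.
    by field; rewrite gt_eqF.
  - rewrite le_eqVlt; apply/orP; left; apply/eqP; apply: eq_bigr => i _.
    by field; rewrite gt_eqF.
  rewrite sumrN lerN2 sumr_const card_ord -[leLHS]mulr_natr.
  rewrite (_ : delta / n.+1%:R / eps * n%:R = delta / eps * (n%:R / n.+1%:R)); last by ring.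
  by rewrite ger_pMr ?divr_gt0 // ler_pdivrMr // mul1r ler_nat.
have lip := lipf eps y.1 (ue eps y) (Q eps (psi y / eps) y.1) epsr (pm_range pm epsr Qy).
have Qrange : -1 <= Q eps (psi y / eps) y.1 <= 1.
  have := bw_le bw (psi y / eps) y.1 epsr; have := pm_range pm epsr Qy.
  have : 0 < theta * eps by rewrite mulr_gt0.
  move: wy; move: (Q _ _ _) (ue _ _) (theta * eps) => q v m qv m0 /andP[v1 v2] qm.
  by apply/andP; split; lra.
have {}lip := lip Qrange.
have {}lip : f eps (ue eps y) y.1 - f eps (Q eps (psi y / eps) y.1) y.1
    <= L * (Q eps (psi y / eps) y.1 - ue eps y).
  apply: (le_trans (ler_norm _)); apply: (le_trans lip).
  by rewrite distrC gtr0_norm // subr_gt0.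
have S1 : 0 <= \sum_i psi1 i y ^+ 2 by apply: sumr_ge0 => i _; exact: sqr_ge0.
(* [f + eps * delta] is nonpositive on the side [psi >= 0] and nonnegative on the other, so its
   product with [1 - |D psi|^2] inherits a sign from [psi * (1 - |D psi|^2) >= 0]; at [psi = 0] both
   bounds together make it vanish. *)
have psi_sgn : (f eps (Q eps (psi y / eps) y.1) y.1 + eps * delta)
    * (1 - \sum_i psi1 i y ^+ 2) <= 0.
  have [p0|p0|p0] := ltgtP (psi y) 0.
  - apply: mulr_ge0_le0; first by apply: sneg; rewrite ler_pdivrMr // mul0r ltW.
    by move: spsi; rewrite nmulr_rge0.
  - apply: mulr_le0_ge0; first by apply: spos; rewrite divr_ge0 // ltW.
    by move: spsi; rewrite pmulr_rge0.
  - rewrite (_ : _ + _ = 0) ?mul0r //; apply/eqP; rewrite eq_le; apply/andP; split.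
      by apply: spos; rewrite p0 mul0r.
    by apply: sneg; rewrite p0 mul0r.
rewrite trE in E.
move: E sumd lip S1 psi_sgn hpsi Crange.
move: (\sum_i d2 i) (\sum_i hess_x _ _ _ _) (dt _ _) => sd sh du.
move: (\sum_i psi1 _ _ ^+ 2) (\sum_i psi2 _ _) (psit y) => s1 s2 pt.
move: (Qrr _ _ _) (Qr _ _ _) (C _ _) => A B Cs.
move: (f _ (ue _ _) _) (f _ (Q _ _ _) _) (Q _ _ _ - _) => Fu F q.
move=> E sumd lip S1 psi_sgn hpsi Crange B0 waveE.
have e20 : 0 < eps ^+ 2 by rewrite exprn_gt0.
rewrite -(ler_pM2l e20).
have X0 : eps * (B * (pt - s2 + b * s1)) <= 0.
  by rewrite pmulr_rle0 //; exact: mulr_ge0_le0.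
have Z0 : 0 <= B * s1 * (eps * b - Cs) by rewrite mulr_ge0 ?mulr_ge0 // subr_ge0.
have Y0 : eps ^+ 2 * (A / eps ^+ 2 * s1 + B / eps * s2 - delta / eps) <= eps ^+ 2 * sd.
  by rewrite ler_pM2l.
have -> : eps ^+ 2 * (L / eps ^+ 2 * q) = L * q by field; rewrite gt_eqF.
(* After multiplication by [eps ^+ 2] the operator splits into the motion of the front, the excess
   of [eps * b] over the wave speed, the defect of unit gradient, the reaction difference and the
   error in the second derivatives. All but the reaction difference contribute nonpositively. *)
have H : eps ^+ 2 * (B * (pt / eps) - du - (sd - sh)) =
    eps * (B * (pt - s2 + b * s1)) - B * s1 * (eps * b - Cs) + (F + eps * delta) * (1 - s1)
    + (Fu - F) - (eps ^+ 2 * sd - eps ^+ 2 * (A / eps ^+ 2 * s1 + B / eps * s2 - delta / eps)).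
  have -> : A = F + eps * delta - Cs * B by rewrite -waveE addrK.
  have -> : du = sh - eps ^- 2 * Fu by rewrite -[du](subrK sh) -[du - sh]subr0 -E; ring.
  by field; rewrite gt_eqF.
rewrite H; move: X0 Z0 Y0 psi_sgn lip; clear.
move: (eps * (B * _)) (B * s1 * _) ((F + _) * _) (eps ^+ 2 * sd) (eps ^+ 2 * _) (L * q).
by move=> *; lra.
Qed.

End Barriers.

(** * Comparison with ordinary differential equations *)

Section OdeBarrier.
Context {R : realType} {n : nat}.
Implicit Types (x y : 'rV[R]_n) (z : 'rV[R]_n * R).

Lemma jet2_exp (a k : R) :
  jet2 (fun s => expR (a + k * s)) (k * expR a) (k ^+ 2 * expR a).
Proof.
have d (s : R) : is_derive s 1 (fun s => expR (a + k * s)) (k * expR (a + k * s)).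
  have dl : is_derive s 1 (fun s : R => a + k * s) k.
    have dc : is_derive s 1 (fun _ : R => a) 0 by exact: is_derive_cst.
    exact: (is_derive_val (is_derive_add dc (is_derive_linear k s)) (add0r k)).
  apply: (is_derive_val (@is_derive_comp R expR (fun s => a + k * s) s _ _ _ dl)).
  by rewrite mulrC.
exists (fun s => k * expR (a + k * s)); split.
- by near=> s; exact: d.
- by rewrite mulr0 addr0.
- apply: (is_derive_val (is_derive_cstM k (d 0))).
  by rewrite mulr0 addr0 mulrA expr2.
Unshelve. all: end_near. Qed.

Lemma jet2_cst (a : R) : jet2 (fun=> a) 0 0.
Proof.
exists (fun=> 0); split=> //; last exact: is_derive_cst.
by near=> s; exact: is_derive_cst.
Unshelve. all: end_near. Qed.

Lemma jet2_add (h g : R -> R) (d1 d2 e1 e2 : R) : jet2 h d1 d2 -> jet2 g e1 e2 ->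
  jet2 (fun s => h s + g s) (d1 + e1) (d2 + e2).
Proof.
move=> jh jg; have := jet2_sub jh (jet2_cstM (-1) jg).
by rewrite !mulN1r !opprK; under eq_fun do rewrite mulN1r opprK.
Qed.

Lemma jet2_sumr (I : finType) (h : I -> R -> R) (d1 d2 : I -> R) :
  (forall i, jet2 (h i) (d1 i) (d2 i)) ->
  jet2 (fun s => \sum_i h i s) (\sum_i d1 i) (\sum_i d2 i).
Proof.
move=> jh; elim: (index_enum I) => [|i r IH].
  by rewrite !big_nil; under eq_fun do rewrite big_nil; exact: jet2_cst.
by rewrite !big_cons; under eq_fun do rewrite big_cons; exact: jet2_add.
Qed.

Lemma cvg_sumr {T : Type} (F : set_system T) {FF : Filter F} (I : finType)
    (g : I -> T -> R) (l : I -> R) :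
  (forall i, g i @ F --> l i) -> (fun t => \sum_i g i t) @ F --> \sum_i l i.
Proof.
move=> cg; elim: (index_enum I) => [|i r IH].
  by rewrite big_nil; under eq_fun do rewrite big_nil; exact: cvg_cst.
by rewrite big_cons; under eq_fun do rewrite big_cons; apply: cvgD; [exact: cg|].
Qed.

Lemma jet2_mul (h g : R -> R) (d1 d2 e1 e2 : R) : jet2 h d1 d2 -> jet2 g e1 e2 ->
  jet2 (fun s => h s * g s) (d1 * g 0 + h 0 * e1) (d2 * g 0 + 2 * d1 * e1 + h 0 * e2).
Proof.
move=> [h1 [dh <- d2h]] [g1 [dg <- d2g]]; exists (fun s => h1 s * g s + h s * g1 s).
have dh0 := nbhs_singleton dh; have dg0 := nbhs_singleton dg.
split=> //; first by near=> s; apply: is_derive_mul; near: s.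
apply: (is_derive_val (is_derive_add (is_derive_mul d2h dg0) (is_derive_mul dh0 d2g))).
by ring.
Unshelve. all: end_near. Qed.

Lemma jet2_affine (a k : R) : jet2 (fun s => a + s * k) k 0.
Proof.
have dc (s b : R) : is_derive s (1 : R) (fun _ : R => b) 0 by exact: is_derive_cst.
have d (s : R) : is_derive s (1 : R) (fun s : R => a + s * k) k.
  apply: (is_derive_val (is_derive_add (dc s a) (is_derive_mul (is_derive_idr s) (dc s k)))).
  by rewrite mul1r mulr0 addr0 add0r.
exists (fun=> k); split=> //.
by near=> s; exact: d.
Unshelve. all: end_near. Qed.

Lemma jet2_comp (f f1 h : R -> R) (f2 d1 d2 : R) :
  (\forall y \near h 0, is_derive y (1 : R) f (f1 y)) -> is_derive (h 0) (1 : R) f1 f2 ->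
  jet2 h d1 d2 ->
  jet2 (fun s => f (h s)) (f1 (h 0) * d1) (f2 * d1 ^+ 2 + f1 (h 0) * d2).
Proof.
move=> df df1 [h1 [dh <- d2h]]; exists (fun s => f1 (h s) * h1 s).
have dh0 := nbhs_singleton dh; have ch := is_derive_cts dh0.
split=> //; last first.
  apply: (is_derive_val (is_derive_mul (is_derive_comp df1 dh0) d2h)).
  by ring.
have dfh : \forall s \near (0 : R), is_derive (h s) (1 : R) f (f1 (h s)).
  by have /(_ _ df) := ch.
by near=> s; apply: is_derive_comp; near: s.
Unshelve. all: end_near. Qed.

Lemma jet2_coord (x y : 'rV[R]_n) (i j : 'I_n) :
  jet2 (fun s => (y + s *: e_ i) 0 j - x 0 j) (i == j)%:R 0.
Proof.
have := jet2_affine (y 0 j - x 0 j) (i == j)%:R.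
by congr jet2; apply/funext => s; rewrite add_e_E addrAC.
Qed.

Lemma jet2_quad (X : 'M[R]_n) (x y : 'rV[R]_n) (i : 'I_n) : X^T = X ->
  jet2 (fun s => quad X (y + s *: e_ i - x) (y + s *: e_ i - x))
    (2 * \sum_j X i j * (y 0 j - x 0 j)) (2 * X i i).
Proof.
move=> symX; pose k j : R := (i == j)%:R; pose v j := y 0 j - x 0 j.
have Xs a b : X a b = X b a by rewrite -[in LHS]symX mxE.
have jq : jet2 (fun s => quad X (y + s *: e_ i - x) (y + s *: e_ i - x))
    (\sum_a \sum_b X a b * (k a * v b + v a * k b)) (\sum_a \sum_b X a b * (2 * k a * k b)).
  rewrite /quad; apply: jet2_sumr => a; apply: jet2_sumr => b.
  have := jet2_cstM (X a b) (jet2_mul (jet2_coord x y i a) (jet2_coord x y i b)).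
  rewrite !scale0r !addr0 -/(v a) -/(v b) -/(k a) -/(k b) mul0r mulr0 add0r addr0.
  by congr jet2; apply/funext => s; rewrite !mxE; ring.
have sk (F : 'I_n -> R) : \sum_a k a * F a = F i.
  rewrite (bigD1 i) //= big1 ?addr0 /k ?eqxx ?mul1r // => a ai.
  by rewrite eq_sym (negbTE ai) mul0r.
move: jq; congr jet2.
  transitivity (\sum_a k a * (\sum_b X a b * v b) + \sum_b k b * (\sum_a X a b * v a)).
    transitivity (\sum_a \sum_b k a * (X a b * v b) + \sum_b \sum_a k b * (X a b * v a)).
      rewrite [X in _ = _ + X]exchange_big -big_split /=; apply: eq_bigr => a _.
      by rewrite -big_split /=; apply: eq_bigr => b _; ring.
    by congr (_ + _); apply: eq_bigr => a _; rewrite mulr_sumr.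
  rewrite !sk mulr_natl mulr2n; congr (_ + _).
  by apply: eq_bigr => a _; rewrite Xs.
transitivity (\sum_a k a * (\sum_b k b * (2 * X a b))).
  by apply: eq_bigr => a _; rewrite mulr_sumr; apply: eq_bigr => b _; ring.
by rewrite !sk.
Qed.

Lemma quad_cvg (X : 'M[R]_n) (x : 'rV[R]_n) (z : 'rV[R]_n * R) :
  (fun y : 'rV[R]_n * R => quad X (y.1 - x) (y.1 - x)) @ z --> quad X (z.1 - x) (z.1 - x).
Proof.
have cc i : (fun y : 'rV[R]_n * R => (y.1 - x) 0 i) @ z --> (z.1 - x) 0 i.
  under eq_fun do rewrite mxE; rewrite mxE.
  by apply: cvgD; [exact: coord_cvg|exact: cvg_cst].
apply: cvg_sumr => i; apply: cvg_sumr => j; apply: cvgM => //.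
by apply: cvgM => //; exact: cvg_cst.
Qed.

(* Comparison with the solution of an ordinary differential equation, up to an
   error travelling at speed [1 / eps]: the sum of the [exp (+- y_i / eps)] absorbs
   the Lipschitz constant of the reaction. *)
Lemma ode_barrier eps0 gamma (f : R -> R -> 'rV[R]_n -> R) ue beta (L : R) :
  phase_model eps0 gamma f ue beta -> 0 < L ->
  (forall (eps : R) x (q q' : R), 0 < eps < eps0 -> -1 <= q <= 1 -> -1 <= q' <= 1 ->
     `|f eps q x - f eps q' x| <= L * `|q - q'|) ->
  forall (eps : R) x1 (r t0 s : R) (zeta zeta' : R -> R), 0 < eps < eps0 ->
  0 < r -> 0 <= t0 -> 0 <= s ->
  (forall tau : R, is_derive tau (1 : R) zeta (zeta' tau)) ->
  (forall (tau : R) x, 0 <= tau <= s -> cube x1 r x ->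
     -1 <= zeta tau <= 1 /\ zeta' tau + f eps (zeta tau) x <= 0) ->
  (forall x, cube x1 r x -> zeta 0 <= ue eps (x, t0)) ->
  zeta s - 4 * n%:R * expR ((L + 1) * s - r / eps) <= ue eps (x1, t0 + s * eps ^+ 2).
Proof.
move=> pm L0 lipf eps x1 r t0 s zeta zeta' epsr r0 t00 s0 dzeta Hzeta Hinit.
have /andP[e0 _] := epsr; have e20 : 0 < eps ^+ 2 by rewrite exprn_gt0.
pose tau (t : R) := (t - t0) / eps ^+ 2.
pose S (x : 'rV[R]_n) := \sum_i (expR ((x 0 i - x1 0 i) / eps) + expR (- ((x 0 i - x1 0 i) / eps))).
(* In [L + 1], [L] absorbs the reaction and 1 the Laplacian [eps ^- 2 * S] of [S]. The factor 2 is
   the largest possible gap between [zeta] and [ue], which [E * S] must exceed on the lateral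
   boundary; at the centre [S] is [2 * n], whence [4 * n] in the conclusion. *)
pose E (t : R) := 2 * expR ((L + 1) * tau t - r / eps).
pose t1 := t0 + s * eps ^+ 2.
pose w (z : 'rV[R]_n * R) := zeta (tau z.2) - E z.2 * S z.1 - ue eps z.
have S0 x : 0 <= S x by apply: sumr_ge0 => i _; rewrite addr_ge0 ?expR_ge0.
have E0 t : 0 < E t by rewrite mulr_gt0 ?expR_gt0.
have dtau (t : R) : is_derive t 1 tau (eps ^- 2).
  have dc : is_derive t 1 (fun _ : R => t0) 0 by exact: is_derive_cst.
  rewrite /tau; under eq_fun do rewrite mulrC.
  apply: (is_derive_val (is_derive_cstM _ (is_derive_sub (is_derive_idr t) dc))).
  by rewrite subr0 mulr1.
have dE (t : R) : is_derive t 1 E ((L + 1) * eps ^- 2 * E t).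
  have dl : is_derive t 1 (fun t => (L + 1) * tau t - r / eps) ((L + 1) * eps ^- 2).
    have dc : is_derive t 1 (fun _ : R => r / eps) 0 by exact: is_derive_cst.
    exact: (is_derive_val (is_derive_sub (is_derive_cstM (L + 1) (dtau t)) dc) (subr0 _)).
  apply: (is_derive_val (is_derive_cstM 2 (@is_derive_comp R expR
    (fun t => (L + 1) * tau t - r / eps) t _ _ _ dl))).
  by rewrite /E; ring.
have cw : {within cyl x1 r t0 t1, continuous w}.
  suff cV : continuous (fun z : 'rV[R]_n * R => zeta (tau z.2) - E z.2 * S z.1).
    move=> y; apply: cvgB; first exact: (continuous_subspaceT cV).
    by apply: (continuous_subspaceW (cyl_Q0 t00)); exact: (pm_cont pm epsr).
  move=> y.
  have c2 : (fun z : 'rV[R]_n * R => z.2) @ y --> y.2 by exact: cvg_snd.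
  apply: cvgB.
    exact: (cvg_comp _ _ c2
      (is_derive_cts (@is_derive_comp R zeta tau _ _ _ (dzeta _) (dtau _)))).
  apply: cvgM; first exact: (cvg_comp _ _ c2 (is_derive_cts (dE _))).
  apply: cvg_sumr => i.
  have ci : (fun z : 'rV[R]_n * R => (z.1 0 i - x1 0 i) / eps) @ y -->
      (y.1 0 i - x1 0 i) / eps.
    apply: cvgM; last exact: cvg_cst.
    apply: cvgB; last exact: cvg_cst.
    exact: coord_cvg.
  apply: cvgD; first exact: (cvg_comp _ _ ci (@continuous_expR R _)).
  exact: (cvg_comp _ _ (cvgN ci) (@continuous_expR R _)).
have tau_rg z : cyl x1 r t0 t1 z -> 0 <= tau z.2 <= s.
  move=> [_ /andP[a b]]; rewrite /tau divr_ge0 ?subr_ge0 ?(ltW e20) //=.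
  by rewrite ler_pdivrMr // lerBlDl.
have H : w (x1, t1) <= 0.
  apply: (@parabolic_max R n x1 r t0 t1 (L / eps ^+ 2) w cw); last first.
    split=> /=; first by move=> i; rewrite subrr normr0 ltW.
    by rewrite lexx andbT lerDl mulr_ge0 // ltW.
  move=> y cy; rewrite /w subr_gt0 => wy.
  have Qy := cyl_Q0 t00 cy; have ry := pm_range pm epsr Qy.
  have [zr zeq] := Hzeta _ _ (tau_rg y cy) cy.1.
  have ES0 : 0 <= E y.2 * S y.1 by rewrite mulr_ge0 // ltW.
  have nb1 : ~ (exists i, `|y.1 0 i - x1 0 i| = r).
    case=> i yi.
    have ESi : expR (r / eps) <= S y.1.
      rewrite /S (bigD1 i) //= -[leLHS]addr0; apply: lerD; last first.
        by apply: sumr_ge0 => j _; rewrite addr_ge0 ?expR_ge0.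
      rewrite -yi; case: (ger0P (y.1 0 i - x1 0 i)) => _.
        by rewrite lerDl expR_ge0.
      by rewrite mulNr lerDr expR_ge0.
    have E1 : 2 <= E y.2 * expR (r / eps).
      rewrite /E -mulrA -expRD subrK ler_peMr //.
      apply: le_trans (expR_ge1Dx _); rewrite lerDl mulr_ge0 //.
        by rewrite addr_ge0 // ltW.
      by case/andP: (tau_rg y cy).
    have := ler_wpM2l (ltW (E0 y.2)) ESi.
    by move: E1 wy zr ry; move: (E y.2 * S _) (E y.2 * _) (zeta _) (ue _ _) => a b c d; lra.
  have nb2 : y.2 <> t0.
    move=> yt; have := Hinit y.1 cy.1; rewrite -yt -surjective_pairing.
    have : tau y.2 = 0 by rewrite /tau yt subrr mul0r.
    move=> tau0; move: wy ES0; rewrite tau0.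
    by move: (E y.2 * S _) (zeta _) (ue _ _) => a b c; lra.
  have yt : t0 < y.2.
    by rewrite lt_neqAle eq_sym (introN eqP nb2) /=; case: cy => _ /andP[].
  have Qpy : Qpos y by exact: le_lt_trans yt.
  split=> //; first exact: (cube_boundary cy.1 nb1).
  pose e (i j : 'I_n) : R := (i == j)%:R / eps.
  pose p j := expR ((y.1 0 j - x1 0 j) / eps).
  pose m j := expR (- ((y.1 0 j - x1 0 j) / eps)).
  have jS i : jet2 (fun s => S (y.1 + s *: e_ i))
      (\sum_j (e i j * p j + - e i j * m j)) (\sum_j (e i j ^+ 2 * p j + (- e i j) ^+ 2 * m j)).
    rewrite /S; apply: jet2_sumr => j; apply: jet2_add.
      have := jet2_exp ((y.1 0 j - x1 0 j) / eps) (e i j).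
      congr jet2; apply/funext => a; rewrite add_e_E /e; congr expR; ring.
    have := jet2_exp (- ((y.1 0 j - x1 0 j) / eps)) (- e i j).
    congr jet2; apply/funext => a; rewrite add_e_E /e; congr expR; ring.
  exists (zeta' (tau y.2) * eps ^- 2 - ((L + 1) * eps ^- 2 * E y.2) * S y.1 - dt (ue eps) y),
    (fun i => 0 - E y.2 * (\sum_j (e i j * p j + - e i j * m j)) - grad_x (ue eps) y 0 i),
    (fun i => 0 - E y.2 * (\sum_j (e i j ^+ 2 * p j + (- e i j) ^+ 2 * m j))
       - hess_x (ue eps) y i i).
  split.
  - have dES : is_derive y.2 1 (fun t => E t * S y.1) ((L + 1) * eps ^- 2 * E y.2 * S y.1).
      by under eq_fun do rewrite mulrC; rewrite mulrC; exact: is_derive_cstM.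
    have dz := is_derive_sub (@is_derive_comp R zeta tau _ _ _ (dzeta _) (dtau y.2)) dES.
    exact: (is_derive_sub dz (C21_dt (pm_C21 pm epsr) Qpy)).
  - move=> i.
    have jz := jet2_sub (jet2_cst (zeta (tau y.2))) (jet2_cstM (E y.2) (jS i)).
    exact: (jet2_sub jz (C21_jet2 i (pm_C21 pm epsr) Qpy)).
  have sumS : \sum_i \sum_j (e i j ^+ 2 * p j + (- e i j) ^+ 2 * m j) = eps ^- 2 * S y.1.
    rewrite /S mulr_sumr exchange_big /=; apply: eq_bigr => j _.
    rewrite (bigD1 j) //= big1 ?addr0; last first.
      by move=> i ij; rewrite /e (negbTE ij) mul0r oppr0 expr0n /= !mul0r addr0.
    have -> : e j j = eps^-1 by rewrite /e eqxx mul1r.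
    by rewrite -/(p j) -/(m j) sqrrN exprVn mulrDr.
  rewrite sumrB; under eq_bigr do rewrite sub0r.
  rewrite sumrN -mulr_sumr sumS.
  have Eq := pm_eq pm epsr Qpy; rewrite (_ : \tr _ = \sum_i hess_x (ue eps) y i i) // in Eq.
  have lip := lipf eps y.1 _ _ epsr ry zr.
  have {}lip : f eps (ue eps y) y.1 - f eps (zeta (tau y.2)) y.1 <=
      L * (zeta (tau y.2) - ue eps y).
    apply: (le_trans (ler_norm _)); apply: (le_trans lip).
    rewrite distrC ger0_norm // subr_ge0; move: wy ES0.
    by move: (E y.2 * S _) (zeta _) (ue _ _) => a b c; lra.
  move: Eq lip zeq ES0; have -> : (L + 1) / eps ^+ 2 * E y.2 * S y.1 = (L + 1) / eps ^+ 2 * (E y.2 * S y.1) by ring.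
  have -> : E y.2 * (eps ^- 2 * S y.1) = eps ^- 2 * (E y.2 * S y.1) by ring.
  move: (E y.2 * S _) (\sum_i hess_x _ _ _ _) (dt _ _) (zeta' _) => P h d z'.
  move: (f _ (ue _ _) _) (f _ (zeta _) _) => Fu F.
  move: (ue _ _) (zeta _) => v ze Eq lip zeq P0.
  rewrite -(ler_pM2l e20).
  have -> : eps ^+ 2 * (L / eps ^+ 2 * (ze - P - v)) = L * (ze - v) - L * P.
    by field; rewrite gt_eqF.
  have -> : d = h - eps ^- 2 * Fu by rewrite -[d](subrK h) -[d - h]subr0 -Eq; ring.
  have -> : eps ^+ 2 * (z' * eps ^- 2 - (L + 1) / eps ^+ 2 * P - (h - eps ^- 2 * Fu)
     - (- (eps ^- 2 * P) - h)) = (z' + F) + (Fu - F) - L * P by field; rewrite gt_eqF.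
  by lra.
move: H; rewrite /w /= subr_le0 => H; apply: (le_trans _ H); rewrite /t1.
have taus : tau t1 = s by rewrite /tau /t1 addrC addKr mulfK // gt_eqF.
have -> : tau (t0 + s * eps ^+ 2) = s by exact: taus.
rewrite lerD2l lerN2 /E -/t1 taus.
have -> : S x1 = 2 * n%:R.
  rewrite /S (eq_bigr (fun=> 2)); last by move=> i _; rewrite subrr mul0r oppr0 expR0.
  by rewrite sumr_const card_ord mulr_natr.
by rewrite le_eqVlt; apply/orP; left; apply/eqP; ring.
Qed.

End OdeBarrier.

(** * Propagation of the settled phase *)

Section Propagation.
Context {R : realType} {n : nat} (eps0 gamma : R).
Context (f : R -> R -> 'rV[R]_n -> R) (ue : R -> 'rV[R]_n * R -> R) (beta : 'rV[R]_n -> R).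
Hypothesis pm : phase_model eps0 gamma f ue beta.
Implicit Types (x y : 'rV[R]_n) (z : 'rV[R]_n * R).

(** In the fast time [tau = t / eps ^+ 2], the comparison function relaxes to 1 like
    [exp (- gamma * tau)]. Time [c / eps] is long enough for this to fall below any multiple of
    [eps], and short enough, by the choice of [c], for the error from the boundary of the cube to
    stay of order [exp (- r / (2 eps))]. *)
Lemma saturation (theta r : R) : 0 < theta -> 0 < r -> exists2 c : R, 0 < c &
  \forall eps \near 0^'+, forall x1 (t0 : R), 0 <= t0 ->
    (forall x, cube x1 r x -> 1 - gamma <= ue eps (x, t0)) ->
    1 - theta * eps <= ue eps (x1, t0 + c * eps).
Proof.
move=> theta0 r0; have /andP[g0 g1] := pm_gamma pm.
have [L L0 lipf] := pm_lipschitz pm.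
have L1 : 0 < L + 1 by rewrite addr_gt0.
exists (r / (2 * (L + 1))); first by rewrite divr_gt0 // mulr_gt0.
set c := r / _; have c0 : 0 < c by rewrite divr_gt0 // mulr_gt0.
have th2 : 0 < theta / 2 by rewrite divr_gt0.
have gc : 0 < gamma * c by rewrite mulr_gt0.
have r2 : 0 < r / 2 by rewrite divr_gt0.
apply: filterS3 (near_eps (pm_eps0 pm)) (expR_small gamma gc th2)
  (expR_small (4 * n%:R) r2 th2).
move=> eps epsr E1 E2 x1 t0 t00 Hx; have /andP[e0 _] := epsr.
pose zeta tau := 1 - gamma * expR (- gamma * tau).
have dzeta (tau : R) : is_derive tau (1 : R) zeta (gamma * (1 - zeta tau)).
  have dc : is_derive tau 1 (fun _ : R => 1 : R) 0 by exact: is_derive_cst.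
  have de := @is_derive_comp R expR (fun tau => - gamma * tau) tau _ _
    (is_derive_expR _) (is_derive_linear _ _).
  apply: (is_derive_val (is_derive_sub dc (is_derive_cstM gamma de))).
  by rewrite /zeta; ring.
have Hz (tau : R) x : 0 <= tau <= c / eps -> cube x1 r x ->
    -1 <= zeta tau <= 1 /\ gamma * (1 - zeta tau) + f eps (zeta tau) x <= 0.
  move=> /andP[tau0 _] _.
  have ex1 : expR (- gamma * tau) <= 1.
    by rewrite -expR0 ler_expR mulNr oppr_le0 mulr_ge0 // ltW.
  have ex0 := expR_gt0 (- gamma * tau).
  have gz : 0 <= gamma * expR (- gamma * tau) <= gamma.
    by rewrite mulr_ge0 ?(ltW g0) ?(ltW ex0) //= ger_pMr.
  have zr : 1 - gamma <= zeta tau <= 1.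
    by rewrite /zeta; move: gz; move: (gamma * expR _) => a; lra.
  split; first by move: zr; lra.
  by have := pm_stable pm x epsr zr; lra.
have s0 : 0 <= c / eps by rewrite divr_ge0 ?ltW.
have z0 x : cube x1 r x -> zeta 0 <= ue eps (x, t0).
  by rewrite /zeta mulr0 expR0 mulr1; exact: Hx.
have := ode_barrier pm L0 lipf epsr r0 t00 s0 dzeta Hz z0.
have -> : c / eps * eps ^+ 2 = c * eps by field; rewrite gt_eqF.
apply: le_trans; rewrite /zeta -addrA lerD2l -opprD lerN2.
have -> : - gamma * (c / eps) = - (gamma * c / eps) by ring.
have -> : (L + 1) * (c / eps) - r / eps = - (r / 2 / eps).
  by rewrite /c; field; rewrite !gt_eqF.
by have := lerD E1 E2; rewrite -mulrDl; congr (_ <= _ * _); field.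
Qed.

(** The front is a shrinking sphere of radius [rad]: [rad / 2 - |x - x0|^2 / (2 rad)] has a gradient
    of length [|x - x0| / rad], below 1 exactly inside the sphere, where the function is positive.
    Balls close to 1 thus get a positive lifetime, uniformly in the starting time [t0]. *)
Lemma ball_persistence : exists2 theta : R, 0 < theta & forall x0 (R0 : R), 0 < R0 ->
  exists2 h : R, 0 < h & \forall eps \near 0^'+, forall t0 : R, 0 <= t0 ->
    (forall x, cube x0 (2 * R0) x -> 1 - theta * eps <= ue eps (x, t0)) ->
    forall x t, cube x0 (R0 / (4 * n.+1%:R)) x -> t0 <= t <= t0 + h ->
      1 - gamma <= ue eps (x, t).
Proof.
have [delta [theta [Q [Qr [Qrr [C [b [delta0 theta0 b0 bw Cb]]]]]]]] := pm_wave_global pm.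
exists theta => // x0 R0 R00.
pose N : R := n%:R; have N0 : 0 <= N by rewrite ler0n.
(* [V / 2] dominates the curvature term [n / rad <= 2 n / R0] and the speed [b]. *)
pose V := 4 * N / R0 + 2 * b.
have V0 : 0 < V by rewrite ltr_wpDl ?mulr_gt0 // divr_ge0 ?mulr_ge0 // ltW.
exists (R0 / (2 * V)); first by rewrite divr_gt0 // mulr_gt0.
(* Up to time [h] the radius is at least [R0 / 2], so the partial derivatives of the front are at
   most 4 on the cube of half-side [2 * R0]. *)
set h := R0 / (2 * V).
have c0 : 0 < R0 / 8 by rewrite divr_gt0.
apply: filterS3 (near_eps (pm_eps0 pm)) (bw_right bw c0)
  (wave_barrier b 4 pm bw delta0 theta0 (@cube_compact R n x0 (2 * R0)) R00).
move=> eps epsr Hright Hbar t0 t00 Hx x t cx tr; have /andP[e0 _] := epsr.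
pose rad (t : R) := R0 - V * (t - t0).
have radh s : t0 <= s <= t0 + h -> R0 / 2 <= rad s <= R0.
  move=> /andP[s1 s2]; rewrite /rad.
  have : V * (s - t0) <= R0 / 2.
    have : V * (s - t0) <= V * h by rewrite ler_pM2l // lerBlDl.
    by rewrite (_ : V * h = R0 / 2) // /h; field; rewrite gt_eqF.
  have : 0 <= V * (s - t0) by rewrite mulr_ge0 ?subr_ge0 // ltW.
  by move: (V * _) => a; lra.
pose D (y : 'rV[R]_n) : R := quad 1%:M (y - x0) (y - x0).
have DE y : D y = \sum_i (y 0 i - x0 0 i) ^+ 2.
  rewrite /D /quad; apply: eq_bigr => i _; rewrite (bigD1 i) //= big1 ?addr0.
    by rewrite !mxE eqxx mulr1 expr2.
  by move=> j ji; rewrite !mxE eq_sym (negbTE ji) mulr0 mul0r.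
have D0 y : 0 <= D y by rewrite DE; apply: sumr_ge0 => i _; exact: sqr_ge0.
pose psi (z : 'rV[R]_n * R) := rad z.2 / 2 - D z.1 / (2 * rad z.2).
pose psit (z : 'rV[R]_n * R) : R := - V / 2 - V * D z.1 / (2 * rad z.2 ^+ 2).
pose psi1 i (z : 'rV[R]_n * R) : R := - (z.1 0 i - x0 0 i) / rad z.2.
pose psi2 (i : 'I_n) (z : 'rV[R]_n * R) := - (rad z.2)^-1.
have drad (s : R) : is_derive s 1 rad (- V).
  have dc a : is_derive s 1 (fun _ : R => a : R) 0 by exact: is_derive_cst.
  apply: (is_derive_val (is_derive_sub (dc R0)
    (is_derive_cstM V (is_derive_sub (is_derive_idr s) (dc t0))))).
  by ring.
have key z : cyl x0 (2 * R0) t0 (t0 + h) z -> Q eps (psi z / eps) z.1 <= ue eps z.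
  move: z.
  apply: (Hbar (fun y _ => Cb eps y epsr) x0 (2 * R0) t0 (t0 + h) psi psit psi1 psi2 _ t00).
  - exact: subset_refl.
  - apply: continuous_in_subspaceT => z; rewrite inE => -[_ /radh/andP[rz1 _]].
    have rz : 2 * rad z.2 != 0 by rewrite gt_eqF // mulr_gt0 //; lra.
    have cr : (fun y : 'rV[R]_n * R => rad y.2) @ z --> rad z.2.
      apply: (@cvg_comp _ _ _ snd rad (nbhs z) (nbhs z.2)); first exact: cvg_snd.
      exact: (is_derive_cts (drad _)).
    apply: cvgB; first by apply: cvgM; [exact: cr|exact: cvg_cst].
    apply: cvgM; first exact: quad_cvg.
    by apply: cvgV => //; apply: cvgM; [exact: cvg_cst|exact: cr].
  - move=> z [cz1 cz2] _ _; have /andP[rz1 rz2] := radh _ cz2.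
    have rz : 0 < rad z.2 by apply: lt_le_trans rz1; rewrite divr_gt0.
    split.
    + have dc a : is_derive z.2 1 (fun _ : R => a : R) 0 by exact: is_derive_cst.
      have rz0 : 2 * rad z.2 != 0 by rewrite gt_eqF // mulr_gt0.
      have di := is_derive_cstM (D z.1) (is_derive_inv (is_derive_cstM 2 (drad z.2)) rz0).
      have dr : is_derive z.2 1 (fun t => rad t / 2) (- V / 2).
        by under eq_fun do rewrite mulrC; rewrite mulrC; exact: is_derive_cstM.
      apply: (is_derive_val (is_derive_sub dr di)).
      by rewrite /psit; field; rewrite gt_eqF.
    + move=> i; have jD := @jet2_quad R n 1%:M x0 z.1 i (trmx1 _ _).
      have := jet2_sub (jet2_cst (rad z.2 / 2)) (jet2_cstM (2 * rad z.2)^-1 jD).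
      have -> : \sum_j (1%:M : 'M[R]_n) i j * (z.1 0 j - x0 0 j) = z.1 0 i - x0 0 i.
        rewrite (bigD1 i) //= big1 ?addr0 ?mxE ?eqxx ?mul1r // => j ji.
        by rewrite mxE eq_sym (negbTE ji) mul0r.
      have -> : 0 - (2 * rad z.2)^-1 * (2 * (z.1 0 i - x0 0 i)) = psi1 i z.
        by rewrite /psi1; field; rewrite gt_eqF.
      have -> : 0 - (2 * rad z.2)^-1 * (2 * (1%:M : 'M[R]_n) i i) = psi2 i z.
        by rewrite /psi2 mxE eqxx mulr1n; field; rewrite gt_eqF.
      by congr jet2; apply/funext => s; rewrite /psi /= [_^-1 * _]mulrC.
    + move=> i; rewrite /psi1 normrM normrN normfV (gtr0_norm rz) ler_pdivrMr //.
      by apply: le_trans (cz1 i) _; lra.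
    + have -> : \sum_i psi1 i z ^+ 2 = D z.1 / rad z.2 ^+ 2.
        by rewrite DE mulr_suml; apply: eq_bigr => i _; rewrite /psi1 expr_div_n sqrrN.
      rewrite /psi; move: (D z.1) (rad z.2) rz => d a a0.
      have -> : (a / 2 - d / (2 * a)) * (1 - d / a ^+ 2) = (a ^+ 2 - d) ^+ 2 / (2 * a ^+ 3).
        by field; rewrite gt_eqF.
      by rewrite divr_ge0 ?sqr_ge0 // mulr_ge0 // exprn_ge0 // ltW.
    + have -> : \sum_i psi1 i z ^+ 2 = D z.1 / rad z.2 ^+ 2.
        by rewrite DE mulr_suml; apply: eq_bigr => i _; rewrite /psi1 expr_div_n sqrrN.
      rewrite /psi2 sumr_const card_ord -mulr_natr -/N /psit.
      have H1 : N / rad z.2 <= 2 * N / R0.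
        rewrite ler_pdivrMr // mulrAC ler_pdivlMr //.
        have := ler_wpM2l N0 rz1; by move: (rad _) => a; lra.
      have H2 : b <= V / 2.
        have : 0 <= N / R0 by rewrite divr_ge0 // ltW.
        rewrite (_ : V / 2 = 2 * (N / R0) + b); first by move: (N / R0) => a; lra.
        by rewrite /V; field; rewrite gt_eqF.
      have H3 : 0 <= D z.1 / rad z.2 ^+ 2 by rewrite divr_ge0 ?sqr_ge0.
      have H4 := ler_wpM2r H3 H2.
      have -> : V * D z.1 / (2 * rad z.2 ^+ 2) = V / 2 * (D z.1 / rad z.2 ^+ 2).
        by field; rewrite gt_eqF.
      have H5 : 2 * N / R0 <= V / 2 by rewrite /V; move: (N / R0) => a; lra.
      by move: (D z.1 / _) H3 H4 => d H3 H4; rewrite mulNr mulrC; lra.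
  - move=> z [cz1 cz2] [[i zi]|zt]; last first.
      by right; rewrite [z]surjective_pairing zt; exact: Hx.
    left; have /andP[rz1 rz2] := radh _ cz2.
    have rz : 0 < rad z.2 by apply: lt_le_trans rz1; rewrite divr_gt0.
    have Dz : 4 * R0 ^+ 2 <= D z.1.
      rewrite DE (bigD1 i) //= -[leLHS]addr0; apply: lerD.
        by rewrite -[leRHS]real_normK ?num_real // zi exprMn; lra.
      by apply: sumr_ge0 => j _; exact: sqr_ge0.
    rewrite /psi lerBlDr -lerBlDl.
    apply: (@le_trans _ _ (4 * R0 ^+ 2 / (2 * R0))).
      have -> : 4 * R0 ^+ 2 / (2 * R0) = 2 * R0 by field; rewrite gt_eqF.
      by lra.
    apply: ler_pM => //; rewrite ?invr_ge0 ?mulr_ge0 ?sqr_ge0 ?(ltW R00) //.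
    by rewrite lef_pV2 ?posrE ?mulr_gt0 // ler_pM2l.
have ct : cyl x0 (2 * R0) t0 (t0 + h) (x, t).
  split=> //= i; apply: le_trans (cx i) _.
  rewrite ler_pdivrMr ?mulr_gt0 //.
  have : R0 <= R0 * n.+1%:R by rewrite ler_peMr ?(ltW R00) // ler1n.
  by move: (n.+1%:R : R) => m; rewrite -mulrA (mulrCA R0); lra.
apply: le_trans (key _ ct); apply: Hright; rewrite ler_pM2r ?invr_gt0 //.
have /andP[rz1 rz2] := radh _ tr.
have rz : 0 < rad t by apply: lt_le_trans rz1; rewrite divr_gt0.
have Dx : D x <= R0 ^+ 2 / 16.
  rewrite DE; pose m : R := n.+1%:R; have m0 : 0 < m by rewrite ltr0n.
  apply: (@le_trans _ _ (\sum_(i < n) (R0 / (4 * m)) ^+ 2)).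
    apply: ler_sum => i _; rewrite -[leLHS]real_normK ?num_real //.
    by rewrite ler_sqr ?nnegrE ?divr_ge0 ?mulr_ge0 ?(ltW R00) ?(ltW m0) //; exact: cx.
  rewrite sumr_const card_ord -[leLHS]mulr_natr.
  have nm : n%:R <= m ^+ 2.
    apply: (@le_trans _ _ m); first by rewrite ler_nat.
    by rewrite expr2 ler_peMr ?(ltW m0) // ler1n.
  have -> : R0 ^+ 2 / 16 = (R0 / (4 * m)) ^+ 2 * m ^+ 2 by field; rewrite gt_eqF.
  by rewrite ler_wpM2l ?sqr_ge0.
rewrite /psi /=; apply: (@le_trans _ _ (R0 / 4 - R0 ^+ 2 / 16 / R0)).
  by rewrite (_ : R0 ^+ 2 / 16 / R0 = R0 / 16); [lra|field; rewrite gt_eqF].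
apply: lerB; first lra.
apply: ler_pM => //; first by rewrite invr_ge0 mulr_ge0 // ltW.
by rewrite lef_pV2 ?posrE ?mulr_gt0 //; lra.
Qed.

Definition settled z : Prop := Qpos z /\ exists2 r : R, 0 < r &
  \forall eps \near 0^'+, forall y s, cube z.1 r y -> `|s - z.2| <= r ->
    1 - gamma <= ue eps (y, s).

Lemma cubeS x (r r' : R) : r <= r' -> cube x r `<=` cube x r'.
Proof. by move=> rr y cy i; exact: le_trans (cy i) rr. Qed.

Lemma near_cube_mem (P : 'rV[R]_n -> Prop) x : (\forall y \near x, P y) ->
  exists2 r : R, 0 < r & forall y, cube x r y -> P y.
Proof.
move=> /near_ball[r r0 rP]; exists (r / 2); first by rewrite divr_gt0.
move=> y cy; apply: rP; apply/rV_norm_lt => // i; rewrite !mxE.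
by apply: le_lt_trans (cy i) _; lra.
Qed.

Lemma near_cyl (P : 'rV[R]_n * R -> Prop) z : (\forall p \near z, P p) ->
  exists2 r : R, 0 < r & forall p, cube z.1 r p.1 -> `|p.2 - z.2| <= r -> P p.
Proof.
move=> /near_ball[r r0 rP]; have r2 : 0 < r / 2 by rewrite divr_gt0.
exists (r / 2) => // y cy ty; apply: rP; rewrite prod_normE /= gt_max.
apply/andP; split; last by apply: le_lt_trans ty _; lra.
apply/rV_norm_lt => // i; rewrite !mxE.
by apply: le_lt_trans (cy i) _; lra.
Qed.

Lemma cyl_near z (r : R) : 0 < r ->
  \forall p \near z, cube z.1 r p.1 /\ `|p.2 - z.2| <= r.
Proof.
move=> r0; apply/nbhs_ballP; exists r => //= y; rewrite -ball_normE /= distrC.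
rewrite prod_normE /= gt_max => /andP[y1 y2]; split; last exact: ltW.
by move=> i; have /(rV_norm_lt _ r0)/(_ i) := y1; rewrite !mxE => /ltW.
Qed.

Lemma cube_trans x y w (r s : R) : cube x r y -> cube y s w -> cube x (r + s) w.
Proof.
move=> cy cw i; rewrite -[w 0 i](subrK (y 0 i)) -addrA addrC.
by apply: (le_trans (ler_normD _ _)); apply: lerD.
Qed.

Lemma cube_self x (r : R) : 0 <= r -> cube x r x.
Proof. by move=> r0 i; rewrite subrr normr0. Qed.

Lemma open_settled : open settled.
Proof.
rewrite openE => z [Qz [r r0 Hr]]; rewrite /interior.
have r2 : 0 < r / 2 by rewrite divr_gt0.
have Qn := near_Qpos Qz.
apply: filterS2 Qn (cyl_near z r2) => y Qy [cy ty]; split=> //; exists (r / 2) => //.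
apply: filterS Hr => eps He w s cw sw; apply: He.
  by rewrite (splitr r); exact: cube_trans cy cw.
rewrite -[s](subrK y.2) -addrA; apply: (le_trans (ler_normD _ _)).
by rewrite (splitr r); exact: lerD.
Qed.

(** [saturation] is started at time [t - c * eps], when [1 - gamma] is still available on a small
    cube, and the compact set is covered. The result supplies both the boundary data of
    [wave_barrier] and the final convergence to 1. *)
Lemma settled_compact (S : set ('rV[R]_n * R)) (theta : R) : 0 < theta -> compact S ->
  S `<=` settled ->
  \forall eps \near 0^'+, forall z, S z -> 1 - theta * eps <= ue eps z.
Proof.
move=> theta0 /compact_near_coveringP cS Ss.
apply: (cS _ (0^'+) (fun eps z => 1 - theta * eps <= ue eps z)) => z Sz.
have [Qz [r r0 Hr]] := Ss z Sz.
have [r' [r'0 r'r r'z]] := small_lt2 r0 (Qz : 0 < z.2).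
have r2 : 0 < r' / 2 by rewrite divr_gt0.
have [c c0 Hc] := saturation theta0 r2.
have ec : 0 < r' / (2 * c) by rewrite divr_gt0 // mulr_gt0.
have Heps : \forall eps \near 0^'+, forall p : 'rV[R]_n * R, cube z.1 (r' / 2) p.1 ->
    `|p.2 - z.2| <= r' / 2 -> 1 - theta * eps <= ue eps p.
  apply: filterS3 (near_eps ec) Hc Hr => eps /andP[e0 ec'] Hsat Hset p cp tp.
  have ce : c * eps < r' / 2.
    by move: ec'; rewrite ltr_pdivlMr ?mulr_gt0 //; lra.
  have ce0 : 0 < c * eps by rewrite mulr_gt0.
  have := Hsat p.1 (p.2 - c * eps); rewrite subrK -surjective_pairing; apply.
    by move: tp; rewrite ler_norml => /andP[t1 t2]; lra.
  move=> x cx; apply: Hset.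
    by apply: (cubeS (ltW r'r)); rewrite (splitr r'); exact: cube_trans cp cx.
  by move: tp; rewrite !ler_norml => /andP[t1 t2]; apply/andP; split; lra.
near=> p eps.
have [cp tp] : cube z.1 (r' / 2) p.1 /\ `|p.2 - z.2| <= r' / 2 by near: p; exact: cyl_near.
have Hp : forall p : 'rV[R]_n * R, cube z.1 (r' / 2) p.1 ->
    `|p.2 - z.2| <= r' / 2 -> 1 - theta * eps <= ue eps p by near: eps; exact: Heps.
exact: Hp.
Unshelve. all: end_near. Qed.

(** Three time scales: order [eps ^+ 2] to exceed [1 - gamma] at the uniform rate [mu] of the
    reaction, order [eps] for [saturation], then a time independent of [eps] from
    [ball_persistence]. Every positive [t] is eventually past the first two. *)
Lemma generation x0 (r0 s0 : R) : 0 < r0 -> 0 < s0 ->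
  (forall eps x, 0 < eps < eps0 -> cube x0 r0 x -> s0 <= ue eps (x, 0)) ->
  exists2 h : R, 0 < h & forall x t, cube x0 h x -> 0 < t <= h -> settled (x, t).
Proof.
move=> r00 s00 Hinit; have /andP[g0 g1] := pm_gamma pm.
have [L L0 lipf] := pm_lipschitz pm.
have L1 : 0 < L + 1 by rewrite addr_gt0.
pose r := r0 / 2; have r_0 : 0 < r by rewrite divr_gt0.
(* The excess [gamma / 2] over [1 - gamma] pays for the exponential error of [ode_barrier]. *)
pose s' := 1 - gamma / 2; have s'1 : s' < 1 by rewrite /s'; lra.
have s'g : 1 - gamma < s' by rewrite /s'; lra.
pose s1 := Num.min s0 s'.
have s10 : 0 < s1 by rewrite lt_min s00 /= /s'; lra.
have s1s0 : s1 <= s0 by rewrite ge_min lexx.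
have s1s' : s1 <= s' by rewrite ge_min lexx orbT.
have [mu mu0 Hmu] := pm_reaction pm (@cube_compact R n x0 r0) s10 s'1.
pose T := (s' - s1) / mu.
have T0 : 0 <= T by rewrite divr_ge0 ?subr_ge0 // ltW.
have gen : \forall eps \near 0^'+, forall x, cube x0 r x ->
    1 - gamma <= ue eps (x, T * eps ^+ 2).
  have ge1 : 0 < gamma / 2 by rewrite divr_gt0.
  have Hexp := expR_small (4 * n%:R * expR ((L + 1) * T)) r_0 ge1.
  apply: filterS3 (near_eps (pm_eps0 pm)) Hmu (filterI Hexp (near_eps ltr01)).
  move=> eps epsr Hf [He /andP[e0 e1]] x cx.
  pose zeta tau := s1 + mu * tau.
  have dz (tau : R) : is_derive tau (1 : R) zeta mu.
    have dc : is_derive tau 1 (fun _ : R => s1) 0 by exact: is_derive_cst.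
    exact: (is_derive_val (is_derive_add dc (is_derive_linear mu tau)) (add0r mu)).
  have Hz (tau : R) y : 0 <= tau <= T -> cube x r y ->
      -1 <= zeta tau <= 1 /\ mu + f eps (zeta tau) y <= 0.
    move=> /andP[tau0 tauT] cy.
    have zr : s1 <= zeta tau <= s'.
      rewrite /zeta lerDl mulr_ge0 ?(ltW mu0) //=.
      rewrite -lerBrDl mulrC -ler_pdivlMr //.
    split; first by move: zr; lra.
    have := Hf y (zeta tau) _ zr; rewrite -lerBrDl sub0r; apply.
    by rewrite (splitr r0); exact: cube_trans cx cy.
  have z0 y : cube x r y -> zeta 0 <= ue eps (y, 0).
    move=> cy; rewrite /zeta mulr0 addr0; apply: (le_trans s1s0); apply: Hinit => //.
    by rewrite (splitr r0); exact: cube_trans cx cy.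
  have := ode_barrier pm L0 lipf epsr r_0 (lexx 0) T0 dz Hz z0.
  rewrite add0r; apply: le_trans.
  have -> : zeta T = s' by rewrite /zeta /T mulrC divfK ?gt_eqF // addrC subrK.
  have := He; rewrite expRD mulrA -[- (r / eps)]mulNr.
  have : gamma / 2 * eps <= gamma / 2 by rewrite ger_pMr // ltW.
  rewrite mulNr; move: (_ * expR (- _)) => E; rewrite /s'; lra.
have [theta theta0 Hball] := ball_persistence.
pose r' := r / 2; have r'0 : 0 < r' by rewrite divr_gt0.
have [c c0 Hsat] := saturation theta0 r'0.
pose R0 := r' / 2; have R00 : 0 < R0 by rewrite divr_gt0.
have [h h0 Hh] := Hball x0 R0 R00.
pose rho := R0 / (4 * n.+1%:R).
have rho0 : 0 < rho by rewrite divr_gt0 // mulr_gt0.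
have [h' [h'0 h'r h'h]] := small_lt2 rho0 h0.
exists (h' / 2); first by rewrite divr_gt0.
move=> x t cx /andP[t0 th]; split; first exact: t0.
have h2 : 0 < h' / 2 by rewrite divr_gt0.
(* Since [q < t], the initial layer is over by time [t - q] once [eps] is small, that is, before the
   whole neighbourhood of [(x, t)] under consideration. *)
have [q [q0 qt qh]] := small_lt2 t0 h2.
exists q => //.
have et : 0 < (t - q) / (T + c + 1) by rewrite divr_gt0 ?subr_gt0 // ltr_wpDl // addr_ge0 // ltW.
apply: filterS3 gen Hsat (filterI Hh (filterI (near_eps et) (near_eps ltr01))).
move=> eps Hgen Hs [Hb [/andP[e0 et'] /andP[_ e1]]] y s cy sy.
pose t1 := T * eps ^+ 2 + c * eps.
have t10 : 0 <= T * eps ^+ 2 by rewrite mulr_ge0 // sqr_ge0.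
have t11 : 0 <= t1 by rewrite addr_ge0 // mulr_ge0 // ltW.
have t1q : t1 <= t - q.
  rewrite /t1; move: et'; rewrite ltr_pdivlMr; last by rewrite ltr_wpDl // addr_ge0 // ltW.
  have : T * eps ^+ 2 <= T * eps by rewrite ler_wpM2l // expr2 ger_pMr // ltW.
  by move: (T * eps ^+ 2) => a; lra.
apply: (Hb t1 t11).
- move=> w cw; apply: Hs => // v cv; apply: Hgen.
  rewrite (splitr r); apply: cube_trans cv.
  by apply: cubeS cw; rewrite /R0 /r'; lra.
- apply: (cubeS (ltW h'r)); rewrite (splitr h'); apply: cube_trans cx _.
  exact: (cubeS (ltW qh)).
- move: sy; rewrite /= ler_norml; move: t1q t11 h'h th qh; move: t1 => u1.
  by move=> *; apply/andP; split; lra.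
Qed.

End Propagation.

(** * Quadratic fronts *)

Section Quadric.
Context {R : realType} {n : nat}.
Variables (x1 e : 'rV[R]_n) (t1 a K lam : R) (Y : 'M[R]_n).
Hypothesis symY : Y^T = Y.
Implicit Types (x : 'rV[R]_n) (z : 'rV[R]_n * R) (c : R).

(** [qg] is the spatial gradient of [qP], [qN] its squared length and [qs] the inverse of its
    length; [qh] and [qm] are half the first and half the second derivatives of [qN]. A final 1 or 2
    marks derivatives in space, a final [t] the derivative in time. *)
Definition qP c z : R := c + a * (z.2 - t1) - K * (z.2 - t1) ^+ 2
  + dotv e (z.1 - x1) + quad Y (z.1 - x1) (z.1 - x1) / 2.
Definition qg j x : R := e 0 j + \sum_l Y j l * (x 0 l - x1 0 l).
Definition qN x : R := \sum_j qg j x ^+ 2.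
Definition qs x : R := (Num.sqrt (qN x))^-1.
Definition qh i x : R := \sum_j qg j x * Y j i.
Definition qm i : R := \sum_j Y j i ^+ 2.
Definition qs1 i x : R := - (qs x ^+ 3 * qh i x).
Definition qs2 i x : R := 3 * qs x ^+ 5 * qh i x ^+ 2 - qs x ^+ 3 * qm i.

(* [qP / |D qP|] has unit gradient on [qP = 0]; the term in [lam] fixes the sign of
   [|D qpsi| - 1] on both sides. *)
Definition qpsi c z : R := qP c z * qs z.1 - lam * (qP c z * qP c z).
Definition qpsit c z : R := (a - 2 * K * (z.2 - t1)) * (qs z.1 - 2 * lam * qP c z).
Definition qpsi1 c i z : R := qg i z.1 * qs z.1 + qP c z * qs1 i z.1
  - lam * (2 * qg i z.1 * qP c z).
Definition qpsi2 c i z : R := Y i i * qs z.1 + 2 * qg i z.1 * qs1 i z.1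
  + qP c z * qs2 i z.1 - lam * (2 * Y i i * qP c z + 2 * qg i z.1 ^+ 2).
(** The spatial gradient of [qpsi] is [qg * qs + qP * qv]. *)
Definition qv i x : R := qs1 i x - 2 * lam * qg i x.

Lemma is_derive_invsqrt (y : R) : 0 < y ->
  is_derive y (1 : R) (fun y => (Num.sqrt y)^-1) (- 2^-1 * (Num.sqrt y)^-1 ^+ 3).
Proof.
move=> y0; have s0 : 0 < Num.sqrt y by rewrite sqrtr_gt0.
apply: (is_derive_val (is_derive_inv (is_derive1_sqrt y0) (lt0r_neq0 s0))).
by field; rewrite gt_eqF.
Qed.

Lemma jet2_invsqrt (h : R -> R) (d1 d2 : R) : 0 < h 0 -> jet2 h d1 d2 ->
  jet2 (fun s => (Num.sqrt (h s))^-1) (- 2^-1 * (Num.sqrt (h 0))^-1 ^+ 3 * d1)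
    (3 / 4 * (Num.sqrt (h 0))^-1 ^+ 5 * d1 ^+ 2 - 2^-1 * (Num.sqrt (h 0))^-1 ^+ 3 * d2).
Proof.
move=> h0 jh; have ds := is_derive_invsqrt h0.
have ds3 := is_derive_mul (is_derive_mul ds ds) ds.
have dd : is_derive (h 0) (1 : R) (fun y => - 2^-1 * (Num.sqrt y)^-1 ^+ 3)
    (3 / 4 * (Num.sqrt (h 0))^-1 ^+ 5).
  have -> : (fun y : R => - 2^-1 * (Num.sqrt y)^-1 ^+ 3) =
      (fun y => - 2^-1 * ((Num.sqrt y)^-1 * (Num.sqrt y)^-1 * (Num.sqrt y)^-1)).
    by apply/funext => y; ring.
  apply: (is_derive_val (is_derive_cstM (- 2^-1) ds3)).
  by move: (Num.sqrt (h 0))^-1 => y; field.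
have near_d : \forall y \near h 0,
    is_derive y (1 : R) (fun y => (Num.sqrt y)^-1) (- 2^-1 * (Num.sqrt y)^-1 ^+ 3).
  by near=> y; apply: is_derive_invsqrt; near: y; exact: lt_nbhsr.
have := jet2_comp near_d dd jh.
by congr jet2; ring.
Unshelve. all: end_near. Qed.

Lemma qP_jet c z i :
  jet2 (fun s => qP c (z.1 + s *: e_ i, z.2)) (qg i z.1) (Y i i).
Proof.
have jq := jet2_cstM 2^-1 (jet2_quad x1 z.1 i symY).
have je : jet2 (fun s => dotv e (z.1 + s *: e_ i - x1)) (e 0 i) 0.
  have : jet2 (fun s => dotv e (z.1 + s *: e_ i - x1))
      (\sum_j e 0 j * (i == j)%:R) (\sum_(j < n) e 0 j * 0).
    apply: jet2_sumr => j; have := jet2_cstM (e 0 j) (jet2_coord x1 z.1 i j).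
    by congr jet2; apply/funext => s; rewrite !mxE.
  rewrite [X in jet2 _ _ X]big1 => [|j _]; last by rewrite mulr0.
  rewrite (bigD1 i) //= big1 ?addr0 ?eqxx ?mulr1 // => j ji.
  by rewrite eq_sym (negbTE ji) mulr0.
have := jet2_add (jet2_add (jet2_cst (c + a * (z.2 - t1) - K * (z.2 - t1) ^+ 2)) je) jq.
rewrite !add0r !mulrA mulVf // !mul1r -/(qg i z.1).
by congr jet2; apply/funext => s; rewrite /qP /=; ring.
Qed.

Lemma qs_jet x i : 0 < qN x -> jet2 (fun s => qs (x + s *: e_ i)) (qs1 i x) (qs2 i x).
Proof.
move=> N0.
have jN : jet2 (fun s => qN (x + s *: e_ i)) (2 * qh i x) (2 * qm i).
  have : jet2 (fun s => qN (x + s *: e_ i))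
     (\sum_j (Y j i * qg j x + qg j x * Y j i)) (\sum_j (2 * Y j i * Y j i)).
    apply: jet2_sumr => j; have ja := jet2_affine (qg j x) (Y j i).
    have := jet2_mul ja ja; rewrite !mul0r !addr0 mulr0 addr0 add0r.
    congr jet2; apply/funext => s; rewrite expr2.
    have -> // : qg j (x + s *: e_ i) = qg j x + s * Y j i.
    rewrite /qg -addrA; congr (_ + _).
    under eq_bigr do rewrite add_e_E addrAC mulrDr.
    rewrite big_split /=; congr (_ + _).
    rewrite (bigD1 i) //= big1 ?addr0 ?eqxx ?mulr1 1?mulrC // => l li.
    by rewrite eq_sym (negbTE li) !mulr0.
  congr jet2.
    by rewrite /qh mulr_sumr; apply: eq_bigr => j _; ring.
  by rewrite /qm mulr_sumr; apply: eq_bigr => j _; ring.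
have := @jet2_invsqrt (fun s => qN (x + s *: e_ i)) (2 * qh i x) (2 * qm i).
rewrite scale0r addr0 -/(qs x) => /(_ N0 jN).
by congr jet2; rewrite ?/qs1 ?/qs2; field.
Qed.

Lemma qpsi_jet c z i : 0 < qN z.1 ->
  jet2 (fun s => qpsi c (z.1 + s *: e_ i, z.2)) (qpsi1 c i z) (qpsi2 c i z).
Proof.
move=> N0; have jP := qP_jet c z i; have js := qs_jet i N0.
have := jet2_sub (jet2_mul jP js) (jet2_cstM lam (jet2_mul jP jP)).
rewrite scale0r addr0 -surjective_pairing.
by congr jet2; rewrite /qpsi1 /qpsi2; ring.
Qed.

Lemma qP_dt c z : is_derive z.2 1 (fun t => qP c (z.1, t)) (a - 2 * K * (z.2 - t1)).
Proof.
have dc (b : R) : is_derive z.2 (1 : R) (fun _ : R => b) 0 by exact: is_derive_cst.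
have dt := is_derive_sub (is_derive_idr z.2) (dc t1).
have := is_derive_add (is_derive_add (is_derive_sub (is_derive_add (dc c)
  (is_derive_cstM a dt)) (is_derive_cstM K (is_derive_mul dt dt)))
  (dc (dotv e (z.1 - x1)))) (dc (quad Y (z.1 - x1) (z.1 - x1) / 2)).
move=> D; apply: (is_derive_val D); by ring.
Qed.

Lemma qpsi_dt c z : is_derive z.2 1 (fun t => qpsi c (z.1, t)) (qpsit c z).
Proof.
have dc (b : R) : is_derive z.2 (1 : R) (fun _ : R => b) 0 by exact: is_derive_cst.
have dP := qP_dt c z.
have := is_derive_sub (is_derive_mul dP (dc (qs z.1))) (is_derive_cstM lam (is_derive_mul dP dP)).
rewrite -surjective_pairing => D; apply: (is_derive_val D).
by rewrite /qpsit; ring.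
Qed.

(** Since [qg * qs] is a unit vector, the defect of unit gradient is divisible by [qP]. Near the
    centre of the front the other factor has the sign of the product of [qg] and [qv], which [lam]
    makes negative. *)
Lemma qpsi_norm c z : 0 < qN z.1 -> \sum_i qpsi1 c i z ^+ 2 =
  1 + qP c z * (2 * qs z.1 * (\sum_i qg i z.1 * qv i z.1) + qP c z * \sum_i qv i z.1 ^+ 2).
Proof.
move=> N0.
have sN : qs z.1 ^+ 2 * qN z.1 = 1.
  by rewrite /qs exprVn sqr_sqrtr ?(ltW N0) // mulVf // gt_eqF.
rewrite -[X in _ = X + _]sN /qN !mulr_sumr mulrDr !mulr_sumr -!big_split /=.
by apply: eq_bigr => i _; rewrite /qpsi1 /qv; ring.
Qed.

Section Continuity.
Variables (T : Type) (G : set_system T) (FG : Filter G).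
Variables (cf : T -> R) (zf : T -> 'rV[R]_n * R) (c : R) (z : 'rV[R]_n * R).
Hypotheses (ccf : cf @ G --> c) (czf : zf @ G --> z).

Let cx i : (zf w).1 0 i @[w --> G] --> z.1 0 i.
Proof. exact: (cvg_comp _ _ czf (@coord_cvg R n i z)). Qed.

Let ct : (zf w).2 @[w --> G] --> z.2.
Proof. exact: (cvg_comp _ _ czf (@cvg_snd _ _ _ _ _)). Qed.

Lemma qP_cvg : qP (cf w) (zf w) @[w --> G] --> qP c z.
Proof.
have cdt : (zf w).2 - t1 @[w --> G] --> z.2 - t1 by apply: cvgB; [exact: ct|exact: cvg_cst].
apply: cvgD; last first.
  apply: cvgM; last exact: cvg_cst.
  exact: (cvg_comp _ _ czf (@quad_cvg R n Y x1 z)).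
apply: cvgD; last first.
  apply: cvg_sumr => i; apply: cvgM; first exact: cvg_cst.
  under eq_fun do rewrite mxE; rewrite mxE.
  by apply: cvgD; [exact: cx|exact: cvg_cst].
apply: cvgB; last first.
  by apply: cvgM; [exact: cvg_cst|apply: cvgM; exact: cdt].
by apply: cvgD; [exact: ccf|apply: cvgM; [exact: cvg_cst|exact: cdt]].
Qed.

Lemma qg_cvg i : qg i (zf w).1 @[w --> G] --> qg i z.1.
Proof.
apply: cvgD; first exact: cvg_cst.
apply: cvg_sumr => l; apply: cvgM; first exact: cvg_cst.
by apply: cvgD; [exact: cx|exact: cvg_cst].
Qed.

Lemma qN_cvg : qN (zf w).1 @[w --> G] --> qN z.1.
Proof. by apply: cvg_sumr => i; apply: cvgM; exact: qg_cvg. Qed.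

Lemma qs_cvg : 0 < qN z.1 -> qs (zf w).1 @[w --> G] --> qs z.1.
Proof.
move=> N0.
exact: (cvg_comp _ _ qN_cvg (is_derive_cts (is_derive_invsqrt N0))).
Qed.

Lemma qh_cvg i : qh i (zf w).1 @[w --> G] --> qh i z.1.
Proof. by apply: cvg_sumr => j; apply: cvgM; [exact: qg_cvg|exact: cvg_cst]. Qed.

Lemma cvg_expn (h : T -> R) (l : R) k : h @ G --> l -> h w ^+ k @[w --> G] --> l ^+ k.
Proof.
move=> ch; elim: k => [|k IH]; first by rewrite expr0; under eq_fun do rewrite expr0; exact: cvg_cst.
by rewrite exprS; under eq_fun do rewrite exprS; exact: cvgM.
Qed.

Hypothesis N0 : 0 < qN z.1.

Lemma qs1_cvg i : qs1 i (zf w).1 @[w --> G] --> qs1 i z.1.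
Proof.
by apply: cvgN; apply: cvgM; [apply: cvg_expn; exact: qs_cvg|exact: qh_cvg].
Qed.

Lemma qs2_cvg i : qs2 i (zf w).1 @[w --> G] --> qs2 i z.1.
Proof.
apply: cvgB; last by apply: cvgM; [apply: cvg_expn; exact: qs_cvg|exact: cvg_cst].
apply: cvgM; last by apply: cvg_expn; exact: qh_cvg.
by apply: cvgM; [exact: cvg_cst|apply: cvg_expn; exact: qs_cvg].
Qed.

Lemma qv_cvg i : qv i (zf w).1 @[w --> G] --> qv i z.1.
Proof.
by apply: cvgB; [exact: qs1_cvg|apply: cvgM; [exact: cvg_cst|exact: qg_cvg]].
Qed.

Lemma qpsi_cvg : qpsi (cf w) (zf w) @[w --> G] --> qpsi c z.
Proof.
apply: cvgB; first by apply: cvgM; [exact: qP_cvg|exact: qs_cvg].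
by apply: cvgM; [exact: cvg_cst|apply: cvgM; exact: qP_cvg].
Qed.

Lemma qpsi1_cvg i : qpsi1 (cf w) i (zf w) @[w --> G] --> qpsi1 c i z.
Proof.
apply: cvgB; last first.
  apply: cvgM; first exact: cvg_cst.
  by apply: cvgM; [apply: cvgM; [exact: cvg_cst|exact: qg_cvg]|exact: qP_cvg].
apply: cvgD; first by apply: cvgM; [exact: qg_cvg|exact: qs_cvg].
by apply: cvgM; [exact: qP_cvg|exact: qs1_cvg].
Qed.

Lemma qpsi2_cvg i : qpsi2 (cf w) i (zf w) @[w --> G] --> qpsi2 c i z.
Proof.
apply: cvgB; last first.
  apply: cvgM; first exact: cvg_cst.
  apply: cvgD; first by apply: cvgM; [exact: cvg_cst|exact: qP_cvg].
  by apply: cvgM; [exact: cvg_cst|apply: cvg_expn; exact: qg_cvg].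
apply: cvgD; last by apply: cvgM; [exact: qP_cvg|exact: qs2_cvg].
apply: cvgD; first by apply: cvgM; [exact: cvg_cst|exact: qs_cvg].
by apply: cvgM; [apply: cvgM; [exact: cvg_cst|exact: qg_cvg]|exact: qs1_cvg].
Qed.

Lemma qpsit_cvg : qpsit (cf w) (zf w) @[w --> G] --> qpsit c z.
Proof.
apply: cvgM.
  apply: cvgB; first exact: cvg_cst.
  by apply: cvgM; [exact: cvg_cst|apply: cvgB; [exact: ct|exact: cvg_cst]].
apply: cvgB; first exact: qs_cvg.
by apply: cvgM; [exact: cvg_cst|exact: qP_cvg].
Qed.

End Continuity.

End Quadric.

Section QuadraticForms.
Context {R : realType} {n : nat}.
Implicit Types (X Y : 'M[R]_n) (x y : 'rV[R]_n).

Lemma quadB_scalar X (k : R) x :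
  quad (X - k%:M) x x = quad X x x - k * dotv x x.
Proof.
rewrite /quad /dotv mulr_sumr -sumrB; apply: eq_bigr => i _.
have -> : k * (x 0 i * x 0 i) = \sum_j x 0 i * (k%:M : 'M[R]_n) i j * x 0 j.
  rewrite (bigD1 i) //= big1 ?addr0; first by rewrite mxE eqxx mulr1n; ring.
  by move=> j ji; rewrite mxE eq_sym (negbTE ji) mulr0n mulr0 mul0r.
by rewrite -sumrB; apply: eq_bigr => j _; rewrite !mxE; ring.
Qed.

Lemma trB_scalar X (k : R) : \tr (X - k%:M) = \tr X - k * n%:R.
Proof. by rewrite raddfB /= mxtrace_scalar mulr_natr. Qed.

Lemma symB_scalar X (k : R) : X^T = X -> (X - k%:M)^T = X - k%:M.
Proof. by move=> sX; rewrite raddfB /= tr_scalar_mx sX. Qed.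

Lemma quadZl X (k : R) x y : quad X (k *: x) y = k * quad X x y.
Proof.
rewrite /quad mulr_sumr; apply: eq_bigr => i _; rewrite mulr_sumr.
by apply: eq_bigr => j _; rewrite mxE; ring.
Qed.

Lemma quadZr X (k : R) x y : quad X x (k *: y) = k * quad X x y.
Proof.
rewrite /quad mulr_sumr; apply: eq_bigr => i _; rewrite mulr_sumr.
by apply: eq_bigr => j _; rewrite mxE; ring.
Qed.

Lemma quadZ X (k : R) x y : quad (k *: X) x y = k * quad X x y.
Proof.
rewrite /quad mulr_sumr; apply: eq_bigr => i _; rewrite mulr_sumr.
by apply: eq_bigr => j _; rewrite mxE; ring.
Qed.

Lemma quad0l X y : quad X 0 y = 0.
Proof. by rewrite /quad big1 // => i _; rewrite big1 // => j _; rewrite mxE !mul0r. Qed.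

Lemma dotvZl (k : R) x y : dotv (k *: x) y = k * dotv x y.
Proof. by rewrite /dotv mulr_sumr; apply: eq_bigr => i _; rewrite mxE mulrA. Qed.

Lemma dotvZr (k : R) x y : dotv x (k *: y) = k * dotv x y.
Proof. by rewrite /dotv mulr_sumr; apply: eq_bigr => i _; rewrite mxE mulrCA. Qed.

Lemma dotv0r x : dotv x 0 = 0.
Proof. by rewrite /dotv big1 // => i _; rewrite mxE mulr0. Qed.

End QuadraticForms.

Section QuadricNear.
Context {R : realType} {n : nat}.
Variables (z1 : 'rV[R]_n * R) (e : 'rV[R]_n) (a b K nu lam : R) (Y : 'M[R]_n).
Hypotheses (e1 : dotv e e = 1) (nu0 : 0 < nu).
Hypothesis lamE : lam = - quad Y e e / 2 + nu.
Hypothesis HF : a - \tr Y + quad Y e e + 2 * nu + b < 0.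
Let P := qP z1.1 e z1.2 a K Y.
Let g := qg z1.1 e Y.
Let N := qN z1.1 e Y.
Let s := qs z1.1 e Y.
Let h := qh z1.1 e Y.
Let v := qv z1.1 e lam Y.
Let psit := qpsit z1.1 e z1.2 a K lam Y.
Let psi1 := qpsi1 z1.1 e z1.2 a K lam Y.
Let psi2 := qpsi2 z1.1 e z1.2 a K lam Y.

(** Everything is evaluated at [z1] with [c = 0], where the gradient is the unit vector [e], and
    persists nearby by continuity. The value of [lam] makes the product of [g] and [v] equal to
    [- 2 * nu] there, and turns the Laplacian of [psi] into [\tr Y - quad Y e e - 2 * nu], that is,
    up to [nu], into the curvature term of the equation. *)
Lemma quadric_near : exists2 rho : R, 0 < rho & forall z c, cube z1.1 rho z.1 ->
    `|z.2 - z1.2| <= rho -> `|c| <= rho ->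
    [/\ 0 < N z.1, 2^-1 < s z.1 - lam * P c z,
     2 * s z.1 * (\sum_i g i z.1 * v i z.1) + P c z * (\sum_i v i z.1 ^+ 2) < 0,
     psit c z - \sum_i psi2 c i z + b * (\sum_i psi1 c i z ^+ 2) < 0
     & \sum_i psi1 c i z ^+ 2 < 4].
Proof.
have P0 c : P c z1 = c.
  by rewrite /P /qP !subrr mulr0 expr0n /= mulr0 dotv0r quad0l; lra.
have g0 i : g i z1.1 = e 0 i.
  by rewrite /g /qg big1 ?addr0 // => l _; rewrite subrr mulr0.
have N1 : N z1.1 = 1.
  by rewrite /N /qN -e1; apply: eq_bigr => i _; rewrite -/(g i _) g0 expr2.
have s1 : s z1.1 = 1 by rewrite /s /qs -/(N _) N1 sqrtr1 invr1.
have Npos : 0 < qN z1.1 e Y z1.1 by rewrite -/(N _) N1.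
have hE : \sum_i e 0 i * h i z1.1 = quad Y e e.
  rewrite /quad exchange_big /=; apply: eq_bigr => i _.
  rewrite /h /qh mulr_sumr; apply: eq_bigr => j _; rewrite -/(g j _) g0; ring.
have s11 i : qs1 z1.1 e Y i z1.1 = - h i z1.1.
  by rewrite /qs1 -/(s _) s1 expr1n mul1r.
have gv : \sum_i g i z1.1 * v i z1.1 = - 2 * nu.
  transitivity (- (\sum_i e 0 i * h i z1.1) - 2 * lam * dotv e e).
    rewrite /dotv mulr_sumr -sumrN -sumrB; apply: eq_bigr => i _.
    by rewrite g0 /v /qv s11 -/(g i _) g0; ring.
  by rewrite hE e1 lamE; field.
have psi11 i : psi1 0 i z1 = e 0 i.
  by rewrite /psi1 /qpsi1 -/(P 0 z1) P0 -/(s _) s1 -/(g i _) g0; ring.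
have psi1S : \sum_i psi1 0 i z1 ^+ 2 = 1.
  by rewrite -e1; apply: eq_bigr => i _; rewrite psi11 expr2.
have E1 : psit 0 z1 - \sum_i psi2 0 i z1 + b * (\sum_i psi1 0 i z1 ^+ 2) < 0.
  have -> : psit 0 z1 = a.
    by rewrite /psit /qpsit -/(P 0 z1) P0 -/(s _) s1 subrr; ring.
  have -> : \sum_i psi2 0 i z1 = \tr Y - 2 * (\sum_i e 0 i * h i z1.1) - 2 * lam * dotv e e.
    rewrite /mxtrace /dotv !mulr_sumr -!sumrB; apply: eq_bigr => i _.
    by rewrite /psi2 /qpsi2 -/(P 0 z1) P0 -/(s _) s1 -/(g i _) g0 s11; ring.
  by move: HF; rewrite hE e1 psi1S lamE; move: (\tr Y) (quad Y e e) => t q; lra.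
pose G := nbhs (z1, 0 : R).
have cz : (fun w : 'rV[R]_n * R * R => w.1) @ G --> z1 by exact: cvg_fst.
have cc : (fun w : 'rV[R]_n * R * R => w.2) @ G --> (0 : R) by exact: cvg_snd.
have cP : P w.2 w.1 @[w --> G] --> (0 : R) by rewrite -[X in _ --> X](P0 0); exact: qP_cvg.
have cN : N w.1.1 @[w --> G] --> (1 : R) by rewrite -[X in _ --> X]N1; exact: qN_cvg.
have cs : s w.1.1 @[w --> G] --> (1 : R) by rewrite -[X in _ --> X]s1; exact: qs_cvg.
have cg i : g i w.1.1 @[w --> G] --> g i z1.1 by exact: qg_cvg.
have cv i : v i w.1.1 @[w --> G] --> v i z1.1 by exact: qv_cvg.
have c1 i : psi1 w.2 i w.1 @[w --> G] --> psi1 0 i z1 by exact: qpsi1_cvg.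
have cS : \sum_i psi1 w.2 i w.1 ^+ 2 @[w --> G] --> (1 : R).
  by rewrite -[X in _ --> X]psi1S; apply: cvg_sumr => i; exact: cvg_expn.
have cA : 2 * s w.1.1 * (\sum_i g i w.1.1 * v i w.1.1) + P w.2 w.1 * (\sum_i v i w.1.1 ^+ 2)
    @[w --> G] --> 2 * 1 * (- 2 * nu) + 0 * (\sum_i v i z1.1 ^+ 2).
  apply: cvgD; last by apply: cvgM => //; apply: cvg_sumr => i; exact: cvg_expn.
  apply: cvgM; first by apply: cvgM; [exact: cvg_cst|].
  by rewrite -gv; apply: cvg_sumr => i; exact: cvgM.
have cE : psit w.2 w.1 - \sum_i psi2 w.2 i w.1 + b * (\sum_i psi1 w.2 i w.1 ^+ 2)
    @[w --> G] --> psit 0 z1 - \sum_i psi2 0 i z1 + b * (\sum_i psi1 0 i z1 ^+ 2).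
  apply: cvgD; last by rewrite psi1S; apply: cvgM; [exact: cvg_cst|].
  apply: cvgB; first exact: qpsit_cvg.
  by apply: cvg_sumr => i; exact: qpsi2_cvg.
have cB : s w.1.1 - lam * P w.2 w.1 @[w --> G] --> 1 - lam * 0.
  by apply: cvgB => //; apply: cvgM; [exact: cvg_cst|].
have nA : 2 * 1 * (- 2 * nu) + 0 * (\sum_i v i z1.1 ^+ 2) < 0.
  by rewrite mul0r addr0 mulr1 mulNr mulrN oppr_lt0 !mulr_gt0.
have n1 : (0 : R) < 1 by exact: ltr01.
have n2 : 2^-1 < 1 - lam * 0 by rewrite mulr0; lra.
have n4 : 1 < 4 :> R by lra.
have [r1 r10 H1] := near_ball (cvgr_gt _ cN _ n1).
have [r2 r20 H2] := near_ball (cvgr_gt _ cB _ n2).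
have [r3 r30 H3] := near_ball (cvgr_lt _ cA _ nA).
have [r4 r40 H4] := near_ball (cvgr_lt _ cE _ E1).
have [r5 r50 H5] := near_ball (cvgr_lt _ cS _ n4).
have [q1 [q10 q11 q12]] := small_lt2 r10 r20.
have [q2' [q20 q21 q22]] := small_lt2 r30 r40.
have [q3 [q30 q31 q32]] := small_lt2 q10 q20.
have [q [q0 qq1 qq2]] := small_lt2 q30 r50.
have q2 : 0 < q / 2 by rewrite divr_gt0.
have qq : q / 2 < q by lra.
exists (q / 2) => //.
move=> z c cz1 tz1 c_le.
have wq : `|(z, c) - (z1, 0 : R)| < q.
  rewrite !prod_normE /= !gt_max subr0 (le_lt_trans c_le qq) (le_lt_trans tz1 qq) !andbT.
  apply/rV_norm_lt => // i; rewrite !mxE; exact: le_lt_trans (cz1 i) qq.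
have q_3 : q < q3 by []. have q_1 : q < q1 by exact: lt_trans q31. have q_2 : q < q2' by exact: lt_trans q32.
split.
- by apply: (H1 (z, c)); apply: lt_trans wq _; exact: lt_trans q11.
- by apply: (H2 (z, c)); apply: lt_trans wq _; exact: lt_trans q12.
- by apply: (H3 (z, c)); apply: lt_trans wq _; exact: lt_trans q21.
- by apply: (H4 (z, c)); apply: lt_trans wq _; exact: lt_trans q22.
- by apply: (H5 (z, c)); apply: lt_trans wq _.
Qed.

End QuadricNear.

(** * Contact at a nonvanishing gradient *)

Section Superflow.
Context {R : realType} {n : nat} (eps0 gamma : R).
Context (f : R -> R -> 'rV[R]_n -> R) (ue : R -> 'rV[R]_n * R -> R) (beta : 'rV[R]_n -> R).
Hypothesis pm : phase_model eps0 gamma f ue beta.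
Implicit Types (x y : 'rV[R]_n) (z : 'rV[R]_n * R).

Let settled := @settled R n gamma ue.

(** Subtracting [d], which is at least [m0] on the parabolic boundary of a small cylinder, and
    adding a constant [c < m0 / 2] places [z1] strictly inside the front, while every boundary point
    is settled or well outside it. [wave_barrier] then gives [1 - gamma] near [z1]. *)
Lemma unit_front z1 e (a K b r0 : R) (X : 'M[R]_n) :
  Qpos z1 -> dotv e e = 1 -> X^T = X -> (usc_env setT beta z1.1 < b%:E)%E -> 0 < r0 ->
  a - \tr X + quad X e e + b < 0 ->
  (forall z, cube z1.1 r0 z.1 -> `|z.2 - z1.2| <= r0 -> ~ settled z ->
     a * (z.2 - z1.2) + dotv e (z.1 - z1.1) + quad X (z.1 - z1.1) (z.1 - z1.1) / 2
     - K * (z.2 - z1.2) ^+ 2 <= 0) ->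
  settled z1.
Proof.
move=> Qz1 e1 symX Hb r00 HF Hout.
pose sig := - (a - \tr X + quad X e e + b).
have sig0 : 0 < sig by rewrite oppr_gt0.
pose M : R := n.+1%:R; have M0 : 0 < M by rewrite ltr0n.
have nM : n%:R = M - 1 by rewrite /M -natr1 addrK.
(* Lowering the Hessian by [2 * kap] costs less than [2 * kap * M = sig / 4], and [2 * nu] costs
   another [sig / 4]. *)
pose kap := sig / (8 * M); have kap0 : 0 < kap by rewrite divr_gt0 // mulr_gt0.
pose nu := sig / 8; have nu0 : 0 < nu by rewrite divr_gt0.
pose Y := X - (2 * kap)%:M.
have symY : Y^T = Y by exact: symB_scalar.
pose lam := - quad Y e e / 2 + nu.
have [delta [theta [Q [Qr [Qrr [C [rw [delta0 theta0 rw0 bw HC]]]]]]]] := pm_wave pm Hb.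
pose P := qP z1.1 e z1.2 a (K + 1) Y.
pose g := qg z1.1 e Y; pose N := qN z1.1 e Y; pose s := qs z1.1 e Y; pose h := qh z1.1 e Y.
pose v := qv z1.1 e lam Y.
pose psi := qpsi z1.1 e z1.2 a (K + 1) lam Y.
pose psit := qpsit z1.1 e z1.2 a (K + 1) lam Y.
pose psi1 := qpsi1 z1.1 e z1.2 a (K + 1) lam Y.
pose psi2 := qpsi2 z1.1 e z1.2 a (K + 1) lam Y.
have t1_0 : 0 < z1.2 by exact: Qz1.
have HY : a - \tr Y + quad Y e e + 2 * nu + b < 0.
  have H1 : kap * M = sig / 8 by rewrite /kap; field; rewrite gt_eqF.
  have H2 : a - \tr X + quad X e e + b = - sig by rewrite opprK.
  have H3 : 2 * kap * M = 2 * (kap * M) by rewrite mulrA.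
  rewrite trB_scalar nM /Y quadB_scalar e1 mulrBr mulr1 /nu.
  move: (\tr X) (quad X e e) (kap * M) (2 * kap * M) H1 H2 H3 kap0 sig0 => t q kM kM2.
  by clear; move=> *; lra.
have [rho rho0 Hrho] := quadric_near z1 (K + 1) e1 nu0 (erefl lam) HY.
have P0 c : P c z1 = c.
  by rewrite /P /qP !subrr mulr0 expr0n /= mulr0 dotv0r quad0l; ring.
have [q1 [q10 q11 q12]] := small_lt2 rho0 r00.
have [q2 [q20 q21 q22]] := small_lt2 rw0 t1_0.
have [r [r_0 r1 r2]] := small_lt2 q10 q20.
have {r1 q10 q11 q12 q1} [r_rho r_r0] := conj (lt_trans r1 q11) (lt_trans r1 q12).
have {r2 q20 q21 q22 q2} [r_rw r_t1] := conj (lt_trans r2 q21) (lt_trans r2 q22).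
pose kap' := Num.min kap 1; have kap'0 : 0 < kap' by rewrite lt_min kap0 ltr01.
have kap'k : kap' <= kap by rewrite ge_min lexx.
have kap'1 : kap' <= 1 by rewrite ge_min lexx orbT.
pose m0 := kap' * r ^+ 2; have m00 : 0 < m0 by rewrite mulr_gt0 ?exprn_gt0.
pose d z := kap * dotv (z.1 - z1.1) (z.1 - z1.1) + (z.2 - z1.2) ^+ 2.
have m02 : 0 < m0 / 2 by rewrite divr_gt0.
have [c [c0 cm cr]] := small_lt2 m02 rho0.
pose cy := cyl z1.1 r (z1.2 - r) (z1.2 + r).
have cyP z : cy z -> cube z1.1 r z.1 /\ `|z.2 - z1.2| <= r.
  by move=> [A /andP[B1 B2]]; split=> //; rewrite ler_distl B1.
have Hz z : cy z -> [/\ 0 < N z.1, 2^-1 < s z.1 - lam * P c z,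
     2 * s z.1 * (\sum_i g i z.1 * v i z.1) + P c z * (\sum_i v i z.1 ^+ 2) < 0,
     psit c z - \sum_i psi2 c i z + b * (\sum_i psi1 c i z ^+ 2) < 0
     & \sum_i psi1 c i z ^+ 2 < 4].
  move=> /cyP[A B]; apply: Hrho.
  - by apply: cubeS A; exact: ltW.
  - by apply: le_trans B _; exact: ltW.
  - by rewrite gtr0_norm // ltW.
have PE z : P c z = P 0 z + c by rewrite /P /qP; ring.
have Pd z : P 0 z = (a * (z.2 - z1.2) + dotv e (z.1 - z1.1)
    + quad X (z.1 - z1.1) (z.1 - z1.1) / 2 - K * (z.2 - z1.2) ^+ 2) - d z.
  by rewrite /P /qP /Y quadB_scalar /d; field.
have cP z : (fun y : 'rV[R]_n * R => P 0 y) @ z --> P 0 z.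
  by apply: (@qP_cvg _ _ _ _ _ _ _ _ _ (nbhs z)); [exact: cvg_cst|exact: cvg_id].
have cd z : d @ z --> d z.
  have cdt : (fun y : 'rV[R]_n * R => y.2 - z1.2) @ z --> z.2 - z1.2.
    by apply: cvgB; [exact: cvg_snd|exact: cvg_cst].
  have cdx i : (fun y : 'rV[R]_n * R => (y.1 - z1.1) 0 i) @ z --> (z.1 - z1.1) 0 i.
    under eq_fun do rewrite mxE; rewrite mxE.
    by apply: cvgD; [exact: coord_cvg|exact: cvg_cst].
  apply: cvgD; last exact: cvg_expn.
  apply: cvgM; first exact: cvg_cst.
  by apply: cvg_sumr => i; exact: cvgM.
(* An unsettled point with [d >= m0] has [P 0 <= - m0], so that all of [S] is settled. *)
pose S := cy `&` ([set z | m0 <= d z] `&` [set z | - (3 / 4 * m0) <= P 0 z]).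
have cS : compact S.
  apply: compact_closedI; first exact: cyl_compact.
  apply: closedI.
    apply: (@closed_comp _ _ d [set x | m0 <= x]); [by move=> z _; exact: cd|exact: closed_ge].
  apply: (@closed_comp _ _ (P 0) [set x | - (3 / 4 * m0) <= x]); last exact: closed_ge.
  by move=> z _; exact: cP.
have Ss : S `<=` settled.
  move=> z [/cyP[A B] [D1 D2]]; apply: contrapT => nz.
  have : P 0 z + d z <= 0.
    rewrite Pd subrK; apply: Hout => //.
      by apply: cubeS A; exact: ltW.
    by apply: le_trans B _; exact: ltW.
  by move: D1 D2 => /= D1 D2; move: (P 0 z) (d z) D1 D2 m00; clear; move=> *; lra.
have bd z : cy z -> (exists i, `|z.1 0 i - z1.1 0 i| = r) \/ z.2 = z1.2 - r -> m0 <= d z.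
  move=> cz [[i zi]|zt].
    have D1 : r ^+ 2 <= dotv (z.1 - z1.1) (z.1 - z1.1).
      apply: le_trans (sqr_le_dotv _ i); rewrite !mxE -[leRHS]real_normK ?num_real //.
      by rewrite zi.
    rewrite /d /m0 -[leLHS]addr0; apply: lerD; last exact: sqr_ge0.
    by apply: ler_pM => //; [exact: ltW|exact: sqr_ge0].
  rewrite /d /m0 -[leLHS]add0r; apply: lerD.
    by rewrite mulr_ge0 ?dotv_ge0 // ltW.
  by rewrite zt addrAC subrr add0r sqrrN ler_piMl // sqr_ge0.
have m08 : 0 < m0 / 8 by rewrite divr_gt0.
have c4 : 0 < c / 4 by rewrite divr_gt0.
have Hbar := wave_barrier b 2 pm bw delta0 theta0 (@cube_compact R n z1.1 r) m08.
have Hset := settled_compact pm theta0 cS Ss.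
have [r3 r30 Hr3] : exists2 r3 : R, 0 < r3 & forall z, cube z1.1 r3 z.1 ->
    `|z.2 - z1.2| <= r3 -> c / 2 < P c z.
  apply: near_cyl; have : c / 2 < P 0 z1 + c by rewrite P0 add0r ltr_pdivrMr // ltr_pMr // ltr1n.
  move=> /(cvgr_gt _ (cvgD (cP z1) (cvg_cst c))).
  by apply: filterS => z; rewrite PE.
have [r4 [r40 r4r r4r3]] := small_lt2 r_0 r30.
split=> //; exists r4 => //.
apply: filterS3 Hbar (filterI HC (near_eps (pm_eps0 pm))) (filterI Hset (bw_right bw c4)).
move=> eps Hb1 [HC1 epsr] [Hs1 Hr1] y t cyr tr; have /andP[eps_gt0 _] := epsr.
have cyt : cy (y, t).
  split; first by apply: cubeS cyr; exact: ltW.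
  by rewrite -ler_distl; apply: le_trans tr _; exact: ltW.
have HK x : cube z1.1 r x -> C eps x <= eps * b.
  by move=> cx; apply: HC1; apply: cubeS cx; exact: ltW.
have := Hb1 HK z1.1 r (z1.2 - r) (z1.2 + r) (psi c) (psit c) (psi1 c) (psi2 c).
move=> /(_ (@subset_refl _ _)) H; apply: le_trans (H _ _ _ _ (y, t) cyt).
- apply: Hr1; rewrite ler_pM2r ?invr_gt0 //.
  have PP : c / 2 < P c (y, t).
    by apply: Hr3; [apply: cubeS cyr; exact: ltW|apply: le_trans tr _; exact: ltW].
  have [_ B _ _ _] := Hz _ cyt.
  have -> : psi c (y, t) = P c (y, t) * (s y - lam * P c (y, t)).
    by rewrite /psi /qpsi -/(P c _) -/(s _) /=; ring.
  have -> : c / 4 = c / 2 * 2^-1 by field.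
  by apply: ler_pM; rewrite ?divr_ge0 ?(ltW c0) ?invr_ge0 ?(ltW PP) ?(ltW B).
- by rewrite subr_ge0 ltW.
- apply: continuous_in_subspaceT => z; rewrite inE => /Hz[Nz _ _ _ _].
  exact: (@qpsi_cvg R n z1.1 e z1.2 a (K + 1) lam Y _ (nbhs z) _ (fun=> c) id c z
    (cvg_cst _) (@cvg_id _ _) Nz).
- move=> z cz _ _; have [Nz B A E S4] := Hz z cz; split.
  + exact: qpsi_dt.
  + by move=> i; apply: qpsi_jet.
  + move=> i; have p4 : psi1 c i z ^+ 2 <= 4.
      apply: le_trans (ltW S4); rewrite (bigD1 i) //= lerDl; apply: sumr_ge0 => j _.
      exact: sqr_ge0.
    rewrite -ler_sqr ?nnegrE // real_normK ?num_real //.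
    by rewrite -natrX.
  + have nE : \sum_i psi1 c i z ^+ 2 = 1 + P c z * (2 * s z.1 * (\sum_i g i z.1 * v i z.1)
       + P c z * \sum_i v i z.1 ^+ 2) by exact: qpsi_norm.
    rewrite nE; have -> : psi c z = P c z * (s z.1 - lam * P c z).
      by rewrite /psi /qpsi -/(P c _) -/(s _) /=; ring.
    move: A B; set AA := _ + P c z * _; move: AA (P c z) (s z.1) => AA p sz A B.
    have -> : p * (sz - lam * p) * (1 - (1 + p * AA)) = p ^+ 2 * ((sz - lam * p) * (- AA)) by ring.
    apply: mulr_ge0; first exact: sqr_ge0.
    by apply: mulr_ge0; [apply: ltW; apply: lt_trans B; rewrite invr_gt0|rewrite oppr_ge0 ltW].
  + exact: ltW.
- move=> z cz bz; have dz := bd z cz bz; have [Nz B _ _ _] := Hz z cz.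
  (* Either the point is in [S], where [ue] is close to 1, or [P c <= - 3/4 m0 + m0 / 2], and
     passing from [P c] to [psi] loses at most a factor 2. *)
  have [P3|P3] := leP (- (3 / 4 * m0)) (P 0 z).
    by right; apply: Hs1; split=> //; split.
  left; have -> : psi c z = P c z * (s z.1 - lam * P c z).
    by rewrite /psi /qpsi -/(P c _) -/(s _) /=; ring.
  have Pc : P c z <= - (m0 / 4) by rewrite PE; move: (P 0 z) P3 cm m00; clear; move=> *; lra.
  rewrite -lerN2 opprK -mulNr.
  have -> : m0 / 8 = m0 / 4 * 2^-1 by field.
  apply: ler_pM; rewrite ?divr_ge0 ?(ltW m00) ?invr_ge0 ?(ltW B) //.
  by rewrite lerNr.
Qed.

End Superflow.

Section QuadraticForms2.
Context {R : realType} {n : nat}.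
Implicit Types (X Y : 'M[R]_n) (x y p : 'rV[R]_n).

Lemma quadDl X x y p : quad X (x + y) p = quad X x p + quad X y p.
Proof.
rewrite /quad -big_split /=; apply: eq_bigr => i _; rewrite -big_split /=.
by apply: eq_bigr => j _; rewrite mxE; ring.
Qed.

Lemma quadC X x y : X^T = X -> quad X x y = quad X y x.
Proof.
move=> sX; rewrite /quad exchange_big; apply: eq_bigr => i _; apply: eq_bigr => j _.
by rewrite -[in LHS]sX mxE; ring.
Qed.

Lemma quadD X x y : X^T = X ->
  quad X (x + y) (x + y) = quad X x x + 2 * quad X x y + quad X y y.
Proof.
move=> sX; rewrite quadDl [quad X x (x + y)]quadC // [quad X y (x + y)]quadC //.
by rewrite !quadDl [quad X y x]quadC //; ring.
Qed.

Lemma dotv_mulmx X x y : dotv (x *m X) y = quad X x y.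
Proof.
rewrite /quad exchange_big; apply: eq_bigr => j _.
by rewrite mxE mulr_suml.
Qed.

Lemma quad_bound X x y (r s : R) : (forall i, `|x 0 i| <= r) -> (forall i, `|y 0 i| <= s) ->
  `|quad X x y| <= (\sum_i \sum_j `|X i j|) * (r * s).
Proof.
move=> xr ys; apply: (le_trans (ler_norm_sum _ _ _)); rewrite mulr_suml.
apply: ler_sum => i _; apply: (le_trans (ler_norm_sum _ _ _)); rewrite mulr_suml.
apply: ler_sum => j _; rewrite !normrM mulrAC mulrC.
by rewrite ler_wpM2l // ler_pM.
Qed.

Lemma mulmx_bound X x (r : R) j : (forall i, `|x 0 i| <= r) ->
  `|(x *m X) 0 j| <= (\sum_i \sum_j `|X i j|) * r.
Proof.
move=> xr; rewrite mxE; apply: (le_trans (ler_norm_sum _ _ _)); rewrite mulr_suml.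
apply: ler_sum => i _; rewrite normrM mulrC.
apply: (@le_trans _ _ (`|X i j| * r)); first by rewrite ler_wpM2l.
have r0 : 0 <= r by exact: le_trans (xr i).
rewrite ler_wpM2r // (bigD1 j) //= lerDl; exact: sumr_ge0.
Qed.

Lemma sqr_enorm x : enorm x ^+ 2 = dotv x x.
Proof.
rewrite /enorm big_ord1 sqr_sqrtr; first by apply: eq_bigr => i _; rewrite expr2.
by apply: sumr_ge0 => i _; exact: sqr_ge0.
Qed.

Lemma enorm_ge0 x : 0 <= enorm x.
Proof. exact: sqrtr_ge0. Qed.

Lemma enorm_gt0 x : x <> 0 -> 0 < enorm x.
Proof.
move=> x0; rewrite lt_neqAle enorm_ge0 andbT eq_sym; apply/negP => /eqP e0; apply: x0.
apply/rowP => i; rewrite mxE; apply/eqP; rewrite -sqrf_eq0 eq_le sqr_ge0 andbT.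
by have := sqr_le_dotv x i; rewrite -sqr_enorm e0 expr0n.
Qed.

Lemma enorm0 : enorm (0 : 'rV[R]_n) = 0.
Proof.
rewrite /enorm big1 ?sqrtr0 // => i _; rewrite big1 // => j _.
by rewrite mxE expr0n.
Qed.

Lemma enormZ (k : R) x : 0 <= k -> enorm (k *: x) = k * enorm x.
Proof.
move=> k0; apply/eqP; rewrite -(@eqrXn2 _ 2) ?mulr_ge0 ?enorm_ge0 //.
by rewrite exprMn !sqr_enorm dotvZl dotvZr mulrA expr2.
Qed.

Lemma enorm_le x (r : R) : 0 <= r -> (forall i, `|x 0 i| <= r) -> enorm x <= n.+1%:R * r.
Proof.
move=> r0 xr; rewrite -ler_sqr ?nnegrE ?enorm_ge0 ?mulr_ge0 ?ler0n // sqr_enorm.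
apply: (@le_trans _ _ (\sum_(i < n) r ^+ 2)).
  apply: ler_sum => i _; rewrite -expr2 -[leLHS]real_normK ?num_real //.
  by rewrite ler_sqr ?nnegrE.
rewrite sumr_const card_ord -[leLHS]mulr_natl exprMn ler_wpM2r ?sqr_ge0 //.
by rewrite -natrX ler_nat; apply: (leq_trans (leqnSn n)); rewrite -{1}[n.+1]expn1 leq_pexp2l.
Qed.

Lemma F_E x X : F (x, X) = - \tr X + quad X ((enorm x)^-1 *: x) ((enorm x)^-1 *: x).
Proof.
rewrite /F /=; set e := _ *: x; rewrite mulmxBl mul1mx raddfB /= opprB addrC; congr (_ + _).
rewrite -mulmxA mxtrace_mulC /mxtrace big_ord1 mxE -dotv_mulmx; apply: eq_bigr => j _.
by rewrite [e^T _ _]mxE.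
Qed.

Lemma unit_enorm x : x <> 0 -> dotv ((enorm x)^-1 *: x) ((enorm x)^-1 *: x) = 1.
Proof.
move=> /enorm_gt0 x0; rewrite dotvZl dotvZr -sqr_enorm.
by field; rewrite gt_eqF.
Qed.

(** Used to test [F] near [p = 0] along one coordinate direction, where only the diagonal of [X]
    intervenes. *)
Lemma F_diag (s : R) X (i : 'I_n) : 0 < s -> F (s *: e_ i, X) = X i i - \tr X.
Proof.
move=> s0; have ei : enorm (e_ i : 'rV[R]_n) = 1.
  apply/eqP; rewrite -(@eqrXn2 _ 2) ?enorm_ge0 // expr1n sqr_enorm /dotv (bigD1 i) //=.
  rewrite big1 ?addr0; first by rewrite !mxE !eqxx mulr1.
  by move=> j ji; rewrite !mxE (negbTE ji) mulr0.
rewrite F_E enormZ ?(ltW s0) // ei mulr1 scalerA mulVf ?gt_eqF // scale1r addrC; congr (_ - _).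
rewrite /quad (bigD1 i) //= (bigD1 i) //= !big1 ?addr0.
- by rewrite !mxE !eqxx mul1r mulr1.
- by move=> j ji; rewrite big1 // => l _; rewrite !mxE (negbTE ji) mul0r mul0r.
- by move=> j ji; rewrite !mxE (negbTE ji) mulr0.
Qed.

End QuadraticForms2.

Section Fronts.
Context {R : realType} {n : nat} (eps0 gamma : R).
Context (f : R -> R -> 'rV[R]_n -> R) (ue : R -> 'rV[R]_n * R -> R) (beta : 'rV[R]_n -> R).
Hypothesis pm : phase_model eps0 gamma f ue beta.
Implicit Types (x y : 'rV[R]_n) (z : 'rV[R]_n * R).

Let settled := @settled R n gamma ue.

(** The condition is homogeneous of degree one in the jet [(a, p, X)], so division by the length of
    [p] reduces to a unit gradient. *)
Lemma front z1 p (a K b r0 : R) (X : 'M[R]_n) :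
  Qpos z1 -> p <> 0 -> X^T = X -> (usc_env setT beta z1.1 < b%:E)%E -> 0 < r0 ->
  a + F (p, X) + b * enorm p < 0 ->
  (forall z, cube z1.1 r0 z.1 -> `|z.2 - z1.2| <= r0 -> ~ settled z ->
     a * (z.2 - z1.2) + dotv p (z.1 - z1.1) + quad X (z.1 - z1.1) (z.1 - z1.1) / 2
     - K * (z.2 - z1.2) ^+ 2 <= 0) ->
  settled z1.
Proof.
move=> Qz1 p0 sX Hb r00 HF Hout; have e0 := enorm_gt0 p0.
pose k := (enorm p)^-1; have k0 : 0 < k by rewrite invr_gt0.
apply: (@unit_front R n eps0 gamma f ue beta pm z1 (k *: p) (k * a) (k * K) b r0 (k *: X)) => //.
- exact: unit_enorm.
- by rewrite linearZ /= sX.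
- have -> : \tr (k *: X) = k * \tr X by rewrite linearZ.
  move: HF; rewrite quadZ F_E -/k -(pmulr_rlt0 _ k0).
  have : k * enorm p = 1 by rewrite mulVf // gt_eqF.
  move: (\tr X) (quad _ _ _) (enorm p) => t q e.
  clear; move=> ke.
  have -> : k * (a + (- t + q) + b * e) = k * a - k * t + k * q + b * (k * e) by ring.
  by rewrite ke mulr1.
- move=> z cz tz nz; have := Hout z cz tz nz; rewrite -(pmulr_rle0 _ k0) dotvZl quadZ.
  by apply: le_trans; rewrite le_eqVlt; apply/orP; left; apply/eqP; ring.
Qed.

End Fronts.

(** * Contact at a vanishing gradient *)

Section DegenerateFront.
Context {R : realType} {n : nat} (eps0 gamma : R).
Context (f : R -> R -> 'rV[R]_n -> R) (ue : R -> 'rV[R]_n * R -> R) (beta : 'rV[R]_n -> R).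
Hypothesis pm : phase_model eps0 gamma f ue beta.
Implicit Types (x y h : 'rV[R]_n) (z : 'rV[R]_n * R).

Let settled := @settled R n gamma ue.

Lemma dotv0l x : dotv 0 x = 0.
Proof. by rewrite /dotv big1 // => i _; rewrite mxE mul0r. Qed.

Lemma qP_shift x1 y h (t1 t s a K c : R) (Y : 'M[R]_n) (tau : R) : Y^T = Y ->
  qP x1 0 t1 a K Y c (y - (s - tau) *: h, t) = qP x1 0 t1 a K Y c (y - s *: h, t)
    + tau * quad Y (y - s *: h - x1) h + tau ^+ 2 * quad Y h h / 2.
Proof.
move=> sY; have -> : y - (s - tau) *: h = y - s *: h + tau *: h.
  by rewrite scalerBl opprB addrA addrAC.
rewrite /qP /= !dotv0l.
have -> : y - s *: h + tau *: h - x1 = (y - s *: h - x1) + tau *: h by rewrite addrAC.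
rewrite quadD // quadZr quadZl quadZr.
by move: (quad _ _ _) (quad _ _ _) (quad _ _ _) => A B C; field.
Qed.

Lemma qP_expand x1 y y' (t1 t t' a K c : R) (Y : 'M[R]_n) : Y^T = Y ->
  qP x1 0 t1 a K Y c (y', t') = qP x1 0 t1 a K Y c (y, t)
   + ((a - 2 * K * (t - t1)) * (t' - t) + dotv ((y - x1) *m Y) (y' - y)
      + quad Y (y' - y) (y' - y) / 2 - K * (t' - t) ^+ 2).
Proof.
move=> sY; rewrite /qP /= !dotv0l.
have -> : y' - x1 = (y - x1) + (y' - y) by rewrite [RHS]addrC addrA subrK.
rewrite quadD // dotv_mulmx; by move: (quad _ _ _) (quad _ _ _) (quad _ _ _) => A B C; field.
Qed.

(* Sliding [P] along [h]: if [P (. - h)] exceeded 0 at an unsettled point, then for the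
   largest excess along the segment [s h] the gradient could not vanish, so that [front]
   applies there. *)
Lemma slide z0 (a b K kap eta r : R) (Y : 'M[R]_n) :
  Y^T = Y -> (forall x, (usc_env setT beta x < b%:E)%E) ->
  0 < r -> r < z0.2 -> 0 < kap -> 0 < eta -> 0 <= K -> 2 * K * r <= eta / 4 ->
  (forall p : 'rV[R]_n, p <> 0 -> (forall i, `|p 0 i| <= (\sum_i \sum_j `|Y i j|) * (2 * r)) ->
     a + F (p, Y) + b * enorm p <= - (eta / 2)) ->
  (forall z, cube z0.1 r z.1 -> `|z.2 - z0.2| <= r -> ~ settled z ->
     a * (z.2 - z0.2) + quad Y (z.1 - z0.1) (z.1 - z0.1) / 2 - K * (z.2 - z0.2) ^+ 2
     <= - (kap * dotv (z.1 - z0.1) (z.1 - z0.1) + (z.2 - z0.2) ^+ 2)) ->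
  exists2 h0 : R, 0 < h0 <= r & forall h z, (forall i, `|h 0 i| <= h0) ->
    cube z0.1 r z.1 -> `|z.2 - z0.2| <= r -> ~ settled z ->
    qP z0.1 0 z0.2 a K Y 0 (z.1 - h, z.2) <= 0.
Proof.
move=> sY Hb r0 rz0 kap0 eta0 K0 Kr HF Hout.
pose B := \sum_i \sum_j `|Y i j|.
have B0 : 0 <= B by apply: sumr_ge0 => i _; apply: sumr_ge0.
pose kap' := Num.min kap 1; have kap'0 : 0 < kap' by rewrite lt_min kap0 ltr01.
have kap'k : kap' <= kap by rewrite ge_min lexx.
have kap'1 : kap' <= 1 by rewrite ge_min lexx orbT.
pose m1 := kap' * r ^+ 2; have m10 : 0 < m1 by rewrite mulr_gt0 ?exprn_gt0.
have h00 : 0 < m1 / (4 * (B + 1) * r) by rewrite divr_gt0 ?mulr_gt0 // ltr_wpDl.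
have [h0 [h0_0 h0a h0r]] := small_lt2 h00 r0.
(* At unsettled points of the boundary of the cylinder [P 0 <= - m1], and a translation by at most
   [h0] changes [P 0] by at most [m1 / 2]; the contact point found below is therefore interior. *)
have Bh : B * (r * h0) + B * (h0 * h0) <= m1 / 2.
  have H1 : h0 * (4 * (B + 1) * r) <= m1.
    by apply: ltW; rewrite -ltr_pdivlMr // ?mulr_gt0 // ltr_wpDl.
  have H2 : B * (h0 * h0) <= B * (r * h0) by rewrite ler_wpM2l // ler_wpM2r // ltW.
  have H3 : 0 < r * h0 by rewrite mulr_gt0.
  have H4 : h0 * (4 * (B + 1) * r) = 4 * (B * (r * h0)) + 4 * (r * h0) by ring.
  by move: H1 H2 H3 m10; rewrite H4; clear; move: (B * (r * h0)) (B * (h0 * h0)) (r * h0);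
    move=> *; lra.
exists h0; first by rewrite h0_0 ltW.
move=> h z1 hh cz1 tz1 nz1; rewrite leNgt; apply/negP => m0.
set m := qP _ _ _ _ _ _ _ _ in m0; pose lam := m / 2.
have lam0 : 0 < lam by rewrite divr_gt0.
pose P c z := qP z0.1 0 z0.2 a K Y c z.
have Pc c z : P c z = P 0 z + c by rewrite /P /qP; ring.
have PE z : P 0 z = a * (z.2 - z0.2) + quad Y (z.1 - z0.1) (z.1 - z0.1) / 2 - K * (z.2 - z0.2) ^+ 2.
  rewrite /P /qP /dotv big1; first by ring.
  by move=> i _; rewrite mxE mul0r.
(* The penalty [lam * s] favours short translations: at a maximum with vanishing gradient, going
   back from [s] to [s - tau] would gain [lam * tau] and lose only [O(tau^2)]. With [lam = m / 2]
   the maximum remains positive. *)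
pose G (w : 'rV[R]_n * R * R) : R := P (- lam * w.2) (w.1.1 - w.2 *: h, w.1.2).
have cG : continuous G.
  move=> w; rewrite /continuous_at /G /P.
  have c1 : (fun w : 'rV[R]_n * R * R => w.1.1) @ w --> w.1.1.
    exact: (@cvg_comp _ _ _ fst fst (nbhs w) (nbhs w.1) _ cvg_fst cvg_fst).
  have c2 : (fun w : 'rV[R]_n * R * R => w.1.2) @ w --> w.1.2.
    exact: (@cvg_comp _ _ _ fst snd (nbhs w) (nbhs w.1) _ cvg_fst cvg_snd).
  have c3 : (fun w : 'rV[R]_n * R * R => w.2) @ w --> w.2 by exact: cvg_snd.
  apply: (@qP_cvg R n z0.1 0 z0.2 a K Y _ (nbhs w) _ (fun w => - lam * w.2)
    (fun w => (w.1.1 - w.2 *: h, w.1.2)) (- lam * w.2) (w.1.1 - w.2 *: h, w.1.2)).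
    by apply: cvgM; [exact: cvg_cst|].
  have c4 : (fun w : 'rV[R]_n * R * R => w.1.1 - w.2 *: h) @ w --> w.1.1 - w.2 *: h.
    by apply: cvgB => //; apply: cvgZr_tmp.
  exact: (cvg_pair c4 c2).
pose C := cyl z0.1 r (z0.2 - r) (z0.2 + r) `&` ~` settled.
have Cout z : C z -> [/\ cube z0.1 r z.1, `|z.2 - z0.2| <= r & ~ settled z].
  by move=> [[A /andP[B1 B2]] nz]; split=> //; rewrite ler_distl B1.
have cC : compact C.
  apply: compact_closedI; first exact: cyl_compact.
  by apply: open_closedC; exact: open_settled.
have Cz1 : C z1 by split=> //; split=> //; rewrite -ler_distl.
have [zs [s [Czs s0 s1 Gmax]]] : exists (zs : 'rV[R]_n * R) (s : R), [/\ C zs, 0 <= s,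
    s <= 1 & forall z (s' : R), C z -> 0 <= s' <= 1 -> G (z, s') <= G (zs, s)].
  have [] := @compact_EVT_max _ R G (C `*` `[0, 1]%classic).
  - by exists (z1, 1); split=> //=; rewrite in_itv /= ler01 lexx.
  - by apply: compact_setX => //; exact: segment_compact.
  - by apply: continuous_subspaceT.
  move=> [zs s]; rewrite inE => -[/= Czs]; rewrite in_itv /= => /andP[s0 s1] Gmax.
  exists zs, s; split=> // z s' Cz ss; apply: Gmax; rewrite inE; split=> //=.
have Gpos : 0 < G (zs, s).
  apply: lt_le_trans (Gmax z1 1 Cz1 _); last by rewrite ler01 lexx.
  rewrite /G /= Pc scale1r -/m mulr1 subr_gt0 /lam.
  by rewrite ltr_pdivrMr // ltr_pMr // ltr1n.
have Ppos : 0 < P 0 (zs.1 - s *: h, zs.2).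
  apply: lt_le_trans Gpos _; rewrite /G /= Pc gerDl mulNr oppr_le0.
  by rewrite mulr_ge0 // ltW.
have [czs tzs nzs] := Cout _ Czs.
have s_gt0 : 0 < s.
  rewrite lt_neqAle s0 andbT eq_sym; apply/negP => /eqP s00.
  move: Ppos; rewrite s00 scale0r subr0 PE; apply/negP; rewrite -leNgt.
  apply: (le_trans (Hout _ czs tzs nzs)); rewrite oppr_le0 addr_ge0 ?sqr_ge0 //.
  by rewrite mulr_ge0 ?dotv_ge0 // ltW.
have hs i : `|(s *: h) 0 i| <= h0.
  rewrite mxE normrM (ger0_norm s0); apply: le_trans (hh i).
  by rewrite ler_piMl.
have inner : (forall i, `|zs.1 0 i - z0.1 0 i| < r) /\ `|zs.2 - z0.2| < r.
  apply: contrapT => bd.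
  have dm : m1 <= kap * dotv (zs.1 - z0.1) (zs.1 - z0.1) + (zs.2 - z0.2) ^+ 2.
    have [tr|tr] := ltP `|zs.2 - z0.2| r; last first.
      rewrite -[leLHS]add0r; apply: lerD; first by rewrite mulr_ge0 ?dotv_ge0 // ltW.
      rewrite -[leRHS]real_normK ?num_real // /m1.
      apply: (@le_trans _ _ (r ^+ 2)); first by rewrite ler_piMl // sqr_ge0.
      by rewrite ler_sqr ?nnegrE // ltW.
    rewrite -[leLHS]addr0; apply: lerD; last exact: sqr_ge0.
    have [i ri] : exists i, r <= `|zs.1 0 i - z0.1 0 i|.
      apply: contrapT => nex; apply: bd; split=> // i; rewrite ltNge; apply/negP => ri.
      by apply: nex; exists i.
    apply: ler_pM => //; [exact: ltW|exact: sqr_ge0|].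
    apply: le_trans (sqr_le_dotv _ i); rewrite !mxE -[leRHS]real_normK ?num_real //.
    by rewrite ler_sqr ?nnegrE // ltW.
  have := Hout _ czs tzs nzs; move: Ppos; rewrite PE /=.
  have -> : zs.1 - s *: h - z0.1 = (zs.1 - z0.1) + (- s) *: h.
    by rewrite scaleNr addrAC.
  have hs' i : `|((- s) *: h) 0 i| <= h0 by rewrite scaleNr mxE normrN.
  have cz' i : `|(zs.1 - z0.1) 0 i| <= r by rewrite !mxE; exact: czs.
  have /ler_normlP[_ q1] := quad_bound Y cz' hs'; have /ler_normlP[_ q2] := quad_bound Y hs' hs'.
  rewrite quadD //; move: q1 q2 Bh dm m10; rewrite -/B.
  have : 0 <= B * (h0 * h0) by rewrite mulr_ge0 // mulr_ge0 // ltW.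
  move: (quad _ _ _) (quad _ _ _) (quad _ _ _) (kap * _ + _) (B * _) (B * _) (a * _) (K * _).
  by clear; move=> *; lra.
have [inx int] := inner.
have [r1 r1_0 Hr1] : exists2 r1 : R, 0 < r1 & forall z, cube zs.1 r1 z.1 ->
    `|z.2 - zs.2| <= r1 -> cube z0.1 r z.1 /\ `|z.2 - z0.2| <= r.
  have oU : \forall w \near zs, `|w - z0| < r.
    have cw : `|w - z0| @[w --> zs] --> `|zs - z0|.
      by apply: cvg_norm; apply: cvgB; [exact: cvg_id|exact: cvg_cst].
    apply: (cvgr_lt _ cw); rewrite prod_normE /= gt_max int andbT.
    by apply/rV_norm_lt => // i; rewrite !mxE.
  have [r1 r10 H] := near_cyl oU; exists r1 => // z cz tz.
  have := H _ cz tz; rewrite prod_normE /= gt_max => /andP[A int']; split; last exact: ltW.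
  by move=> i; have /(rV_norm_lt _ r0)/(_ i) := A; rewrite !mxE => /ltW.
have Qzs : Qpos zs.
  rewrite /Qpos /=; move: int; rewrite ltr_distl => /andP[A _].
  by apply: lt_trans A; rewrite subr_gt0.
pose p := (zs.1 - s *: h - z0.1) *m Y.
have p0 : p <> 0.
  move=> p0; pose q := `|quad Y h h|.
  have t10 : 0 < lam / (q + 1) by rewrite divr_gt0 // ltr_wpDl // normr_ge0.
  have [tau [tau0 tau1 tau2]] := small_lt2 t10 s_gt0.
  have := Gmax zs (s - tau) Czs; rewrite subr_ge0 (ltW tau2) /=.
  have st1 : s - tau <= 1 by rewrite lerBlDr; apply: le_trans s1 _; rewrite lerDl ltW.
  move=> /(_ st1); apply/negP; rewrite -ltNge /G /= !(Pc (- lam * _)) /P.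
  rewrite (@qP_shift z0.1 zs.1 h z0.2 zs.2 s a K 0 Y tau sY) -dotv_mulmx -/p p0 dotv0l mulr0 addr0.
  have H1 : tau * q < lam.
    apply: (@le_lt_trans _ _ (tau * (q + 1))); first by rewrite ler_wpM2l ?(ltW tau0) // lerDl.
    by rewrite -ltr_pdivlMr // ltr_wpDl // normr_ge0.
  have H2 : - (tau * q) <= tau * quad Y h h.
    by rewrite lerNl -mulrN ler_wpM2l ?(ltW tau0) // /q -normrN ler_norm.
  rewrite -subr_gt0.
  have H3 : 0 < tau * (tau * quad Y h h / 2 + lam).
    rewrite pmulr_rgt0 //; move: (tau * q) (tau * _) H1 H2 lam0; clear; move=> *; lra.
  apply: lt_le_trans H3 _; rewrite le_eqVlt; apply/orP; left; apply/eqP.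
  by move: (qP _ _ _ _ _ _ _ _) (quad _ _ _) => A Q; field.
apply: nzs; have Fp := HF p p0.
apply: (@front R n eps0 gamma f ue beta pm zs p (a - 2 * K * (zs.2 - z0.2)) K b r1 Y) => //.
- have {Fp}: a + F (p, Y) + b * enorm p <= - (eta / 2).
    apply: Fp => i; apply: mulmx_bound => j.
    have := hs j; have := czs j; rewrite !mxE => A1 A2.
    have -> : zs.1 0 j - s * h 0 j - z0.1 0 j = (zs.1 0 j - z0.1 0 j) - s * h 0 j by ring.
    apply: (le_trans (ler_normB _ _)).
    have -> : 2 * r = r + r by ring.
    by apply: lerD => //; apply: le_trans A2 _; exact: ltW.
  have : - (2 * K * (zs.2 - z0.2)) <= 2 * K * r.
    rewrite -mulrN ler_wpM2l // ?mulr_ge0 //.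
    by move: tzs; rewrite ler_norml lerNl => /andP[].
  move: (F _) (b * _) (2 * K * (zs.2 - _)) (2 * K * r) Kr eta0; clear; move=> *; lra.
(* Maximality in [z] for fixed [s] says that the expansion of [P] at the translated contact point is
   nonpositive at unsettled points, which is the hypothesis of [front]. *)
- move=> z cz tz nz; have [A1 A2] := Hr1 z cz tz.
  have Cz : C z by split=> //; split=> //; rewrite -ler_distl.
  have := Gmax z s Cz; rewrite s0 s1 => /(_ isT).
  rewrite /G /= /P (@qP_expand z0.1 (zs.1 - s *: h) (z.1 - s *: h) z0.2 zs.2 z.2 a K _ Y sY).
  rewrite gerDl -/p.
  by have -> : z.1 - s *: h - (zs.1 - s *: h) = z.1 - zs.1 by rewrite opprB addrA subrK.
Qed.

(** If [z0] were unsettled, [slide] at [z0] would make the diagonal of [Y] nonpositive, hence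
    [a <= - eta] by [F_diag]. At earlier times the term [a * (t - z0.2)] is then positive, and
    [slide] with [h = x - z0.1], which cancels the quadratic term, shows a whole cube to be settled
    just before [z0]; [ball_persistence] carries it past [z0]. *)
Lemma degenerate_front z0 (a b K kap eta r0 rp : R) (Y : 'M[R]_n) (i0 : 'I_n) :
  Qpos z0 -> Y^T = Y -> (forall x, (usc_env setT beta x < b%:E)%E) ->
  0 < r0 -> 0 < rp -> 0 < kap -> 0 < eta -> 0 <= K ->
  (forall p : 'rV[R]_n, p <> 0 -> (forall i, `|p 0 i| <= rp) -> a + F (p, Y) <= - eta) ->
  (forall z, cube z0.1 r0 z.1 -> `|z.2 - z0.2| <= r0 -> ~ settled z ->
     a * (z.2 - z0.2) + quad Y (z.1 - z0.1) (z.1 - z0.1) / 2 - K * (z.2 - z0.2) ^+ 2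
     <= - (kap * dotv (z.1 - z0.1) (z.1 - z0.1) + (z.2 - z0.2) ^+ 2)) ->
  settled z0.
Proof.
move=> Qz0 sY Hb r00 rp0 kap0 eta0 K0 HF Hout; apply: contrapT => nz0.
pose B := \sum_i \sum_j `|Y i j|.
have B0 : 0 <= B by apply: sumr_ge0 => i _; apply: sumr_ge0.
pose M : R := n.+1%:R; have M0 : 0 < M by rewrite ltr0n.
have [r [r_0 rr0 rz0 rK [rB rb]]] : exists r : R, [/\ 0 < r, r < r0, r < z0.2,
    2 * K * r <= eta / 4 & B * (2 * r) <= rp /\ `|b| * (M * (B * (2 * r))) <= eta / 4].
  have e4 : 0 < eta / 4 by rewrite divr_gt0.
  have K1 : 0 < 2 * K + 1 by rewrite ltr_wpDl // mulr_ge0.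
  have B1 : 0 < B * 2 + 1 by rewrite ltr_wpDl // mulr_ge0.
  have D1 : 0 < `|b| * (M * (B * 2)) + 1.
    by rewrite ltr_wpDl // mulr_ge0 // mulr_ge0 ?(ltW M0) // mulr_ge0.
  have [q1 [q10 q11 q12]] := small_lt2 r00 (Qz0 : 0 < z0.2).
  have [q2 [q20 q21 q22]] := small_lt2 (divr_gt0 e4 K1) (divr_gt0 rp0 B1).
  have [q3 [q30 q31 q32]] := small_lt2 q10 q20.
  have [r [r_0 r1 r2]] := small_lt2 q30 (divr_gt0 e4 D1).
  have bnd (c d : R) : 0 <= c -> r < d / (c + 1) -> c * r <= d.
    move=> c0; rewrite ltr_pdivlMr ?ltr_wpDl // => /ltW; apply: le_trans.
    by rewrite mulrC ler_wpM2l ?(ltW r_0) // lerDl.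
  exists r; split=> //.
  - exact: lt_trans (lt_trans r1 q31) q11.
  - exact: lt_trans (lt_trans r1 q31) q12.
  - apply: bnd; first by rewrite mulr_ge0.
    exact: lt_trans (lt_trans r1 q32) q21.
  - split.
      rewrite mulrA; apply: bnd; first by rewrite mulr_ge0.
      exact: lt_trans (lt_trans r1 q32) q22.
    rewrite !mulrA; rewrite !mulrA in D1 r2; apply: bnd => //.
    by rewrite !mulr_ge0 // ltW.
have [|h0 /andP[h00 h0r] slideP] := slide sY Hb r_0 rz0 kap0 eta0 K0 rK _
    (fun z cz tz => Hout z (cubeS (ltW rr0) cz) (le_trans tz (ltW rr0))).
  move=> p p0 pB; have := HF p p0 (fun i => le_trans (pB i) rB).
  have : b * enorm p <= eta / 4.
    apply: (le_trans (ler_norm _)); rewrite normrM (ger0_norm (enorm_ge0 _)).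
    apply: le_trans rb; rewrite ler_wpM2l //; apply: enorm_le => //.
    by rewrite mulr_ge0 // mulr_ge0 // ltW.
  by move: (F _) (b * _) eta0; clear; move=> *; lra.
have z0c : cube z0.1 r z0.1 by apply: cube_self; exact: ltW.
have z0t : `|z0.2 - z0.2| <= r by rewrite subrr normr0 ltW.
have PE y t : qP z0.1 0 z0.2 a K Y 0 (y, t) =
    a * (t - z0.2) + quad Y (y - z0.1) (y - z0.1) / 2 - K * (t - z0.2) ^+ 2.
  rewrite /qP /dotv big1; first by rewrite /=; ring.
  by move=> i _; rewrite mxE mul0r.
have Yneg i : Y i i <= 0.
  have := slideP (h0 *: e_ i) z0 _ z0c z0t nz0; rewrite PE subrr expr0n /= !mulr0 add0r subr0.
  rewrite addrAC subrr add0r -scaleN1r quadZl quadZr quadZl quadZr.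
  have -> : quad Y (e_ i) (e_ i) = Y i i.
    rewrite /quad (bigD1 i) //= (bigD1 i) //= !big1 ?addr0.
    - by rewrite !mxE !eqxx mul1r mulr1.
    - by move=> j ji; rewrite big1 // => l _; rewrite !mxE (negbTE ji) mul0r mul0r.
    - by move=> j ji; rewrite !mxE (negbTE ji) mulr0.
  have -> : -1 * (-1 * (h0 * (h0 * Y i i))) / 2 = h0 ^+ 2 / 2 * Y i i by ring.
  rewrite pmulr_rle0 ?divr_gt0 ?exprn_gt0 //; apply=> j.
  rewrite !mxE normrM (gtr0_norm h00) ler_piMr ?(ltW h00) //.
  by case: (_ && _); rewrite ?normr1 ?normr0 ?ler01.
have a_neg : a <= - eta.
  have := HF (rp *: e_ i0); rewrite F_diag //.
  have -> : \tr Y = Y i0 i0 + \sum_(i < n | i != i0) Y i i by rewrite /mxtrace (bigD1 i0).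
  have : \sum_(i < n | i != i0) Y i i <= 0 by apply: sumr_le0.
  move=> S0 H; have {H} : a + (Y i0 i0 - (Y i0 i0 + \sum_(i < n | i != i0) Y i i)) <= - eta.
    apply: H.
      move=> /rowP/(_ i0); rewrite !mxE !eqxx mulr1 => rp00.
      by move: rp0; rewrite rp00 ltxx.
    move=> i; rewrite !mxE normrM (gtr0_norm rp0) ler_piMr ?(ltW rp0) //.
    by case: (_ && _); rewrite ?normr1 ?normr0 ?ler01.
  by rewrite opprD addNKr; apply: le_trans; rewrite lerDl oppr_ge0.
have Sset x (s : R) : cube z0.1 h0 x -> 0 < s <= r -> settled (x, z0.2 - s).
  move=> cx /andP[s0 sr]; apply: contrapT => nz.
  have := slideP (x - z0.1) (x, z0.2 - s) _ _ _ nz; rewrite /= PE.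
  have -> : x - (x - z0.1) - z0.1 = 0 by rewrite subKr subrr.
  have -> : z0.2 - s - z0.2 = - s by rewrite addrAC subrr add0r.
  rewrite quad0l mul0r addr0 normrN (gtr0_norm s0) => H.
  have {H} : a * (- s) - K * (- s) ^+ 2 <= 0.
    by apply: H => //; [move=> i; rewrite !mxE; exact: cx|exact: cubeS h0r _ cx].
  apply/negP; rewrite -ltNge.
  have -> : a * - s - K * (- s) ^+ 2 = s * (- a - K * s) by ring.
  rewrite pmulr_rgt0 //.
  have : K * s <= K * r by rewrite ler_wpM2l.
  have : 2 * K * r = 2 * (K * r) by rewrite mulrA.
  by move: (K * s) (2 * K * r) (K * r) rK a_neg eta0; clear; move=> *; lra.
have [theta theta0 Hball] := ball_persistence pm.
have R00 : 0 < h0 / 2 by rewrite divr_gt0.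
have [h h_0 Hh] := Hball z0.1 _ R00.
have h2 : 0 < h / 2 by rewrite divr_gt0.
have [s [s0 sr sh]] := small_lt2 r_0 h2.
have cS : compact (cube z0.1 h0 `*` [set z0.2 - s]).
  by apply: compact_setX; [exact: cube_compact|exact: compact_set1].
have Ss : cube z0.1 h0 `*` [set z0.2 - s] `<=` settled.
  by move=> [x t] [/= cx ->]; apply: Sset => //; rewrite s0 ltW.
have Hset := settled_compact pm theta0 cS Ss.
have rr : 0 < h0 / 2 / (4 * M) by rewrite divr_gt0 ?mulr_gt0.
have [r1 [r10 r1a r1b]] := small_lt2 rr s0.
apply: nz0; split=> //; exists r1 => //.
apply: filterS2 Hh Hset => eps H1 H2 y t cy ty.
apply: (H1 (z0.2 - s)).
- by rewrite subr_ge0 ltW // (lt_trans sr).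
- move=> x cx; apply: (H2 (x, z0.2 - s)); split=> //=.
  by move: cx; have -> : 2 * (h0 / 2) = h0 by field.
- by apply: cubeS cy; exact: ltW.
- move: ty; rewrite ler_distl => /andP[t1 t2]; move: t1 t2 r1b sh; clear.
  by move=> *; apply/andP; split; lra.
Qed.

End DegenerateFront.

(** * The settled phase as a supersolution *)

Section Envelopes.
Context {R : realType} {T : topologicalType}.
Implicit Types (D : set T) (h : T -> R) (x : T).

Lemma usc_env_le D h x (b : R) : (\forall y \near within D (nbhs x), h y <= b) ->
  (usc_env D h x <= b%:E)%E.
Proof.
move=> hb; apply: (le_trans (y := ereal_sup [set (h y)%:E | y in [set y | h y <= b]])).
  by apply: ereal_inf_lbound; exists [set y | h y <= b].
by apply: ge_ereal_sup => _ [y hy <-]; rewrite lee_fin.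
Qed.

Lemma usc_env_ge D h x (b : R) :
  (forall U, nbhs x U -> exists y, [/\ U y, D y & b <= h y]) -> (b%:E <= usc_env D h x)%E.
Proof.
move=> H; apply: le_ereal_inf_tmp => _ [V FV <-]; have [y [Uy Dy hy]] := H _ FV.
apply: (le_trans (y := (h y)%:E)); first by rewrite lee_fin.
by apply: ereal_sup_ubound; exists y => //; exact: Uy.
Qed.

Lemma usc_env_lt D h x (b : R) : (usc_env D h x < b%:E)%E ->
  \forall y \near within D (nbhs x), h y < b.
Proof.
move=> /ereal_inf_lt[_ [V FV <-]] Vb; apply: filterS FV => y Vy.
by rewrite -lte_fin; apply: le_lt_trans Vb; apply: ereal_sup_ubound; exists y.
Qed.

Lemma usc_env_self D h x : D x -> ((h x)%:E <= usc_env D h x)%E.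
Proof. by move=> Dx; apply: usc_env_ge => U /nbhs_singleton Ux; exists x. Qed.

Lemma lsc_envE D h x : lsc_env D h x = (- usc_env D (fun y => - h y)%R x)%E.
Proof. by []. Qed.

Lemma lsc_env_ge D h x (b : R) : (\forall y \near within D (nbhs x), b <= h y) ->
  (b%:E <= lsc_env D h x)%E.
Proof.
move=> hb; rewrite lsc_envE leeNr -EFinN; apply: usc_env_le.
by apply: filterS hb => y; rewrite lerN2.
Qed.

Lemma lsc_env_le D h x (b : R) :
  (forall U, nbhs x U -> exists y, [/\ U y, D y & h y <= b]) -> (lsc_env D h x <= b%:E)%E.
Proof.
move=> H; rewrite lsc_envE leeNl -EFinN; apply: usc_env_ge => U /H[y [Uy Dy hy]].
by exists y; rewrite lerN2.
Qed.

Lemma lsc_env_gt D h x (b : R) : (b%:E < lsc_env D h x)%E ->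
  \forall y \near within D (nbhs x), b < h y.
Proof.
rewrite lsc_envE lteNr -EFinN => /usc_env_lt; apply: filterS => y.
by rewrite ltrN2.
Qed.

Lemma lsc_env_min D h x : D x -> (\forall y \near within D (nbhs x), h x <= h y) ->
  lsc_env D h x = (h x)%:E.
Proof.
move=> Dx hx; apply/eqP; rewrite eq_le lsc_env_ge // andbT.
by apply: lsc_env_le => U /nbhs_singleton Ux; exists x.
Qed.

End Envelopes.

Section SettledPhase.
Context {R : realType} {n : nat} (eps0 gamma : R).
Context (f : R -> R -> 'rV[R]_n -> R) (ue : R -> 'rV[R]_n * R -> R) (beta g : 'rV[R]_n -> R).
Hypothesis pm : phase_model eps0 gamma f ue beta.
Hypothesis g_cont : continuous g.
Hypothesis ue0 : forall eps x, 0 < eps < eps0 -> ue eps (x, 0) = g x.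
Implicit Types (x y : 'rV[R]_n) (z : 'rV[R]_n * R).

Let settled := @settled R n gamma ue.

(** [settled] contains points of positive time only, so the values at [t = 0], which the comparison
    principle has to order, are prescribed through [g]. *)
Definition phase z : R := if `[< settled z \/ z.2 = 0 /\ 0 < g z.1 >] then 1 else -1.

Lemma phase_ge z : -1 <= phase z.
Proof. by rewrite /phase; case: ifP => // _; lra. Qed.

Lemma phase_le z : phase z <= 1.
Proof. by rewrite /phase; case: ifP => // _; lra. Qed.

Lemma phase_settled z : settled z -> phase z = 1.
Proof. by move=> sz; rewrite /phase; case: asboolP => // -[]; left. Qed.

Lemma phase_unsettled z : Qpos z -> ~ settled z -> phase z = -1.
Proof.
move=> Qz nz; rewrite /phase; case: asboolP => // -[//|[z0 _]].
by move: Qz; rewrite /Qpos /= z0 ltxx.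
Qed.

Lemma phase_bounded : [bounded phase z | z in @Q0 R n].
Proof.
exists 1; split; first exact: num_real.
move=> M M1 z _ /=; apply: le_trans (ltW M1); rewrite ler_norml phase_le andbT.
exact: phase_ge.
Qed.

(** Only points of value 1 matter: [settled] is open, and at [t = 0] [generation] provides a
    neighbourhood whose points of positive time are settled. *)
Lemma phase_lsc : lsc_on (@Q0 R n) phase.
Proof.
move=> z Qz; apply: lsc_env_min => //.
have [sz|nz] := pselect (settled z \/ z.2 = 0 /\ 0 < g z.1); last first.
  near=> y; rewrite [X in X <= _](_ : _ = -1) ?phase_ge // /phase.
  by case: asboolP.
suff : \forall y \near within (@Q0 R n) (nbhs z), phase y = 1.
  by apply: filterS => y ->; exact: phase_le.
case: sz => [sz|[z0 gz]].
  have : \forall y \near z, settled y.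
    by apply: open_nbhs_nbhs; split=> //; exact: open_settled.
  by move=> sn; apply: filterS sn => y sy _; exact: phase_settled.
have g2 : 0 < g z.1 / 2 by rewrite divr_gt0.
have [r r0 Hr] : exists2 r : R, 0 < r & forall y, cube z.1 r y -> g z.1 / 2 < g y.
  have g2g : g z.1 / 2 < g z.1 by rewrite ltr_pdivrMr // ltr_pMr // ltr1n.
  have cg : g @ z.1 --> g z.1 by exact: g_cont.
  exact: near_cube_mem (cvgr_gt _ cg _ g2g).
have Hinit (eps : R) y : 0 < eps < eps0 -> cube z.1 r y -> g z.1 / 2 <= ue eps (y, 0).
  by move=> epsr cy; rewrite ue0 // ltW // Hr.
have [h h0 Hh] := generation pm r0 g2 Hinit.
have [e [e0 er eh]] := small_lt2 r0 h0.
have := cyl_near z e0; apply: filterS => y [cy ty] Qy; rewrite /phase; case: asboolP => // -[].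
have y0 : 0 <= y.2 := Qy; move: ty; rewrite z0 subr0 (ger0_norm y0) => ty.
have [y20|y20] := eqVneq y.2 0.
  right; split=> //; apply: lt_trans g2 _; apply: Hr; apply: cubeS cy; exact: ltW.
left; rewrite [y]surjective_pairing; apply: Hh; first by apply: cubeS cy; exact: ltW.
by rewrite lt_neqAle eq_sym y20 y0 /= (le_trans ty) // ltW.
Unshelve. all: end_near. Qed.

Lemma Qpos_Q0 z : Qpos z -> Q0 z.
Proof. by move=> /ltW. Qed.

(** At a settled point the test function has a local maximum. At an unsettled one it is at most
    [phi z0] at unsettled neighbours; if the inequality failed, its Taylor polynomial would be a
    front to which [front] or [degenerate_front] applies, and the point would be settled. *)
Lemma phase_super (B : R) (i0 : 'I_n) : (forall x, beta x <= B) -> viscosity_super beta phase.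
Proof.
move=> HB; split.
  move=> z Qz; exists 1; split; first exact: num_real.
  move=> M M1; near=> y => /=; apply: le_trans (ltW M1); rewrite ler_norml phase_le andbT.
  exact: phase_ge.
move=> phi z0 Cphi Qz0 Hmin.
have Qn := near_Qpos Qz0.
have {}Hmin : \forall z \near z0, Qpos z /\ phase z0 - phi z0 <= phase z - phi z.
  apply: filterS2 Qn Hmin => z Qz Hz; split=> //; move: Hz.
  by rewrite (phase_lsc (Qpos_Q0 Qz0)) (phase_lsc (Qpos_Q0 Qz)) -!EFinB lee_fin.
have sX := hess_x_sym Cphi Qz0.
set X := hess_x phi z0 in sX *; set p := grad_x phi z0; set a := dt phi z0.
have [sz|nz] := pselect (settled z0).
  have Hmax : \forall z \near z0, phi z <= phi z0.
    have sn : \forall y \near z0, settled y.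
      by apply: open_nbhs_nbhs; split=> //; exact: open_settled.
    apply: filterS2 sn Hmin => z sz' [_]; rewrite !phase_settled //.
    by rewrite lerD2l lerN2.
  have jmax (v : 'rV[R]_n * R) : 'D_v phi z0 = 0 /\ 'D_v ('D_v phi) z0 <= 0.
    apply: (jet2_max (@C2_jet2 R _ _ phi z0 v open_Qpos Qz0 Cphi)).
    have cl : (fun s : R => z0 + s *: v) @ (0 : R) --> z0 + (0 : R) *: v.
      apply: cvgD; first exact: cvg_cst.
      by apply: cvgZr_tmp; exact: cvg_id.
    rewrite scale0r addr0 in cl; rewrite scale0r addr0.
    exact: (cl _ Hmax).
  have p0 : p = 0 by apply/rowP => i; rewrite /p grad_xE mxE; exact: (jmax _).1.
  have a0 : a = 0 by rewrite /a dtE; exact: (jmax _).1.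
  have X0 i : X i i <= 0 by rewrite /X hess_xE; exact: (jmax _).2.
  rewrite p0 a0 enorm0 mule0 adde0 add0e.
  (* The envelope at [p = 0] is approached through [s *: e_ i0], where [F] is minus the sum of the
     other diagonal entries, all nonpositive. *)
  apply: usc_env_ge => U U0.
  pose P0 := (0 : 'rV[R]_n, X).
  have cl : (fun s : R => (s *: e_ i0 : 'rV[R]_n, X)) @ 0^'+ --> P0.
    have c1 : (fun s : R => s *: e_ i0 : 'rV[R]_n) @ 0^'+ --> (0 : 'rV[R]_n).
      rewrite -[X in _ --> X](scale0r (e_ i0 : 'rV[R]_n)).
      by apply: cvgZr_tmp; apply: cvg_at_right_filter; exact: cvg_id.
    exact: (cvg_pair c1 (cvg_cst X)).
  have [s [s0 Us]] : exists s : R, 0 < s /\ U (s *: e_ i0, X).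
    have Us : \forall s \near (0 : R)^'+, U (s *: e_ i0, X) by exact: cl.
    have [s [{}Us s0]] := filter_ex (filterI Us (nbhs_right_gt (0 : R))).
    by exists s.
  exists (s *: e_ i0, X); split=> //.
    split=> //= /rowP/(_ i0); rewrite !mxE !eqxx mulr1 => s00.
    by rewrite s00 ltxx in s0.
  rewrite F_diag // /mxtrace (bigD1 i0) //= opprD addNKr oppr_ge0.
  by apply: sumr_le0 => i _; exact: X0.
have Hout : \forall z \near z0, ~ settled z -> phi z <= phi z0.
  apply: filterS Hmin => z [Qz]; rewrite (phase_unsettled Qz0 nz) => H nz'.
  by move: H; rewrite (phase_unsettled Qz nz') lerD2l lerN2.
have [r r0 Hr] := near_cyl Hout.
rewrite leNgt; apply/negP => Hneg; apply: nz.
have taylor (kap : R) : 0 < kap -> exists K r' : R, [/\ 0 <= K, 0 < r' &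
    forall z, cube z0.1 r' z.1 -> `|z.2 - z0.2| <= r' -> ~ settled z ->
     a * (z.2 - z0.2) + dotv p (z.1 - z0.1) + quad X (z.1 - z0.1) (z.1 - z0.1) / 2
      - kap * dotv (z.1 - z0.1) (z.1 - z0.1) - K * (z.2 - z0.2) ^+ 2 <= 0].
  move=> kap0; have [K [r1 [K0 r10 HT]]] := parabolic_taylor Cphi Qz0 kap0.
  have [r2 [r20 r2r r21]] := small_lt2 r0 r10.
  exists K, r2; split=> // z cz tz nz'.
  have cz1 i : `|(z.1 - z0.1) 0 i| < r1 by rewrite !mxE; apply: le_lt_trans r21; exact: cz.
  have := HT _ _ cz1 (le_lt_trans tz r21).
  rewrite !addrA ![_ + z.1]addrC ![_ + z.2]addrC addrK addrK -surjective_pairing => H1.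
  have := Hr z (cubeS (ltW r2r) cz) (le_trans tz (ltW r2r)) nz'.
  rewrite -/a -/p -/X in H1; move: H1.
  rewrite [(_ - _) * a]mulrC.
  move: (phi z) (phi z0) (a * _) (dotv p _) (quad X _ _) (kap * _) (K * _).
  by move=> *; lra.
have [p0|p0] := pselect (p = 0).
  have Fneg : (usc_env (@Fdom R n) F (p, X) < (- a)%:E)%E.
    move: Hneg; rewrite p0 enorm0 mule0 adde0.
    case: (usc_env _ _ _) => [s| |]; last by move=> _; exact: ltNyr.
      by rewrite -EFinD !lte_fin; lra.
    by rewrite addey.
  have [b1 [b1a Fb1]] : exists b1 : R, b1 < - a /\ (usc_env (@Fdom R n) F (p, X) < b1%:E)%E.
    move: Fneg; case: (usc_env _ _ _) => //= [s|].
      rewrite lte_fin => sa; exists ((s - a) / 2); rewrite lte_fin; split; lra.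
    by move=> _; exists (- a - 1); split; [lra|exact: ltNyr].
  have := usc_env_lt Fb1; rewrite /within /= => /near_ball[d d0 Hd].
  (* [4 * kap = d / 2] keeps the shifted Hessian where [F < b1]. Of the [2 * kap] gained in the
     quadratic term, one half covers the Taylor error and the other is the margin asked for by
     [degenerate_front]. *)
  pose kap := d / 8; have kap0 : 0 < kap by rewrite divr_gt0.
  have [K [r1 [K0 r10 HT]]] := taylor kap kap0.
  have d2 : 0 < d / 2 by rewrite divr_gt0.
  have eta0 : 0 < - a - b1 by rewrite subr_gt0.
  have K1 : 0 <= K + 1 by rewrite addr_ge0.
  have sY : (X - (4 * kap)%:M)^T = X - (4 * kap)%:M by exact: symB_scalar.
  have Hb x : (usc_env setT beta x < (B + 1)%:E)%E.
    apply: (@le_lt_trans _ _ B%:E); last by rewrite lte_fin ltrDl.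
    by apply: usc_env_le; apply: nearW.
  apply: (degenerate_front pm i0 Qz0 sY Hb r10 d2 kap0 eta0 K1 (a := a)).
    move=> p' p'0 p'd.
    suff : F (p', X - (4 * kap)%:M) < b1.
      by move: (F _); move=> *; lra.
    apply: Hd; last by split.
    rewrite prod_normE /= gt_max p0 subr0; apply/andP; split.
      apply/rV_norm_lt => // i; apply: le_lt_trans (p'd i) _.
      by rewrite ltr_pdivrMr // ltr_pMr // ltr1n.
    rewrite addrAC subrr add0r normrN [`|_|]mx_normrE; apply/bigmax_ltP; split=> // -[i j] _ /=.
    rewrite mxE normrMn (gtr0_norm (_ : 0 < 4 * kap)) ?mulr_gt0 //.
    apply: (@le_lt_trans _ _ (4 * kap)).
      by case: (_ == _); rewrite ?mulr1n ?mulr0n // mulr_ge0 // ltW.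
    by rewrite /kap; lra.
  move=> z cz tz nz; have := HT z cz tz nz; rewrite p0.
  have -> : dotv 0 (z.1 - z0.1) = 0 by rewrite dotv0l.
  rewrite addr0 quadB_scalar.
  move: (a * _) (quad _ _ _) (dotv _ _) (_ ^+ 2) => A Q D E.
  have -> : (Q - 4 * kap * D) / 2 = Q / 2 - 2 * (kap * D) by field.
  have -> : (K + 1) * E = K * E + E by ring.
  by move: (kap * D) (K * E); move=> *; lra.
have bfin : exists s : R, usc_env setT beta z0.1 = s%:E.
  have := usc_env_self beta (I : [set: 'rV[R]_n] z0.1).
  have : (usc_env setT beta z0.1 <= B%:E)%E by apply: usc_env_le; apply: nearW.
  by case: (usc_env _ _ _) => // s _ _; exists s.
case: bfin => s bs.
have Fp : a + F (p, X) + s * enorm p < 0.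
  have : ((F (p, X))%:E <= usc_env (@Fdom R n) F (p, X))%E by exact: usc_env_self.
  move: Hneg; rewrite bs; case: (usc_env _ _ _) => [v| |].
  - rewrite -EFinM -!EFinD !lte_fin lee_fin.
    by move: (F _) (s * _); move=> *; lra.
  - by rewrite -EFinM addey // addye.
  - by move=> _; rewrite leeNy_eq.
pose sig := - (a + F (p, X) + s * enorm p).
have sig0 : 0 < sig by rewrite oppr_gt0.
have e0 := enorm_gt0 p0.
pose M : R := n.+1%:R; have M0 : 0 < M by rewrite ltr0n.
(* At most [sig / 4] is spent on the shift of the Hessian, and [sig / 4] on a bound of the speed
   strictly above its envelope. *)
pose kap := sig / (8 * M); have kap0 : 0 < kap by rewrite divr_gt0 // mulr_gt0.
have [K [r1 [K0 r10 HT]]] := taylor kap kap0.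
have sY : (X - (2 * kap)%:M)^T = X - (2 * kap)%:M by exact: symB_scalar.
apply: (@front R n eps0 gamma f ue beta pm z0 p a K (s + sig / (4 * enorm p)) r1
  (X - (2 * kap)%:M)) => //.
- by rewrite bs lte_fin ltrDl divr_gt0 // mulr_gt0.
- have -> : (s + sig / (4 * enorm p)) * enorm p = s * enorm p + sig / 4.
    by field; rewrite gt_eqF.
  have -> : F (p, X - (2 * kap)%:M) = F (p, X) + 2 * kap * (n%:R - 1).
    rewrite !F_E trB_scalar quadB_scalar unit_enorm // !mulr1.
    by move: (\tr X) (quad _ _ _) => t q; ring.
  have kM : kap * M = sig / 8 by rewrite /kap; field; rewrite gt_eqF.
  have nM : n%:R = M - 1 by rewrite /M -natr1 addrK.
  have -> : 2 * kap * (n%:R - 1) = 2 * (kap * M) - 4 * kap by rewrite nM; ring.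
  rewrite kM; have : a + F (p, X) + s * enorm p = - sig by rewrite opprK.
  by move: (F _) (s * _) sig kap sig0 kap0 {kM nM K HT K0 sY}; move=> *; lra.
- move=> z cz tz nz; have := HT z cz tz nz; rewrite quadB_scalar.
  move: (dotv (z.1 - z0.1) _) => D.
  by move: (a * _) (dotv p _) (quad _ _ _) (K * _); move=> *; lra.
Unshelve. all: end_near. Qed.

End SettledPhase.

(** * Relabelling and reflection *)

Section SquashingMap.
Context {R : realType}.
Implicit Types (a s y : R).

(** The comparison principle is about bounded functions, whereas [u] starts from a distance that may
    be unbounded. This increasing relabelling preserves signs and is inverted by [y / (1 - |y|)]. *)
Definition squash y : R := y / (1 + `|y|).

Lemma squash_den y : 0 < 1 + `|y|.
Proof. by rewrite ltr_pwDl. Qed.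

Lemma norm_squash y : `|squash y| < 1.
Proof.
rewrite /squash normrM normfV (gtr0_norm (squash_den y)) ltr_pdivrMr ?squash_den //.
by rewrite mul1r ltrDr.
Qed.

Lemma squash_gt0 y : (0 < squash y) = (0 < y).
Proof. by rewrite /squash pmulr_lgt0 // invr_gt0 squash_den. Qed.

Lemma squash_inv a y : `|y| < 1 -> squash a <= y -> a <= y / (1 - `|y|).
Proof.
move=> y1; have d0 : 0 < 1 - `|y| by rewrite subr_gt0.
rewrite ler_pdivlMr // /squash ler_pdivrMr ?squash_den //.
have [a0|a0] := leP 0 a; have [y0|y0] := leP 0 y.
- by rewrite (ger0_norm a0) (ger0_norm y0); lra.
- rewrite (ger0_norm a0) => H; have : y * (1 + a) < 0 by rewrite nmulr_rlt0 // ltr_pwDl.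
  by move=> H1; have := le_lt_trans H H1; rewrite ltNge a0.
- by move=> _; apply: (@le_trans _ _ 0) => //; rewrite nmulr_rle0 // ltW.
- by rewrite (ltr0_norm a0) (ltr0_norm y0); lra.
Qed.

(* The inverse of [squash] is only [C^1] at 0, so its second order upper bound is proved by
   hand. *)
Lemma squash_upper a : exists K d : R, 0 < d /\ forall y s, `|s| < d ->
  squash y <= squash a + s -> y <= a + (1 + `|a|) ^+ 2 * s + K * (s * s).
Proof.
pose q := 1 + `|a|; have q0 : 0 < q := squash_den a; have qn : q != 0 by rewrite gt_eqF.
have q1 : 0 < (2 * q)^-1 by rewrite invr_gt0 mulr_gt0.
have pos s : 0 <= a -> `|s| < (2 * q)^-1 -> 0 <= squash a + s ->
    (squash a + s) / (1 - (squash a + s)) <= a + q ^+ 2 * s + 2 * q ^+ 3 * (s * s).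
  move=> a0; rewrite -[X in _ < X]mul1r ltr_pdivlMr ?mulr_gt0 // => sq _.
  have qE : q = 1 + a by rewrite /q ger0_norm.
  have sa : squash a = 1 - q^-1.
    by rewrite /squash -/q; apply: (mulIf qn); rewrite divfK // mulrBl mulVf // qE; ring.
  have s1 : s * (2 * q) < 1 by apply: le_lt_trans sq; rewrite ler_wpM2r ?ler_norm // mulr_ge0 // ltW.
  have d0 : 0 < 1 - (squash a + s).
    rewrite sa; have -> : 1 - (1 - q^-1 + s) = (1 - s * q) / q by field.
    by rewrite divr_gt0 //; move: s1; rewrite mulrCA; move: (s * q) => x; lra.
  rewrite ler_pdivrMr // -subr_ge0.
  have -> : (a + q ^+ 2 * s + 2 * q ^+ 3 * (s * s)) * (1 - (squash a + s)) - (squash a + s)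
      = q * (s * s) * (q * (1 - s * (2 * q))).
    by rewrite sa (_ : a = q - 1); [field|rewrite qE; ring].
  apply: mulr_ge0; first by rewrite mulr_ge0 ?(ltW q0) // -expr2 sqr_ge0.
  by rewrite mulr_ge0 ?(ltW q0) // subr_ge0 ltW.
have neg s : a <= 0 -> `|s| < (2 * q)^-1 -> squash a + s <= 0 ->
    (squash a + s) / (1 + (squash a + s)) <= a + q ^+ 2 * s + 2 * q ^+ 3 * (s * s).
  move=> a0; rewrite -[X in _ < X]mul1r ltr_pdivlMr ?mulr_gt0 // => sq _.
  have qE : q = 1 - a by rewrite /q ler0_norm.
  have sa : squash a = q^-1 - 1.
    by rewrite /squash -/q; apply: (mulIf qn); rewrite divfK // mulrBl mulVf // qE; ring.
  have s1 : - s * (2 * q) < 1.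
    apply: le_lt_trans sq; rewrite ler_wpM2r ?mulr_ge0 // ?(ltW q0) //.
    by rewrite -normrN ler_norm.
  have d0 : 0 < 1 + (squash a + s).
    rewrite sa; have -> : 1 + (q^-1 - 1 + s) = (1 + s * q) / q by field.
    by rewrite divr_gt0 //; move: s1; rewrite mulrCA mulNr; move: (s * q) => x; lra.
  rewrite ler_pdivrMr // -subr_ge0.
  have -> : (a + q ^+ 2 * s + 2 * q ^+ 3 * (s * s)) * (1 + (squash a + s)) - (squash a + s)
      = q * (s * s) * (q * (3 - 2 * (- s * q))).
    by rewrite sa (_ : a = 1 - q); [field|rewrite qE; ring].
  apply: mulr_ge0; first by rewrite mulr_ge0 ?(ltW q0) // -expr2 sqr_ge0.
  rewrite mulr_ge0 ?(ltW q0) //; move: s1; rewrite mulrCA.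
  by move: (- s * q) => x; lra.
pose d := if a == 0 then (2 * q)^-1 else Num.min (2 * q)^-1 `|squash a|.
have dq : d <= (2 * q)^-1 by rewrite /d; case: ifP => // _; rewrite ge_min lexx.
exists (2 * q ^+ 3), d; split.
  rewrite /d; case: eqVneq => // a0; rewrite lt_min q1 normr_gt0 /squash mulf_neq0 //.
move=> y s sd; have sq := lt_le_trans sd dq.
have y1 : `|squash a + s| < 1.
  apply: (le_lt_trans (ler_normD _ _)).
  have -> : `|squash a| = 1 - q^-1.
    rewrite /squash normrM normfV (gtr0_norm (squash_den a)) -/q; apply: (mulIf qn).
    by rewrite divfK // mulrBl mulVf // /q; ring.
  rewrite -[ltRHS](subrK q^-1) ltrD2l; apply: lt_trans sq _; rewrite ltf_pV2 ?posrE ?mulr_gt0 //.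
  by rewrite ltr_pMl // ltr1n.
move=> /(squash_inv y1) H; apply: (le_trans H).
have [ys0|ys0] := leP 0 (squash a + s).
  rewrite (ger0_norm ys0); apply: pos => //.
  rewrite leNgt; apply/negP => a0; move: sd ys0.
  rewrite /d lt_eqF // lt_min => /andP[_].
  have : squash a < 0 by rewrite /squash nmulr_rlt0 // invr_gt0.
  move=> sa0; rewrite (ltr0_norm sa0) ltr_norml => /andP[_].
  by move: (squash a) => b; lra.
rewrite (ltr0_norm ys0) opprK; apply: neg => //; last exact: ltW.
rewrite leNgt; apply/negP => a0; move: sd ys0.
rewrite /d gt_eqF // lt_min => /andP[_].
have : 0 < squash a by rewrite squash_gt0.
move=> sa0; rewrite (gtr0_norm sa0) ltr_norml => /andP[+ _].
by move: (squash a) => b; lra.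
Qed.

End SquashingMap.

Section QuadraticRelabelling.
Context {R : realType} {V : normedModType R}.
Variables (U : set V) (phi : V -> R) (c0 a b c : R).
Hypothesis oU : open U.
Hypothesis Cphi : Ck_on U 2 phi.
Implicit Types (z v w : V).

(** Converts a test function for [squash u] into one for [u], the coefficient [b] absorbing the
    second order error of the inverse of [squash]. With [a = -1] and the other constants 0 it is
    [- phi]. *)
Definition relabel z : R := c0 + a * (phi z - c) + b * ((phi z - c) * (phi z - c)).

Let dphi z v : U z -> is_derive z v phi ('D_v phi z).
Proof. by case: Cphi => _ /(_ v)[dv _] Uz; apply: derivableP; exact: dv. Qed.

Let nearU z : U z -> \forall y \near z, U y.
Proof. by move=> Uz; apply: open_nbhs_nbhs. Qed.

Let is_derive_shift z v k : U z -> is_derive z v (fun y => k + a * (phi y - c)) (a * 'D_v phi z).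
Proof.
move=> Uz; have := is_deriveD (is_derive_cst k z v)
  (is_deriveZ a (is_deriveB (dphi v Uz) (is_derive_cst c z v))).
by rewrite add0r subr0.
Qed.

Lemma is_derive_relabel z v : U z ->
  is_derive z v relabel ((a + 2 * b * (phi z - c)) * 'D_v phi z).
Proof.
move=> Uz; have ds := is_deriveB (dphi v Uz) (is_derive_cst c z v).
have := is_deriveD (is_derive_shift v c0 Uz) (is_deriveZ b (is_deriveM ds ds)).
rewrite subr0; congr is_derive.
rewrite /GRing.scale /=; have -> : (phi - cst c) z = phi z - c by [].
by ring.
Qed.

Lemma derive_relabel z v : U z -> 'D_v relabel z = (a + 2 * b * (phi z - c)) * 'D_v phi z.
Proof. by move=> Uz; have [_ ->] := is_derive_relabel v Uz. Qed.

Lemma is_derive2_relabel z v w : U z -> is_derive z w ('D_v relabel)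
  (2 * b * 'D_w phi z * 'D_v phi z + (a + 2 * b * (phi z - c)) * 'D_w ('D_v phi) z).
Proof.
move=> Uz; have dv : is_derive z w ('D_v phi) ('D_w ('D_v phi) z).
  by case: Cphi => _ /(_ v)[_ [_ /(_ w)[dw _]]]; apply: derivableP; exact: dw.
have d1 : is_derive z w (fun y => a + 2 * b * (phi y - c)) (2 * b * 'D_w phi z).
  have := is_deriveD (is_derive_cst a z w)
    (is_deriveZ (2 * b) (is_deriveB (dphi w Uz) (is_derive_cst c z w))).
  by rewrite add0r subr0.
apply: (near_eq_is_derive (f := (fun y => a + 2 * b * (phi y - c)) * 'D_v phi)).
  by apply: filterS (nearU Uz) => y Uy; rewrite derive_relabel.
have := is_deriveM d1 dv; congr is_derive.
by rewrite /GRing.scale /=; ring.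
Qed.

Lemma derive2_relabel z v w : U z -> 'D_w ('D_v relabel) z =
  2 * b * 'D_w phi z * 'D_v phi z + (a + 2 * b * (phi z - c)) * 'D_w ('D_v phi) z.
Proof. by move=> Uz; have [_ ->] := is_derive2_relabel v w Uz. Qed.

Lemma relabel_Ck : Ck_on U 2 relabel.
Proof.
have c1 z : U z -> {for z, continuous phi} by case: Cphi => cc _; exact: cc.
have c2 z v : U z -> {for z, continuous ('D_v phi)}.
  by case: Cphi => _ /(_ v)[_ [cc _]]; exact: cc.
have c3 z v w : U z -> {for z, continuous ('D_w ('D_v phi))}.
  by case: Cphi => _ /(_ v)[_ [_ /(_ w)[_ [cc _]]]]; exact: cc.
have cs z : U z -> {for z, continuous (fun y => phi y - c)}.
  by move=> Uz; apply: cvgB; [exact: c1|exact: cvg_cst].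
have ext z (h k : V -> R) : U z -> (forall y, U y -> k y = h y) -> {for z, continuous k} ->
    {for z, continuous h}.
  move=> Uz hk ck; rewrite /prop_for /continuous_at -(hk _ Uz); apply: cvg_trans ck.
  by apply: near_eq_cvg; apply: filterS (nearU Uz) => y Uy; rewrite hk.
split.
  move=> z Uz; apply: cvgD; first apply: cvgD; first exact: cvg_cst.
    by apply: cvgM; [exact: cvg_cst|exact: cs].
  by apply: cvgM; [exact: cvg_cst|apply: cvgM; exact: cs].
move=> v; split; first by move=> z Uz; have [] := is_derive_relabel v Uz.
split.
  move=> z Uz; apply: (ext z _ _ Uz (fun y Uy => esym (derive_relabel v Uy))).
  apply: cvgM; last exact: c2.
  by apply: cvgD; [exact: cvg_cst|apply: cvgM; [exact: cvg_cst|exact: cs]].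
move=> w; split; first by move=> z Uz; have [] := is_derive2_relabel v w Uz.
split=> // z Uz; apply: (ext z _ _ Uz (fun y Uy => esym (derive2_relabel v w Uy))).
apply: cvgD.
  by apply: cvgM; [apply: cvgM; [exact: cvg_cst|exact: c2]|exact: c2].
apply: cvgM; last exact: c3.
by apply: cvgD; [exact: cvg_cst|apply: cvgM; [exact: cvg_cst|exact: cs]].
Qed.

End QuadraticRelabelling.

Section MatrixLimits.
Context {R : realType} {m n : nat}.

Lemma cvg_mx (T : Type) (G : set_system T) (FG : Filter G) (h : T -> 'M[R]_(m, n))
    (L : 'M[R]_(m, n)) :
  (forall i j, h t i j @[t --> G] --> L i j) -> h @ G --> L.
Proof.
move=> hc; apply/cvgrPdist_lt => e e0.
have Hn : \forall t \near G, forall ij : 'I_m * 'I_n, `|L ij.1 ij.2 - h t ij.1 ij.2| < e.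
  by apply: filter_forall => -[i j] /=; have /cvgrPdist_lt/(_ e e0) := hc i j.
apply: filterS Hn => t Ht; rewrite [`|_|]mx_normrE; apply/bigmax_ltP; split=> // ij _.
by rewrite !mxE; exact: Ht.
Qed.

End MatrixLimits.

Section Envelopes2.
Context {R : realType} {n : nat}.

Lemma usc_env_continuous (T : topologicalType) (D : set T) (h : T -> R) x :
  {within D, continuous h} -> D x -> usc_env D h x = (h x)%:E.
Proof.
move=> /subspace_continuousP ch Dx; apply/eqP; rewrite eq_le usc_env_self // andbT.
apply/lee_addgt0Pr => e e0; apply: usc_env_le.
have hx : h x < h x + e by rewrite ltrDl.
by near=> y; apply: ltW; near: y; exact: (cvgr_lt _ (ch x Dx) _ hx).
Unshelve. all: end_near. Qed.

Lemma quad_outer (p x : 'rV[R]_n) : quad (p^T *m p) x x = dotv x p ^+ 2.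
Proof.
rewrite /quad expr2 /dotv mulr_suml; apply: eq_bigr => i _; rewrite mulr_sumr.
by apply: eq_bigr => j _; rewrite !mxE big_ord1 mxE; ring.
Qed.

(** The projection in [F] annihilates [p^T *m p] and depends on the direction of [p] only, and [F]
    is linear in [X]: this is the geometric character of the equation. *)
Lemma F_relabel (p : 'rV[R]_n) (X : 'M[R]_n) (k c : R) : p <> 0 -> 0 < k ->
  F (k^-1 *: p, k^-1 *: (X - c *: (p^T *m p))) = k^-1 * F (p, X).
Proof.
move=> p0 k0; have ki : 0 < k^-1 by rewrite invr_gt0.
have e0 := enorm_gt0 p0.
rewrite !F_E enormZ ?(ltW ki) // scalerA.
have -> : (k^-1 * enorm p)^-1 * k^-1 = (enorm p)^-1 by field; rewrite !gt_eqF.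
set e := _ *: p.
have qB Y Z (x : 'rV[R]_n) : quad (Y - Z) x x = quad Y x x - quad Z x x.
  rewrite /quad -sumrB; apply: eq_bigr => i _; rewrite -sumrB; apply: eq_bigr => j _.
  by rewrite !mxE; ring.
have trE : \tr (k^-1 *: (X - c *: (p^T *m p))) = k^-1 * (\tr X - c * enorm p ^+ 2).
  rewrite mxtraceZ raddfB /= mxtraceZ; congr (_ * (_ - _ * _)).
  rewrite mxtrace_mulC /mxtrace big_ord1 mxE sqr_enorm; apply: eq_bigr => j _.
  by rewrite mxE.
rewrite trE quadZ qB quadZ quad_outer.
have -> : dotv e p ^+ 2 = enorm p ^+ 2.
  rewrite /e dotvZl -sqr_enorm; congr (_ ^+ 2); first by field; rewrite gt_eqF.
by ring.
Qed.

(** The inverse relabelling of jets is continuous and preserves [Fdom], so the identity passes to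
    the envelope, including at [p = 0]. A real bound [b] stands for the envelope to avoid arithmetic
    with infinite values. *)
Lemma lsc_env_F_relabel (p : 'rV[R]_n) (X : 'M[R]_n) (k c b : R) : 0 < k ->
  (b%:E < lsc_env (@Fdom R n) F (p, X))%E ->
  ((k * b)%:E <= lsc_env (@Fdom R n) F (k *: p, k *: X + (c * k ^+ 2) *: (p^T *m p))%R)%E.
Proof.
move=> k0 /lsc_env_gt Hb0; apply: lsc_env_ge.
have {Hb0} Hb : \forall y \near (p, X), Fdom y -> b < F y by exact: Hb0.
pose P1 := (k *: p, k *: X + (c * k ^+ 2) *: (p^T *m p)).
pose psi (w : 'rV[R]_n * 'M[R]_n) := (k^-1 *: w.1, k^-1 *: (w.2 - c *: (w.1^T *m w.1))).
have kn : k != 0 by rewrite gt_eqF.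
have psi1 : psi P1 = (p, X).
  rewrite /psi /P1 /=; congr (_, _); first by rewrite scalerA mulVf // scale1r.
  apply/matrixP => i j; rewrite !mxE !big_ord1 !mxE; field.
  by [].
have cpsi : psi @ P1 --> (p, X).
  rewrite -psi1; have c1 : (fun w : 'rV[R]_n * 'M[R]_n => w.1) @ P1 --> P1.1 by exact: cvg_fst.
  have c2 : (fun w : 'rV[R]_n * 'M[R]_n => w.2) @ P1 --> P1.2 by exact: cvg_snd.
  have ci i : (fun w : 'rV[R]_n * 'M[R]_n => w.1 0 i) @ P1 --> P1.1 0 i.
    exact: (cvg_comp _ _ c1 (@coord_continuous R 1 n 0 i _)).
  have cij i j : (fun w : 'rV[R]_n * 'M[R]_n => w.2 i j) @ P1 --> P1.2 i j.
    exact: (cvg_comp _ _ c2 (@coord_continuous R n n i j _)).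
  have cA : (fun w : 'rV[R]_n * 'M[R]_n => k^-1 *: w.1) @ P1 --> k^-1 *: P1.1.
    by apply: cvgZl_tmp.
  suff cB : (fun w : 'rV[R]_n * 'M[R]_n => k^-1 *: (w.2 - c *: (w.1^T *m w.1))) @ P1
      --> k^-1 *: (P1.2 - c *: (P1.1^T *m P1.1)) by exact: (cvg_pair cA cB).
  apply: cvg_mx => i j; rewrite mxE; under eq_fun do rewrite mxE.
  apply: cvgM; first exact: cvg_cst.
  rewrite mxE; under eq_fun do rewrite mxE.
  apply: cvgD; first exact: cij.
  rewrite mxE; under eq_fun do rewrite mxE; apply: cvgN.
  rewrite mxE; under eq_fun do rewrite mxE; apply: cvgM; first exact: cvg_cst.
  rewrite mxE big_ord1 mxE; under eq_fun do rewrite mxE big_ord1 mxE.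
  by apply: cvgM; exact: ci.
have Hb1 : \forall w \near P1, Fdom (psi w) -> b < F (psi w) by exact: (cpsi _ Hb).
suff : \forall w \near P1, Fdom w -> k * b <= F w by [].
apply: filterS Hb1 => -[p' X'] /= Hw [/= p'0 sX'].
have {}Hw : b < F (psi (p', X')).
  apply: Hw; split=> /=.
    move=> /(congr1 (fun y => k *: y)); rewrite scalerA mulfV // scale1r scaler0.
    exact: p'0.
  by rewrite linearZ linearB linearZ /= trmx_mul trmxK sX'.
move: Hw; rewrite /psi /= F_relabel // => Hw.
by rewrite -ler_pdivlMl // ltW.
Qed.

End Envelopes2.

Section SubRelabel.
Context {R : realType} {n : nat}.
Implicit Types (u : 'rV[R]_n * R -> R) (z : 'rV[R]_n * R).

Lemma lsc_env_bounded (alpha : 'rV[R]_n -> R) (B : R) x : (forall x, `|alpha x| <= B) ->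
  exists r : R, lsc_env setT alpha x = r%:E.
Proof.
move=> HB.
have H1 : ((- B)%:E <= lsc_env setT alpha x)%E.
  by apply: lsc_env_ge; apply: nearW => y; have := HB y; rewrite ler_norml => /andP[].
have H2 : (lsc_env setT alpha x <= B%:E)%E.
  apply: lsc_env_le => U /nbhs_singleton Ux; exists x; split=> //.
  by have := HB x; rewrite ler_norml => /andP[].
by move: H1 H2; case: (lsc_env _ _ _) => // s _ _; exists s.
Qed.

Lemma squash_continuous u : {within @Q0 R n, continuous u} ->
  {within @Q0 R n, continuous (fun z => -1 + squash (u z))}.
Proof.
move=> cu z; apply: cvgD; first exact: cvg_cst.
apply: cvgM; first exact: cu.
apply: cvgV; first by rewrite gt_eqF // squash_den.
by apply: cvgD; [exact: cvg_cst|apply: cvg_norm; exact: cu].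
Qed.

Lemma squash_bound u z : `|-1 + squash (u z)| <= 2.
Proof.
apply: (le_trans (ler_normD _ _)); rewrite normrN1.
by have := norm_squash (u z); lra.
Qed.

(** At a contact point, [squash_upper] makes the quadratic relabelling [Phi] of [phi] touch [u] from
    above. Its jet is [k] times that of [phi] up to a multiple of [p^T *m p], to which [F] is
    insensitive. *)
Lemma viscosity_sub_squash (alpha : 'rV[R]_n -> R) (B : R) u :
  (forall x, `|alpha x| <= B) -> {within @Q0 R n, continuous u} -> viscosity_sub alpha u ->
  viscosity_sub alpha (fun z => -1 + squash (u z)).
Proof.
move=> HB cu [_ subu]; split.
  move=> z Qz; exists 2; split; first exact: num_real.
  by move=> M M2; near=> y => /=; exact: le_trans (squash_bound u y) (ltW M2).
have cv := squash_continuous cu.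
move=> phi z0 Cphi Qz0 Hmax.
have [K [d [d0 HK]]] := squash_upper (u z0).
pose k := (1 + `|u z0|) ^+ 2; have k0 : 0 < k by rewrite exprn_gt0 // squash_den.
pose Phi : 'rV[R]_n * R -> R := relabel phi (u z0) k K (phi z0).
have CPhi : Ck_on Qpos 2 Phi by apply: relabel_Ck => //; exact: open_Qpos.
have Qn := near_Qpos Qz0.
have cphi : phi @ z0 --> phi z0 by case: Cphi => /(_ z0 Qz0).
have D1 v : 'D_v Phi z0 = k * 'D_v phi z0.
  rewrite /Phi (@derive_relabel R _ Qpos phi (u z0) k K (phi z0) Cphi) //.
  by rewrite subrr mulr0 addr0.
have D2 v w : 'D_w ('D_v Phi) z0 = 2 * K * 'D_w phi z0 * 'D_v phi z0 + k * 'D_w ('D_v phi) z0.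
  rewrite /Phi (@derive2_relabel R _ Qpos phi (u z0) k K (phi z0) open_Qpos Cphi) //.
  by rewrite subrr mulr0 addr0.
have := subu Phi z0 CPhi Qz0 _.
have -> : dt Phi z0 = k * dt phi z0 by rewrite !dtE D1.
have -> : grad_x Phi z0 = k *: grad_x phi z0.
  by apply/rowP => i; rewrite [RHS]mxE !grad_xE D1.
have -> : hess_x Phi z0 = k *: hess_x phi z0
    + (2 * K / k ^+ 2 * k ^+ 2) *: ((grad_x phi z0)^T *m grad_x phi z0).
  apply/matrixP => i j; rewrite [RHS]mxE [X in _ = X + _]mxE [X in _ = _ + X]mxE.
  have E : ((grad_x phi z0)^T *m grad_x phi z0) i j = grad_x phi z0 0 i * grad_x phi z0 0 j.
    by rewrite mxE big_ord1 mxE.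
  have kk : 2 * K / k ^+ 2 * k ^+ 2 = 2 * K by rewrite divfK // gt_eqF // exprn_gt0.
  rewrite E kk; apply: (etrans (hess_xE Phi z0 i j)).
  apply: (etrans (D2 (e_ j, 0) (e_ i, 0))).
  have H2 := hess_xE phi z0 i j; have G1 := grad_xE phi z0 i; have G2 := grad_xE phi z0 j.
  by rewrite H2 G1 G2 addrC mulrA.
move=> HPhi; have {HPhi} HPhi : ((k * dt phi z0)%:E
    + lsc_env (@Fdom R n) F (k *: grad_x phi z0, k *: hess_x phi z0
       + (2 * K / k ^+ 2 * k ^+ 2) *: ((grad_x phi z0)^T *m grad_x phi z0))%R
    + lsc_env setT alpha z0.1 * (enorm (k *: grad_x phi z0)%R)%:E <= 0)%E.
  apply: HPhi; have near_s : \forall z \near z0, `|phi z - phi z0| < d.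
    by have /cvgrPdist_lt/(_ d d0) := cphi; apply: filterS => z; rewrite distrC.
  apply: filterS3 Qn near_s Hmax => z Qz sd.
  rewrite (usc_env_continuous cv (Qpos_Q0 Qz)) (usc_env_continuous cv (Qpos_Q0 Qz0)).
  rewrite (usc_env_continuous cu (Qpos_Q0 Qz)) (usc_env_continuous cu (Qpos_Q0 Qz0)).
  rewrite -!EFinB !lee_fin => Hz.
  have Hs : squash (u z) <= squash (u z0) + (phi z - phi z0) by move: Hz; lra.
  have := HK _ _ sd Hs; rewrite /Phi /relabel subrr !mulr0 !addr0 -/k.
  by move: (k * _) (K * _); move=> *; lra.
have [r ar] := lsc_env_bounded z0.1 HB.
move: HPhi; rewrite ar enormZ ?(ltW k0) // -!EFinM leNgt => /negP HPhi.
rewrite leNgt; apply/negP => Hpos; apply: HPhi.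
set e := enorm _ in Hpos *; set a := dt phi z0 in Hpos *.
have [b [b1 b2]] : exists b : R, 0 < a + b + r * e /\
    (b%:E < lsc_env (@Fdom R n) F (grad_x phi z0, hess_x phi z0))%E.
  move: Hpos; case: (lsc_env _ _ _) => [s| |].
  - rewrite -!EFinD lte_fin => H; exists (s - (a + s + r * e) / 2); rewrite lte_fin.
    by move: H; move: (r * e) => t; split; lra.
  - by move=> _; exists (1 - a - r * e); rewrite ltry; split=> //; move: (r * e) => t; lra.
  - by rewrite addeNy addNye.
have := lsc_env_F_relabel (2 * K / k ^+ 2) k0 b2.
case: (lsc_env _ _ _) => [s| |] //.
- rewrite lee_fin -!EFinD lte_fin => ks; apply: lt_le_trans (_ : k * (a + b + r * e) <= _).
    by rewrite pmulr_rgt0.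
  by rewrite !mulrDr (mulrCA k r e) lerD2r lerD2l.
- by move=> _; rewrite addey // addye // ltry.
Unshelve. all: end_near. Qed.

End SubRelabel.

(** * Exchange of the two phases *)

Section Reflection.
Context {R : realType} {n : nat}.
Implicit Types (u phi : 'rV[R]_n * R -> R) (z : 'rV[R]_n * R) (alpha : 'rV[R]_n -> R).

Lemma usc_env_comp (T : topologicalType) (D : set T) (h : T -> R) (sigma : T -> T) x :
  {for x, continuous sigma} -> (forall y, D y -> D (sigma y)) ->
  (usc_env D (h \o sigma) x <= usc_env D h (sigma x))%E.
Proof.
move=> cs Ds; apply: le_ereal_inf_tmp => _ [V FV <-].
apply: (@le_trans _ _ (ereal_sup [set ((h \o sigma) y)%:E | y in sigma @^-1` V `&` D])).
  apply: ereal_inf_lbound; exists (sigma @^-1` V `&` D) => //.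
  have : \forall y \near x, D (sigma y) -> V (sigma y) := cs _ FV.
  by apply: filterS => y H Dy; split=> //; apply: H; exact: Ds.
by apply: ge_ereal_sup => _ [y [Vy _] <-]; apply: ereal_sup_ubound; exists (sigma y).
Qed.

Lemma enormN (p : 'rV[R]_n) : enorm (- p) = enorm p.
Proof.
by rewrite /enorm; congr Num.sqrt; apply: eq_bigr => i _; apply: eq_bigr => j _; rewrite mxE sqrrN.
Qed.

Lemma F_opp (p : 'rV[R]_n) (X : 'M[R]_n) : F (- p, - X) = - F (p, X).
Proof.
rewrite /F /= enormN scalerN; set e := _ *: p.
have -> : (- e)^T *m (- e) = e^T *m e.
  by apply/matrixP => i j; rewrite !mxE !big_ord1 !mxE mulrNN.
by rewrite mulmxN raddfN.
Qed.

(** The involution [(p, X) |-> (- p, - X)] is continuous and preserves [Fdom]; [usc_env_comp],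
    applied to it twice, gives both inequalities. *)
Lemma usc_env_F_opp (p : 'rV[R]_n) (X : 'M[R]_n) :
  usc_env (@Fdom R n) F (- p, - X) = (- lsc_env (@Fdom R n) F (p, X))%E.
Proof.
pose sigma (pX : 'rV[R]_n * 'M[R]_n) := (- pX.1, - pX.2).
have cs pX : {for pX, continuous sigma}.
  have c1 : (fun w : 'rV[R]_n * 'M[R]_n => - w.1) @ pX --> - pX.1 by apply: cvgN; exact: cvg_fst.
  have c2 : (fun w : 'rV[R]_n * 'M[R]_n => - w.2) @ pX --> - pX.2 by apply: cvgN; exact: cvg_snd.
  exact: (cvg_pair c1 c2).
have Ds pX : @Fdom R n pX -> Fdom (sigma pX).
  move=> [/= p0 sX]; split=> /=; last by rewrite linearN /= sX.
  by move=> /eqP; rewrite oppr_eq0 => /eqP.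
have sK pX : sigma (sigma pX) = pX by rewrite /sigma /= !opprK -surjective_pairing.
have FE : F \o sigma = (fun pX : 'rV[R]_n * 'M[R]_n => - F pX).
  by apply/funext => -[q Y]; rewrite /= F_opp.
have FE2 : (fun pX => - F pX) \o sigma = @F R n.
  by apply/funext => -[q Y]; rewrite /= F_opp opprK.
rewrite lsc_envE oppeK; apply/eqP; rewrite eq_le; apply/andP; split.
  have := @usc_env_comp _ (@Fdom R n) (fun pX => - F pX) sigma (- p, - X) (cs _) Ds.
  by rewrite FE2 (sK (p, X)).
have := @usc_env_comp _ (@Fdom R n) F sigma (p, X) (cs _) Ds.
by rewrite FE.
Qed.

Lemma relabel_opp phi : relabel phi 0 (-1) 0 0 = (fun z => - phi z).
Proof. by apply/funext => z; rewrite /relabel; ring. Qed.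

Lemma Ck_opp (U : set ('rV[R]_n * R)) phi : open U -> Ck_on U 2 phi ->
  Ck_on U 2 (fun z => - phi z).
Proof. by move=> oU Cphi; rewrite -relabel_opp; exact: relabel_Ck. Qed.

Lemma jet_opp phi z : Ck_on Qpos 2 phi -> Qpos z ->
  [/\ dt (fun z => - phi z) z = - dt phi z,
      grad_x (fun z => - phi z) z = - grad_x phi z
    & hess_x (fun z => - phi z) z = - hess_x phi z].
Proof.
move=> Cphi Qz; rewrite -relabel_opp.
have D1 v : 'D_v (relabel phi 0 (-1) 0 0) z = - 'D_v phi z.
  rewrite (@derive_relabel R _ Qpos phi 0 (-1) 0 0 Cphi) //.
  by rewrite mulr0 mul0r addr0 mulN1r.
have D2 v w : 'D_w ('D_v (relabel phi 0 (-1) 0 0)) z = - 'D_w ('D_v phi) z.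
  rewrite (@derive2_relabel R _ Qpos phi 0 (-1) 0 0 open_Qpos Cphi) //.
  by rewrite mulr0 !mul0r addr0 add0r mulN1r.
split; first by rewrite !dtE D1.
  by apply/rowP => i; rewrite [RHS]mxE !grad_xE D1.
apply/matrixP => i j; rewrite [RHS]mxE; apply: (etrans (hess_xE _ z i j)).
apply: (etrans (D2 (e_ j, 0) (e_ i, 0))).
by have H := hess_xE phi z i j; rewrite H.
Qed.

Lemma usc_env_opp (T : topologicalType) (D : set T) (h : T -> R) x :
  usc_env D (fun y => - h y) x = (- lsc_env D h x)%E.
Proof. by rewrite lsc_envE oppeK. Qed.

Lemma lsc_env_opp (T : topologicalType) (D : set T) (h : T -> R) x :
  lsc_env D (fun y => - h y) x = (- usc_env D h x)%E.
Proof.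
rewrite lsc_envE; congr (- usc_env _ _ _)%E.
by apply/funext => y; rewrite opprK.
Qed.

Lemma locally_bounded_opp u : locally_bounded u -> locally_bounded (fun z => - u z).
Proof.
move=> bw z Qz; have := bw z Qz; rewrite /bounded_near.
by apply: filterS => M; apply: filterS => y /=; rewrite normrN.
Qed.

Lemma leeB_opp (a b : \bar R) (x y : R) :
  (- a - x%:E <= - b - y%:E -> b - (- y)%:E <= a - (- x)%:E)%E.
Proof.
case: a => [a| |]; case: b => [b| |] //=; rewrite ?leey ?leNye //.
by rewrite -?EFinN -?EFinD !lee_fin; lra.
Qed.

Lemma viscosity_super_opp alpha (B : R) (w : 'rV[R]_n * R -> R) : (forall x, `|alpha x| <= B) ->
  viscosity_super alpha w -> viscosity_sub (fun x => - alpha x) (fun z => - w z).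
Proof.
move=> HB [bw sw]; split; first exact: locally_bounded_opp.
move=> phi z0 Cphi Qz0 Hmax; have [J1 J2 J3] := jet_opp Cphi Qz0.
have := sw (fun z => - phi z) z0 (Ck_opp open_Qpos Cphi) Qz0 _.
rewrite J1 J2 J3 usc_env_F_opp enormN => H.
have {H} : (0 <= (- dt phi z0)%:E - lsc_env (@Fdom R n) F (grad_x phi z0, hess_x phi z0)
     + usc_env setT alpha z0.1 * (enorm (grad_x phi z0))%:E)%E.
  apply: H; apply: filterS Hmax => z.
  by move: (usc_env_opp Q0 w z) (usc_env_opp Q0 w z0) => -> ->; exact: leeB_opp.
have HBN x : `|- alpha x| <= B by rewrite normrN.
have [r rE] := lsc_env_bounded z0.1 HBN.
have -> : usc_env setT alpha z0.1 = (- r)%:E.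
  by move: rE; rewrite (lsc_env_opp setT alpha) EFinN => <-; rewrite oppeK.
rewrite rE.
case: (lsc_env _ _ _) => [s| |].
- rewrite -?EFinN -!EFinM -!EFinD !lee_fin ?mulNr; move: (r * _) => t; move=> *; lra.
- by rewrite -!EFinM addeNy addNye.
- by move=> _; rewrite addeNy addNye leNye.
Qed.

Lemma viscosity_sub_opp alpha (B : R) (v : 'rV[R]_n * R -> R) : (forall x, `|alpha x| <= B) ->
  viscosity_sub alpha v -> viscosity_super (fun x => - alpha x) (fun z => - v z).
Proof.
move=> HB [bv sv]; split; first exact: locally_bounded_opp.
move=> phi z0 Cphi Qz0 Hmin; have [J1 J2 J3] := jet_opp Cphi Qz0.
have := sv (fun z => - phi z) z0 (Ck_opp open_Qpos Cphi) Qz0 _.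
have E : lsc_env (@Fdom R n) F (- grad_x phi z0, - hess_x phi z0)
    = (- usc_env (@Fdom R n) F (grad_x phi z0, hess_x phi z0))%E.
  by have := usc_env_F_opp (- grad_x phi z0) (- hess_x phi z0); rewrite !opprK => ->; rewrite oppeK.
rewrite J1 J2 J3 E enormN => H.
have {H} : ((- dt phi z0)%:E - usc_env (@Fdom R n) F (grad_x phi z0, hess_x phi z0)
     + lsc_env setT alpha z0.1 * (enorm (grad_x phi z0))%:E <= 0)%E.
  apply: H; apply: filterS Hmin => z.
  by move: (lsc_env_opp Q0 v z) (lsc_env_opp Q0 v z0) => -> ->; exact: leeB_opp.
have [r rE] := lsc_env_bounded z0.1 HB; rewrite rE (usc_env_opp setT alpha) rE.
case: (usc_env _ _ _) => [s| |].
- rewrite -?EFinN -!EFinM -!EFinD !lee_fin ?mulNr; move: (r * _) => t; move=> *; lra.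
- by move=> _; rewrite -!EFinN -!EFinM addey // addye // leey.
- by rewrite -!EFinN -!EFinM addey // addye.
Qed.

Lemma continuous_opp_within u : {within @Q0 R n, continuous u} ->
  {within @Q0 R n, continuous (fun z => - u z)}.
Proof. by move=> cu z; apply: cvgN; exact: cu. Qed.

Lemma bounded_opp u : [bounded u z | z in @Q0 R n] -> [bounded - u z | z in @Q0 R n].
Proof.
rewrite /bounded_near; apply: filterS => M H z Qz /=; rewrite normrN; exact: H.
Qed.

(** Negation exchanges sub- and supersolutions, so [v] and [w] trade places. *)
Lemma comparison_opp alpha (B : R) : (forall x, `|alpha x| <= B) ->
  @comparison_principle R n alpha -> @comparison_principle R n (fun x => - alpha x).
Proof.
move=> HB cmp v w bv cv sv bw cw sw vw z Qz.
have HBN x : `|- alpha x| <= B by rewrite normrN.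
have aE : (fun x => - - alpha x) = alpha by apply/funext => x; rewrite opprK.
rewrite -lerN2; apply: (cmp (fun z => - w z) (fun z => - v z)) => //.
- exact: bounded_opp.
- by move=> y Qy; rewrite (usc_env_opp Q0 w) (cw y Qy).
- by have := viscosity_super_opp HBN sw; rewrite aE.
- exact: bounded_opp.
- by move=> y Qy; rewrite (lsc_env_opp Q0 v) (cv y Qy).
- by have := viscosity_sub_opp HBN sv; rewrite aE.
- by move=> x; rewrite lerN2.
Qed.

End Reflection.

Section PhaseFront.
Context {R : realType} {n : nat} (eps0 gamma : R).
Context (f : R -> R -> 'rV[R]_n -> R) (ue : R -> 'rV[R]_n * R -> R) (beta g : 'rV[R]_n -> R).
Hypothesis pm : phase_model eps0 gamma f ue beta.
Hypothesis g_cont : continuous g.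
Hypothesis ue0 : forall eps x, 0 < eps < eps0 -> ue eps (x, 0) = g x.

(** At an unsettled point [phase] is [-1], and comparison with [-1 + squash u] leaves
    [squash u <= 0]. The shift by [-1] gives the order at [t = 0] both where [g > 0], because
    [squash < 1], and where [g <= 0]. *)
Lemma positive_settled (B : R) (i0 : 'I_n) (u : 'rV[R]_n * R -> R) :
  (forall x, `|beta x| <= B) -> comparison_principle beta ->
  {within @Q0 R n, continuous u} -> viscosity_sub beta u ->
  (forall x, g x <= 0 -> u (x, 0) <= 0) ->
  forall z, Qpos z -> 0 < u z -> settled gamma ue z.
Proof.
move=> HB cmp cu su u0 z Qz uz; apply: contrapT => nz.
have cv := squash_continuous cu.
have HB' x : beta x <= B by have := HB x; rewrite ler_norml => /andP[].
have := cmp _ (phase gamma ue g) _ (fun y Qy => usc_env_continuous cv Qy)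
  (viscosity_sub_squash HB cu su) (phase_bounded gamma ue g) (phase_lsc pm g_cont ue0)
  (phase_super pm g_cont ue0 i0 HB') _ z (Qpos_Q0 Qz).
rewrite (phase_unsettled g Qz nz) => H.
have : -1 + squash (u z) <= -1.
  apply: H.
    by exists 2; split=> [|M M2 y _]; [exact: num_real|exact: le_trans (squash_bound u y) (ltW M2)].
  move=> x; have [gx|gx] := ltP 0 (g x).
    have -> : phase gamma ue g (x, 0) = 1 by rewrite /phase; case: asboolP => // -[]; right.
    by have := norm_squash (u (x, 0)); rewrite ltr_norml => /andP[_]; lra.
  apply: le_trans (phase_ge _ _ _ _).
  by rewrite gerDl leNgt squash_gt0 -leNgt; exact: u0.
by rewrite gerDl leNgt squash_gt0 uz.
Qed.

End PhaseFront.

(** * Estimates from the standing hypotheses *)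

Section ClassicalReflection.
Context {R : realType} {n : nat}.
Implicit Types (u : 'rV[R]_n * R -> R) (z : 'rV[R]_n * R).

Lemma quad1 (x : 'rV[R]_n) : quad 1%:M x x = dotv x x.
Proof.
apply: eq_bigr => j _; rewrite (bigD1 j) //= big1 ?addr0; first by rewrite mxE eqxx mulr1n mulr1.
by move=> l lj; rewrite mxE eq_sym (negbTE lj) mulr0n mulr0 mul0r.
Qed.

Lemma C21_oppE u z : C21 u -> Qpos z ->
  [/\ dt (fun y => - u y) z = - dt u z,
      grad_x (fun y => - u y) z = - grad_x u z
    & hess_x (fun y => - u y) z = - hess_x u z].
Proof.
move=> Cu Qz; have D1 i (x : 'rV[R]_n) :
    'D_(e_ i) (fun y => - u (y, z.2)) x = - 'D_(e_ i) (fun y => u (y, z.2)) x.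
  by have [_ du _ _] := Cu (x, z.2) Qz; exact: (deriveN (du i)).
split.
- have [du _ _ _] := Cu z Qz.
  by rewrite /dt !derive1E; exact: (deriveN du).
- by apply/rowP => i; rewrite !mxE D1.
- apply/matrixP => i j; rewrite !mxE.
  have [_ _ du _] := Cu z Qz.
  rewrite -(deriveN (du j i)); congr ('D_(e_ i) _ z.1).
  by apply/funext => x; exact: D1.
Qed.

Lemma C21_opp u : C21 u -> C21 (fun y => - u y).
Proof.
move=> Cu z Qz; have [d1 d2 d3 [c1 c2 c3]] := Cu z Qz.
have Qn := near_Qpos Qz.
have ext (T : topologicalType) (h k : 'rV[R]_n * R -> T) :
    (forall y, Qpos y -> k y = h y) -> {for z, continuous k} -> {for z, continuous h}.
  move=> hk ck; rewrite /prop_for /continuous_at -(hk _ Qz); apply: cvg_trans ck.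
  by apply: near_eq_cvg; apply: filterS Qn => y Qy; rewrite hk.
split.
- exact: derivableN.
- by move=> i; apply: derivableN; exact: d2.
- move=> i j; have -> : 'D_(e_ i) (fun y => - u (y, z.2)) = - 'D_(e_ i) (fun y => u (y, z.2)).
    apply/funext => x; have [_ du _ _] := Cu (x, z.2) Qz; exact: (deriveN (du i)).
  by apply: derivableN; exact: d3.
split.
- apply: (@ext _ _ (fun y => - dt u y)); last exact: cvgN.
  by move=> y Qy; have [] := C21_oppE Cu Qy.
- apply: (@ext _ _ (fun y => - grad_x u y)); last exact: cvgN.
  by move=> y Qy; have [] := C21_oppE Cu Qy.
- apply: (@ext _ _ (fun y => - hess_x u y)); last exact: cvgN.
  by move=> y Qy; have [] := C21_oppE Cu Qy.
Qed.

(* Penalization by a quadratic: [u - 1 - sigma (|x|^2 + (2 n + 1) t)] is negative for large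
   [x] and a strict subsolution of the heat equation where it is positive. *)
Lemma solution_le1 (eps : R) (f : R -> 'rV[R]_n -> R) u :
  0 < eps -> {within @Q0 R n, continuous u} -> [bounded u z | z in @Q0 R n] -> C21 u ->
  (forall z, Qpos z -> dt u z - \tr (hess_x u z) + eps ^- 2 * f (u z) z.1 = 0) ->
  (forall x, u (x, 0) <= 1) -> (forall q x, 1 < q -> 0 <= f q x) ->
  forall z, Q0 z -> u z <= 1.
Proof.
move=> eps0 cu bu Cu eq_u u0 f0 z Qz.
have [M M0 HM] : exists2 M : R, 0 < M & forall z, Q0 z -> u z <= M.
  have [M [_ HM]] := bu; exists (`|M| + 1); first by rewrite ltr_wpDl.
  move=> y Qy; apply: (le_trans (ler_norm _)); apply: (HM (`|M| + 1)) => //.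
  by apply: (le_lt_trans (ler_norm _)); rewrite ltrDl.
pose D (y : 'rV[R]_n * R) : R := dotv y.1 y.1 + (2 * n%:R + 1) * y.2.
have Dz : 0 <= D z.
  by rewrite addr_ge0 ?dotv_ge0 // mulr_ge0 // addr_ge0 // mulr_ge0.
suff key (sigma : R) : 0 < sigma -> u z <= 1 + sigma * D z.
  apply/ler_addgt0Pr => e e0; have d0 : 0 < D z + 1 by rewrite ltr_wpDl.
  apply: (le_trans (key (e / (D z + 1)) _)); first by rewrite divr_gt0.
  by rewrite lerD2l mulrAC ler_pdivrMr // ler_pM2l // lerDl.
(* [rho] makes the penalty exceed the bound [M] on the lateral boundary and keeps [z] in the
   cylinder; in [D], the rate [2 * n + 1] in time beats the Laplacian [2 * n] of the square. *)
move=> s0; pose rho := \sum_i `|z.1 0 i| + M / sigma + 1.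
have S0 : 0 <= \sum_i `|z.1 0 i| by apply: sumr_ge0.
have Ms : 0 < M / sigma by rewrite divr_gt0.
have rho1 : 1 <= rho by rewrite /rho lerDr addr_ge0 // ltW.
have rhoM : M <= sigma * rho ^+ 2.
  rewrite -ler_pdivrMl // mulrC; apply: (@le_trans _ _ rho).
    by rewrite /rho -addrA addrCA lerDl addr_ge0.
  by rewrite expr2 ler_peMl // (le_trans ler01).
pose w (y : 'rV[R]_n * R) : R := u y - (1 + sigma * D y).
suff : w z <= 0 by rewrite /w subr_le0.
apply: (@parabolic_max R n 0 rho 0 z.2 0 w).
- move=> y; apply: cvgB.
    by apply: (continuous_subspaceW (cyl_Q0 (lexx 0))); exact: cu.
  apply: cvgD; first exact: cvg_cst.
  apply: cvgM; first exact: cvg_cst.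
  suff cD : continuous D by apply: continuous_subspaceT => ? ; exact: cD.
  move=> p; apply: cvgD; last by apply: cvgM; [exact: cvg_cst|exact: cvg_snd].
  by apply: cvg_sumr => i; apply: cvgM; exact: coord_cvg.
- move=> y cy wy; have Qy := cyl_Q0 (lexx 0) cy.
  have Dy : dotv y.1 y.1 <= D y.
    by rewrite /D lerDl mulr_ge0 // addr_ge0 // mulr_ge0.
  have u1 : 1 < u y.
    move: wy; rewrite /w subr_gt0; apply: le_lt_trans; rewrite lerDl mulr_ge0 ?(ltW s0) //.
    exact: le_trans (dotv_ge0 _) Dy.
  have yt : 0 < y.2.
    rewrite lt_neqAle; apply/andP; split => //; apply/eqP => y20.
    by move: u1; rewrite [y]surjective_pairing -y20 ltNge u0.
  have yr : forall i, `|y.1 0 i - (0 : 'rV[R]_n) 0 i| < rho.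
    apply: cube_boundary; first by case: cy.
    move=> [i]; rewrite mxE subr0 => yi.
    move: wy; rewrite /w subr_gt0 ltNge => /negP; apply.
    apply: (le_trans (HM y Qy)); apply: (le_trans rhoM); rewrite ler_wpDl // ler_pM2l //.
    apply: le_trans Dy; apply: le_trans (sqr_le_dotv _ i).
    by rewrite -yi real_normK ?num_real.
  split=> //.
  exists (dt u y - sigma * (2 * n%:R + 1)), (fun i => grad_x u y 0 i - sigma * (2 * y.1 0 i)),
    (fun i => hess_x u y i i - sigma * 2); split.
  + apply: is_derive_sub; first exact: C21_dt.
    have dc (a : R) : is_derive y.2 1 (fun _ : R => a : R) 0 by exact: is_derive_cst.
    have dD : is_derive y.2 1 (fun t => D (y.1, t)) (2 * n%:R + 1).
      have := is_derive_add (dc (dotv y.1 y.1)) (is_derive_linear (2 * n%:R + 1) y.2).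
      by rewrite add0r.
    apply: (is_derive_val (is_derive_add (dc 1) (is_derive_cstM sigma dD))).
    by rewrite add0r.
  + move=> i; apply: jet2_sub; first exact: C21_jet2.
    have jD : jet2 (fun s => D (y.1 + s *: e_ i, y.2)) (2 * y.1 0 i) 2.
      have := jet2_quad 0 y.1 i (trmx1 R n).
      have -> : \sum_j (1%:M : 'M[R]_n) i j * (y.1 0 j - (0 : 'rV[R]_n) 0 j) = y.1 0 i.
        rewrite (bigD1 i) //= big1 ?addr0 ?mxE ?eqxx ?mul1r ?subr0 // => j ji.
        by rewrite mxE eq_sym (negbTE ji) mul0r.
      move=> jq; have := jet2_add jq (jet2_cst ((2 * n%:R + 1) * y.2)).
      rewrite !addr0 mxE eqxx mulr1n mulr1; congr jet2; apply/funext => s; rewrite /D /=.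
      by rewrite subr0 quad1.
    have := jet2_add (jet2_cst 1) (jet2_cstM sigma jD).
    by rewrite !add0r.
  have sn : sigma * 2 *+ n = n%:R * (sigma * 2) by rewrite mulr_natl.
  rewrite mul0r sumrB sumr_const card_ord sn.
  have := eq_u y yt; rewrite /mxtrace.
  have : 0 <= eps ^- 2 * f (u y) y.1.
    by rewrite mulr_ge0 ?f0 // invr_ge0 exprn_ge0 // ltW.
  move: (eps ^- 2 * _) (\sum_i _) (dt u y) (n%:R : R) => A S d m A0 E.
  have -> : d = S - A by move: E; clear; move=> ?; lra.
  have -> : S - A - sigma * (2 * m + 1) - (S - m * (sigma * 2)) = - A - sigma by ring.
  by rewrite -opprD oppr_le0 addr_ge0 // ltW.
- split=> /=; last by rewrite Qz lexx.
  move=> i; rewrite mxE subr0; apply: (@le_trans _ _ (\sum_i `|z.1 0 i|)).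
    by rewrite (bigD1 i) //= lerDl; apply: sumr_ge0.
  by rewrite /rho -addrA lerDl addr_ge0 // ltW.
Qed.

End ClassicalReflection.

Section ProductSlices.
Context {R : realType} {n : nat}.
Implicit Types (h : R * 'rV[R]_n -> R) (f : R -> 'rV[R]_n -> R) (x w : 'rV[R]_n) (q : R).

Let qdir : R * 'rV[R]_n := (1, 0).
Let xdir w : R * 'rV[R]_n := (0, w).

Lemma derive_qdir h q x : 'D_qdir h (q, x) = derive1 (fun s => h (s, x)) q.
Proof.
rewrite derive1E.
have E : (fun s : R => s^-1 *: (h (s *: qdir + (q, x)) - h (q, x))) =
    (fun s : R => s^-1 *: (h (s *: (1 : R) + q, x) - h (q, x))).
  apply/funext => s; congr (_ *: (h (_, _) - _)).
  by rewrite /= scaler0 add0r.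
exact: (congr1 (fun k => lim (k @ 0^')) E).
Qed.

Lemma derive_xdir h q x w : 'D_(xdir w) h (q, x) = 'D_w (fun y => h (q, y)) x.
Proof.
have E : (fun s : R => s^-1 *: (h (s *: xdir w + (q, x)) - h (q, x))) =
    (fun s : R => s^-1 *: (h (q, s *: w + x) - h (q, x))).
  apply/funext => s; congr (_ *: (h (_, _) - _)).
  by rewrite /= scaler0 add0r.
exact: (congr1 (fun k => lim (k @ 0^')) E).
Qed.

Lemma d_qE f q x : d_q f q x = 'D_qdir (fun z => f z.1 z.2) (q, x).
Proof. by rewrite derive_qdir. Qed.

Lemma d_qqE f q x : d_q (d_q f) q x = 'D_qdir ('D_qdir (fun z => f z.1 z.2)) (q, x).
Proof.
rewrite derive_qdir /d_q; congr (derive1 _ q); apply/funext => s.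
by rewrite derive_qdir.
Qed.

Lemma grad_d_qE f q x i :
  grad (d_q f q) x 0 i = 'D_(xdir (e_ i)) ('D_qdir (fun z => f z.1 z.2)) (q, x).
Proof.
rewrite mxE derive_xdir; congr ('D_(e_ i) _ x); apply/funext => y.
by rewrite derive_qdir.
Qed.

Lemma hess_sliceE f q x i j :
  hess (f q) x i j = 'D_(xdir (e_ i)) ('D_(xdir (e_ j)) (fun z => f z.1 z.2)) (q, x).
Proof.
rewrite mxE derive_xdir; congr ('D_(e_ i) _ x); apply/funext => y.
by rewrite derive_xdir.
Qed.

Lemma class_C2_dq f q x : class_C2 f -> is_derive q (1 : R) (f ^~ x) (d_q f q x).
Proof.
move=> [_ /(_ qdir)[dh _]].
have E s : ((0, x) + s *: qdir : R * 'rV[R]_n) = (s, x).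
  by rewrite /qdir; congr (_, _); rewrite /= ?scaler0 ?addr0 ?add0r // /GRing.scale /= mulr1.
have := @is_derive_line R _ (fun z => f z.1 z.2) (0, x) qdir q (dh _ I).
by rewrite E -d_qE; congr is_derive; apply/funext => s; rewrite E.
Qed.

Lemma class_C2_jet2 f x q i (rho : R -> R) (r1 r2 : R) : class_C2 f -> jet2 rho r1 r2 -> rho 0 = q ->
  jet2 (fun s => f (rho s) (x + s *: e_ i)) (r1 * d_q f q x + grad (f q) x 0 i)
    (r1 ^+ 2 * d_q (d_q f) q x + 2 * r1 * grad (d_q f q) x 0 i + r2 * d_q f q x
     + hess (f q) x i i).
Proof.
move=> Cf jrho rho0; have j0 : jet2 (fun s => rho s - q) r1 r2.
  have := jet2_sub jrho (jet2_cst q); by rewrite !subr0.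
have := @C2_curve_jet2 R _ _ (q, x) qdir (xdir (e_ i)) _ r1 r2 Cf _ j0.
rewrite rho0 subrr => /(_ erefl).
rewrite (derive_symmetric _ _ openT I Cf) -grad_d_qE -hess_sliceE -d_qE -d_qqE.
have -> : 'D_(xdir (e_ i)) (fun z : R * 'rV[R]_n => f z.1 z.2) (q, x) = grad (f q) x 0 i.
  by rewrite derive_xdir mxE.
congr jet2; apply/funext => s; congr f => /=.
  by rewrite /GRing.scale /= mulr1 mulr0 addr0 addrC subrK.
by rewrite scaler0 addr0.
Qed.

End ProductSlices.

Section NonlinearityFacts.
Context {R : realType} {n : nat} (eps0 rho gamma k : R).
Context (f : R -> R -> 'rV[R]_n -> R) (mo : R -> 'rV[R]_n -> R).
Hypothesis Hf : nonlinearity eps0 rho gamma k f mo.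
Hypothesis gamma01 : 0 < gamma < 1.
Implicit Types (x : 'rV[R]_n) (q eps : R).

(** The interval [[-2, 2]] also contains, for small [eps], the end states of the perturbed waves,
    which may lie outside [[-1, 1]]. *)
Lemma nl_lipschitz : exists2 L : R, 0 < L & forall eps x q q', 0 < eps < eps0 ->
  -2 <= q <= 2 -> -2 <= q' <= 2 -> `|f eps q x - f eps q' x| <= L * `|q - q'|.
Proof.
have [C [C1 [C2 [C0 _ _ HC]]]] := nl_bounds Hf (@segment_compact R (-2) 2).
exists C => // eps x q q' epsr qr qr'.
have [y yr ->] := @mean_value R (f eps ^~ x) (fun s => d_q (f eps) s x) q' q
  (fun s _ => class_C2_dq s x (nl_C2 Hf epsr)).
rewrite normrM ler_wpM2r //.
have [] := HC eps epsr y x; last by [].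
rewrite /= in_itv /=; move: yr => /andP[y1 y2]; apply/andP; split.
  by apply: le_trans y1; rewrite le_min; move: qr qr' => /andP[-> _] /andP[-> _].
by apply: (le_trans y2); rewrite ge_max; move: qr qr' => /andP[_ ->] /andP[_ ->].
Qed.

Lemma nl_zero eps x : 0 < eps < eps0 -> f eps 1 x = 0 /\ f eps (-1) x = 0.
Proof.
move=> epsr; have [_ z _ _ _] := nl_bistable Hf epsr x.
by split; apply/z; [apply: Or33|apply: Or31].
Qed.

Lemma nl_stable_right eps x q : 0 < eps < eps0 -> 1 - gamma <= q <= 1 ->
  f eps q x <= - (gamma * (1 - q)).
Proof.
move=> epsr /andP[q1 q2]; have [_ _ _ _ [slope _]] := nl_bistable Hf epsr x.
have [y /andP[y1 _]] := @mean_value R (f eps ^~ x) (fun s => d_q (f eps) s x) q 1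
  (fun s _ => class_C2_dq s x (nl_C2 Hf epsr)).
have [-> _] := nl_zero x epsr; rewrite min_l // in y1 * => E.
have := slope y (or_intror (le_trans q1 y1)).
have -> : f eps q x = - (d_q (f eps) y x * (1 - q)) by rewrite -E sub0r opprK.
by move=> sl; rewrite lerN2 ler_wpM2r // subr_ge0.
Qed.

Lemma nl_stable_left eps x q : 0 < eps < eps0 -> -1 <= q <= -1 + gamma ->
  gamma * (1 + q) <= f eps q x.
Proof.
move=> epsr /andP[q1 q2]; have [_ _ _ _ [slope _]] := nl_bistable Hf epsr x.
have [y /andP[_ y1]] := @mean_value R (f eps ^~ x) (fun s => d_q (f eps) s x) (-1) q
  (fun s _ => class_C2_dq s x (nl_C2 Hf epsr)).
have [_ ->] := nl_zero x epsr; rewrite subr0 opprK max_r // in y1 * => ->.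
have := slope y (or_introl (le_trans y1 q2)).
by move=> sl; rewrite [1 + q]addrC ler_wpM2r // -lerBlDr sub0r.
Qed.

Lemma nl_pos eps x q : 0 < eps < eps0 -> 1 < q -> 0 <= f eps q x.
Proof. by move=> epsr q1; have [_ _ p _ _] := nl_bistable Hf epsr x; apply/ltW/p; right. Qed.

Lemma nl_neg eps x q : 0 < eps < eps0 -> q < -1 -> f eps q x <= 0.
Proof. by move=> epsr q1; have [_ _ _ p _] := nl_bistable Hf epsr x; apply/ltW/p; left. Qed.

Lemma compact_max_neg (T : topologicalType) (S : set T) (h : T -> R) : compact S ->
  continuous h -> (forall p, S p -> h p < 0) -> exists2 mu : R, 0 < mu & forall p, S p -> h p <= - mu.
Proof.
move=> cS ch hS; have [S0|/set0P[p0 Sp0]] := eqVneq S set0.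
  by exists 1 => // p; rewrite S0.
have [] := @compact_EVT_max T R h S; first by exists p0.
- exact: cS.
- exact: continuous_subspaceT.
move=> p; rewrite inE => Sp Hp; exists (- h p); first by rewrite oppr_gt0 hS.
by move=> y Sy; rewrite opprK; apply: Hp; rewrite inE.
Qed.

(** [fup] and [flow] do not depend on [eps] and have strict signs on compact sets away from their
    zeroes. Taking [sigma < s] puts [[s, s']] strictly between two zeroes of [fup]; [flow], whose
    middle zero is 0, serves the negative phase. *)
Lemma nl_reaction (K : set 'rV[R]_n) (s s' : R) : compact K -> 0 < s -> s' < 1 ->
  exists2 mu : R, 0 < mu & \forall eps \near 0^'+, forall x q, K x ->
    (s <= q <= s' -> f eps q x <= - mu) /\ (- s' <= q <= - s -> mu <= f eps q x).
Proof.
move=> cK s0 s'1; have H := nl_barriers Hf cK.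
have H2 : \forall sigma \near (0 : R)^'+, 0 < sigma < s by exact: near_eps.
have [sigma [/andP[sig0 sigs] [fup [flow [bup blow Hb]]]]] := filter_ex (filterI H2 H).
have cS (a b : R) : compact (`[a, b]%classic `*` K) by apply: compact_setX => //; exact: segment_compact.
have [mu1 mu10 Hmu1] : exists2 mu : R, 0 < mu &
    forall p, (`[s, s']%classic `*` K) p -> fup p.1 p.2 <= - mu.
  apply: compact_max_neg => //; first by case: bup => -[cc _] _ _ z; exact: cc.
  move=> [q x] [/=]; rewrite in_itv /= => /andP[q1 q2] _.
  have [_ [g' _ bi] _] := bup; have [_ _ _ neg _] := bi x; apply: neg; right.
  by rewrite /cst (lt_le_trans sigs q1) (le_lt_trans q2 s'1).
have [mu2 mu20 Hmu2] : exists2 mu : R, 0 < mu &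
    forall p, (`[- s', - s]%classic `*` K) p -> - flow p.1 p.2 <= - mu.
  apply: (@compact_max_neg _ _ (fun p : R * 'rV[R]_n => - flow p.1 p.2)) => //.
    by case: blow => -[cc _] _ _ z; apply: cvgN; exact: cc.
  move=> [q x] [/=]; rewrite in_itv /= => /andP[q1 q2] _.
  have [_ [g' _ bi] _] := blow; have [_ _ pos _ _] := bi x; rewrite oppr_lt0; apply: pos; left.
  rewrite /cst; apply/andP; split; first by apply: lt_le_trans q1; rewrite ltrN2.
  by apply: le_lt_trans q2 _; rewrite oppr_lt0.
have [mu [mu0 m1 m2]] := small_lt2 mu10 mu20.
exists mu => //; apply: filterS Hb => eps Hfb x q Kx; split=> /andP[q1 q2].
  have [|_ up] := andP (Hfb x q Kx _).
    rewrite (le_trans q2 (ltW s'1)) andbT; apply: le_trans (le_trans (ltW s0) q1).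
    exact: lerN10.
  apply: (le_trans up); apply: le_trans (_ : - mu1 <= _); last by rewrite lerN2 ltW.
  by apply: (Hmu1 (q, x)); split=> //=; rewrite in_itv /= q1.
have [|lo _] := andP (Hfb x q Kx _).
  apply/andP; split; first by apply: le_trans q1; rewrite lerN2 ltW.
  by apply: (le_trans q2); apply: (@le_trans _ _ 0) => //; rewrite oppr_le0 ltW.
apply: le_trans lo; apply: (le_trans (ltW m2)); rewrite -lerN2.
by apply: (Hmu2 (q, x)); split=> //=; rewrite in_itv /= q1.
Qed.

End NonlinearityFacts.

Section PerturbedWaves.
Context {R : realType} {n : nat} (eps0 rho gamma k dbar : R).
Context (f : R -> R -> 'rV[R]_n -> R) (mo c : R -> 'rV[R]_n -> R).
Context (mmd mzd mpd : R -> R -> 'rV[R]_n -> R).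
Context (qd : R -> R -> R -> 'rV[R]_n -> R) (cd : R -> R -> 'rV[R]_n -> R).
Hypothesis eps0_gt0 : 0 < eps0.
Hypothesis gamma01 : 0 < gamma < 1.
Hypothesis k01 : 0 <= k < 1.
Hypothesis dbar_gt0 : 0 < dbar.
Hypothesis Hf : nonlinearity eps0 rho gamma k f mo.
Hypothesis Hqd : perturbed_waves eps0 dbar k f c mmd mzd mpd qd cd.
Implicit Types (x : 'rV[R]_n) (eps delta r : R).

Section Fixed.
Variables (eps delta : R).
Hypotheses (epsr : 0 < eps < eps0) (delr : `|delta| <= dbar).
Let Q := qd eps delta.

Lemma pw_C2 : class_C2 Q.
Proof. exact: (we_C2 (pw_estimates Hqd) (i := (eps, delta)) (conj epsr delr)). Qed.

Lemma pw_eq r x : d_q (d_q Q) r x + cd eps delta x * d_q Q r x = f eps (Q r x) x + eps * delta.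
Proof. by have [[[_ E _ _ _] _] _] := pw_unique Hqd x epsr delr; exact: E. Qed.

Lemma pw_slope r x : 0 < d_q Q r x.
Proof. by have [[_ E] _] := pw_unique Hqd x epsr delr; exact: E. Qed.

Lemma pw_mono r r' x : r <= r' -> Q r x <= Q r' x.
Proof.
move=> rr; apply: (@derive_ge0_le R (Q ^~ x) (fun s => d_q Q s x)) => //.
  by move=> s _; exact: class_C2_dq pw_C2.
by move=> s _; exact: ltW (pw_slope s x).
Qed.

Lemma pw_range r x : mmd eps delta x <= Q r x <= mpd eps delta x.
Proof.
have [[[_ _ cm cp _] _] _] := pw_unique Hqd x epsr delr.
apply/andP; split; rewrite leNgt; apply/negP => H.
  have H1 : \forall s \near -oo, Q r x < Q s x by exact: (cvgr_gt _ cm _ H).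
  have [s [qs sr]] := filter_ex (filterI H1 (nbhs_ninfty_le (num_real r))).
  by move: qs; rewrite ltNge pw_mono.
have H1 : \forall s \near +oo, Q s x < Q r x by exact: (cvgr_lt _ cp _ H).
have [s [qs sr]] := filter_ex (filterI H1 (nbhs_pinfty_ge (num_real r))).
by move: qs; rewrite ltNge pw_mono.
Qed.

(** The profile is increasing, equals the middle zero at [r = 0] and stays between the outer ones,
    so the bistable sign pattern can be read off [r]. *)
Lemma pw_sign r x : (0 <= r -> f eps (Q r x) x + eps * delta <= 0) /\
  (r <= 0 -> 0 <= f eps (Q r x) x + eps * delta).
Proof.
have [[[_ _ _ _ Q0] _] _] := pw_unique Hqd x epsr delr.
rewrite /= in Q0; have /andP[qm qp] := pw_range r x.
have [g' _ bi] := pw_bistable Hqd; have [_ zs pos neg _] := bi eps delta epsr delr x.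
split=> r0; have := pw_mono x r0; rewrite /Q Q0 => qz.
  have [E|ne] := eqVneq (Q r x) (mzd eps delta x).
    by have -> : f eps (Q r x) x + eps * delta = 0 by apply/zs; rewrite E; exact: Or32.
  have [E|ne'] := eqVneq (Q r x) (mpd eps delta x).
    by have -> : f eps (Q r x) x + eps * delta = 0 by apply/zs; rewrite E; exact: Or33.
  by apply/ltW/neg; right; rewrite !lt_neqAle qz qp eq_sym ne ne'.
have [E|ne] := eqVneq (Q r x) (mzd eps delta x).
  by have -> : f eps (Q r x) x + eps * delta = 0 by apply/zs; rewrite E; exact: Or32.
have [E|ne'] := eqVneq (Q r x) (mmd eps delta x).
  by have -> : f eps (Q r x) x + eps * delta = 0 by apply/zs; rewrite E; exact: Or31.
by apply/ltW/pos; left; rewrite !lt_neqAle qz qm ne eq_sym ne'.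
Qed.

Lemma pw_root x : f eps (mmd eps delta x) x = - (eps * delta) /\
  f eps (mpd eps delta x) x = - (eps * delta).
Proof.
have [g' _ bi] := pw_bistable Hqd; have [_ zs _ _ _] := bi eps delta epsr delr x.
by split; apply/eqP; rewrite -addr_eq0; apply/eqP/zs; [exact: Or31|exact: Or33].
Qed.

End Fixed.

Lemma pw_tails (delta a eta : R) : `|delta| <= dbar -> 0 < a -> 0 < eta ->
  \forall eps \near 0^'+, forall r x,
   (a / eps <= r -> mpd eps delta x - eta * eps <= qd eps delta r x) /\
   (r <= - a / eps -> qd eps delta r x <= mmd eps delta x + eta * eps).
Proof.
move=> delr a0 eta0; have [A [b [r0 [A0 b0 HA]]]] := we_tails (pw_estimates Hqd).
have ba : 0 < b * a by rewrite mulr_gt0.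
have r0' : 0 < a / (`|r0| + 1) by rewrite divr_gt0 // ltr_wpDl.
apply: filterS3 (near_eps eps0_gt0) (near_eps r0') (expR_small A ba eta0).
move=> eps epsr /andP[e0 er0] Hexp r x.
have ar0 : r0 <= a / eps.
  apply: (le_trans (ler_norm r0)); apply: (@le_trans _ _ (`|r0| + 1)); first by rewrite lerDl.
  rewrite ler_pdivlMr // mulrC -ler_pdivlMr ?ltr_wpDl //; exact: ltW.
have [H1 H2] := HA (eps, delta) x (conj epsr delr).
have expb s : a / eps <= s -> A * expR (- (b * s)) <= eta * eps.
  move=> as'; apply: le_trans Hexp; rewrite ler_pM2l // ler_expR lerN2 -mulrA.
  by rewrite ler_pM2l.
split=> ar.
  apply: le_trans (H1 r (le_trans ar0 ar)); rewrite lerD2l lerN2; exact: expb.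
have ar' : a / eps <= - r by rewrite lerNr -mulNr.
have rr0 : r <= - r0 by rewrite lerNr; exact: le_trans ar'.
apply: (le_trans (H2 r rr0)); rewrite lerD2l /=.
have -> : b * r = - (b * - r) by rewrite mulrN opprK.
exact: expb.
Qed.

Lemma powR_small (p d : R) : 0 < p -> 0 < d -> \forall eps \near (0 : R)^'+, eps `^ p <= d.
Proof.
move=> p0 d0; have e0 : 0 < d `^ p^-1 by rewrite powR_gt0.
apply: filterS (near_eps e0) => eps /andP[eps_gt0 epsd].
apply: (@le_trans _ _ ((d `^ p^-1) `^ p)).
  by apply: ge0_ler_powR; rewrite ?nnegrE ?(ltW p0) ?(ltW eps_gt0) ?(ltW e0) // ltW.
by rewrite -powRrM mulVf ?gt_eqF // powRr1 // ltW.
Qed.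

Lemma norm_le_enorm (p q : nat) (A : 'M[R]_(p, q)) i j : `|A i j| <= enorm A.
Proof.
rewrite -ler_sqr ?nnegrE ?sqrtr_ge0 // real_normK ?num_real // /enorm sqr_sqrtr; last first.
  by apply: sumr_ge0 => a _; apply: sumr_ge0 => b _; exact: sqr_ge0.
rewrite (bigD1 i) //= (bigD1 j) //= -addrA lerDl addr_ge0 //.
  by apply: sumr_ge0 => b _; exact: sqr_ge0.
by apply: sumr_ge0 => a _; apply: sumr_ge0 => b _; exact: sqr_ge0.
Qed.

(* The mixed and the pure [x]-derivatives contribute [O(eps^(1 - k)) / eps]. *)
Lemma pw_space (delta : R) (K : set 'rV[R]_n) (G eta : R) : `|delta| <= dbar -> compact K ->
  0 < eta ->
  \forall eps \near 0^'+, forall x i (rh : R -> R) (r1 r2 : R), K x ->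
    jet2 rh r1 r2 -> `|r1| <= G / eps ->
    exists d1 d2 : R, jet2 (fun s => qd eps delta (rh s) (x + s *: e_ i)) d1 d2 /\
      `|d2 - (d_q (d_q (qd eps delta)) (rh 0) x * r1 ^+ 2
              + d_q (qd eps delta) (rh 0) x * r2)| <= eta / eps.
Proof.
move=> delr cK eta0; have [M1 [M2 [M10 M20 HM]]] := we_space (pw_estimates Hqd) cK.
have k1 : 0 < 1 - k by case/andP: k01 => _; rewrite subr_gt0.
pose g := `|G| + 1; have g0 : 0 < g by rewrite ltr_wpDl.
have D0 : 0 < 2 * g * M1 + M2 by rewrite addr_gt0 ?mulr_gt0.
(* The bound by 1 reduces [eps^(2 (1 - k))], coming from the Hessian, to [eps^(1 - k)]; the other
   bound makes the total error at most [eta / eps]. *)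
pose d := Num.min 1 (eta / (2 * g * M1 + M2)).
have d0 : 0 < d by rewrite lt_min ltr01 divr_gt0.
apply: filterS2 (near_eps eps0_gt0) (powR_small k1 d0).
move=> eps epsr sd x i rh r1 r2 Kx jr r1G; have /andP[e0 _] := epsr.
set Q := qd eps delta.
exists (r1 * d_q Q (rh 0) x + grad (Q (rh 0)) x 0 i),
  (r1 ^+ 2 * d_q (d_q Q) (rh 0) x + 2 * r1 * grad (d_q Q (rh 0)) x 0 i + r2 * d_q Q (rh 0) x
     + hess (Q (rh 0)) x i i).
split; first exact: class_C2_jet2 (pw_C2 epsr delr) jr erefl.
have [_ B1 B2] := HM (eps, delta) x (rh 0) (conj epsr delr) Kx.
have {}B1 := le_trans (norm_le_enorm _ 0 i) B1; have {}B2 := le_trans (norm_le_enorm _ i i) B2.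
rewrite /= -/Q in B1 B2; set s := eps `^ (1 - k) in sd.
have s0 : 0 < s by rewrite powR_gt0.
have E1 : eps `^ (- (k - 1)) = s by rewrite opprB.
have E2 : eps `^ (- (2 * k - 1)) = s ^+ 2 / eps.
  have -> : - (2 * k - 1) = (1 - k) + (1 - k) - 1 by ring.
  have en : eps != 0 by rewrite gt_eqF.
  rewrite (@powRD R eps (1 - k + (1 - k)) (-1)) ?en ?implybT //.
  by rewrite (@powRD R eps (1 - k) (1 - k)) ?en ?implybT // powR_inv1 ?(ltW e0) // -expr2.
rewrite E1 in B1; rewrite E2 in B2.
have -> : r1 ^+ 2 * d_q (d_q Q) (rh 0) x + 2 * r1 * grad (d_q Q (rh 0)) x 0 i
    + r2 * d_q Q (rh 0) x + hess (Q (rh 0)) x i i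
    - (d_q (d_q Q) (rh 0) x * r1 ^+ 2 + d_q Q (rh 0) x * r2)
    = 2 * (r1 * grad (d_q Q (rh 0)) x 0 i) + hess (Q (rh 0)) x i i by ring.
have H1 : `|r1 * grad (d_q Q (rh 0)) x 0 i| <= g / eps * (M1 * s).
  rewrite normrM; apply: ler_pM => //; apply: (le_trans r1G).
  by rewrite ler_pM2r ?invr_gt0 // (le_trans (ler_norm G)) // lerDl.
apply: (le_trans (ler_normD _ _)); rewrite normrM (ger0_norm (ler0n R 2)).
apply: (@le_trans _ _ ((2 * g * M1 + M2) * s / eps)).
  have -> : (2 * g * M1 + M2) * s / eps = 2 * (g / eps * (M1 * s)) + M2 * (s / eps).
    by field; rewrite gt_eqF.
  apply: lerD; first by rewrite ler_pM2l.
  apply: (le_trans B2); rewrite ler_pM2l // ler_pM2r ?invr_gt0 // expr2 ler_piMl ?(ltW s0) //.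
  by apply: (le_trans sd); rewrite ge_min lexx.
rewrite ler_pM2r ?invr_gt0 // mulrC -ler_pdivlMr //; apply: (le_trans sd).
by rewrite ge_min lexx orbT.
Qed.

End PerturbedWaves.

Section PerturbedBarriers.
Context {R : realType} {n : nat} (eps0 rho gamma k dbar : R).
Context (f : R -> R -> 'rV[R]_n -> R) (mo c : R -> 'rV[R]_n -> R).
Context (mmd mzd mpd : R -> R -> 'rV[R]_n -> R).
Context (qd : R -> R -> R -> 'rV[R]_n -> R) (cd : R -> R -> 'rV[R]_n -> R).
Hypothesis eps0_gt0 : 0 < eps0.
Hypothesis gamma01 : 0 < gamma < 1.
Hypothesis k01 : 0 <= k < 1.
Hypothesis dbar_gt0 : 0 < dbar.
Hypothesis Hf : nonlinearity eps0 rho gamma k f mo.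
Hypothesis Hqd : perturbed_waves eps0 dbar k f c mmd mzd mpd qd cd.
Implicit Types (x : 'rV[R]_n) (eps delta r : R).

(** Quantifies how [delta] moves the end states: a positive [delta] lowers both and a negative one
    raises both, by at least [|delta| * eps / L]. This lower bound is the Lipschitz estimate of [f],
    which takes the value [- eps * delta] there and 0 at [-1] and [1]. *)
Record wave_gap (M L eps1 : R) : Prop := {
  wg_M : 0 < M;
  wg_L : 0 < L;
  wg_eps1 : 0 < eps1 <= eps0;
  wg_speed : forall eps delta x, 0 < eps < eps1 -> `|delta| <= dbar ->
    `|c eps x - cd eps delta x| <= M * `|delta| * eps;
  wg_right : forall eps delta x, 0 < eps < eps1 -> `|delta| <= dbar ->
    `|1 - mpd eps delta x| <= M * dbar * eps;
  wg_left : forall eps delta x, 0 < eps < eps1 -> `|delta| <= dbar ->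
    `|1 + mmd eps delta x| <= M * dbar * eps;
  wg_pos : forall eps delta x, 0 < eps < eps1 -> 0 < delta <= dbar ->
    mpd eps delta x <= 1 - delta / L * eps /\ mmd eps delta x <= - 1 - delta / L * eps;
  wg_neg : forall eps delta x, 0 < eps < eps1 -> 0 < delta <= dbar ->
    1 + delta / L * eps <= mpd eps (- delta) x /\ -1 + delta / L * eps <= mmd eps (- delta) x }.

Lemma pw_gap : exists M L eps1, wave_gap M L eps1.
Proof.
have [M M0 HM] := pw_close Hqd; have [L L0 HL] := nl_lipschitz Hf.
have /andP[g0 g1] := gamma01.
have Md0 : 0 < M * dbar by rewrite mulr_gt0.
(* Below [e1] the end states stay within [gamma] of [-1] and [1], where the sign of [f] decides on
   which side they lie. *)
have [e1 [e10 e1a e1b]] := small_lt2 eps0_gt0 (divr_gt0 g0 Md0).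
have sub eps : 0 < eps < e1 -> 0 < eps < eps0.
  by move=> /andP[-> H]; exact: lt_trans H e1a.
have close eps delta x : 0 < eps < e1 -> `|delta| <= dbar ->
    [/\ `|c eps x - cd eps delta x| <= M * `|delta| * eps,
        `|1 - mpd eps delta x| <= M * dbar * eps,
        `|1 + mmd eps delta x| <= M * dbar * eps & M * dbar * eps <= gamma].
  move=> epsr delr; have := HM eps delta x (sub _ epsr) delr.
  have /andP[e0 ee] := epsr.
  have H1 : M * `|delta| * eps <= M * dbar * eps by rewrite ler_pM2r // ler_pM2l.
  have H2 : M * dbar * eps <= gamma.
    by rewrite mulrC -ler_pdivlMr //; apply: ltW; exact: lt_trans e1b.
  have := normr_ge0 (c eps x - cd eps delta x); have := normr_ge0 (1 - mpd eps delta x).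
  have := normr_ge0 (1 + mmd eps delta x); move: H1 H2.
  move: `|c eps x - _| `|1 - _| `|1 + _| (M * _ * _) (M * dbar * eps) => A B C D E.
  by move=> *; split; lra.
have m2 eps delta x : 0 < eps < e1 -> `|delta| <= dbar ->
    [/\ 1 - gamma <= mpd eps delta x, mpd eps delta x <= 2,
        -2 <= mmd eps delta x & mmd eps delta x <= -1 + gamma].
  move=> epsr delr; have [_ B C D] := close eps delta x epsr delr.
  have := le_trans B D; have := le_trans C D; rewrite !ler_norml.
  move: (mpd _ _ _) (mmd _ _ _) g1 => p m g1 /andP[? ?] /andP[? ?].
  by split; lra.
have lip1 eps delta x : 0 < eps < e1 -> `|delta| <= dbar ->
    eps * `|delta| <= L * `|mpd eps delta x - 1| /\ eps * `|delta| <= L * `|mmd eps delta x + 1|.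
  move=> epsr delr; have epsr0 := sub _ epsr; have /andP[e0 _] := epsr.
  have [p1 p2 m1 m2'] := m2 eps delta x epsr delr.
  have [rm rp] := pw_root Hqd epsr0 delr x; have [z1 z2] := nl_zero Hf x epsr0.
  have edE : eps * `|delta| = `|- (eps * delta) - 0|.
    by rewrite subr0 normrN normrM (gtr0_norm e0).
  split; rewrite edE.
    rewrite -rp -z1; apply: HL => //; last by apply/andP; split; lra.
    by apply/andP; split=> //; apply: le_trans p1; lra.
  have m1E : mmd eps delta x + 1 = mmd eps delta x - (-1) by rewrite opprK.
  rewrite m1E -rm -z2; apply: HL => //; first by rewrite m1 /=; move: m2' g1; lra.
  by apply/andP; split; lra.
exists M, L, e1; split => //.
- by rewrite e10 ltW.
- by move=> eps delta x epsr delr; have [] := close eps delta x epsr delr.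
- by move=> eps delta x epsr delr; have [] := close eps delta x epsr delr.
- by move=> eps delta x epsr delr; have [] := close eps delta x epsr delr.
- move=> eps delta x epsr /andP[d0 dd].
  have delr : `|delta| <= dbar by rewrite gtr0_norm.
  have epsr0 := sub _ epsr; have /andP[e0 _] := epsr; have ed0 : 0 < eps * delta by rewrite mulr_gt0.
  have [p1 p2 m1 m2'] := m2 eps delta x epsr delr.
  have [rm rp] := pw_root Hqd epsr0 delr x; have [z1 z2] := nl_zero Hf x epsr0.
  have [l1 l2] := lip1 eps delta x epsr delr; rewrite (gtr0_norm d0) in l1 l2.
  have pl1 : mpd eps delta x < 1.
    rewrite ltNge; apply/negP; rewrite le_eqVlt => /orP[/eqP E|H].
      by move: rp; rewrite -E z1 => /esym/eqP; rewrite oppr_eq0 gt_eqF.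
    by have := nl_pos Hf x epsr0 H; rewrite rp leNgt oppr_lt0 ed0.
  have ml1 : mmd eps delta x < -1.
    rewrite ltNge; apply/negP => H.
    have := nl_stable_left Hf x epsr0 (introT andP (conj H m2')); rewrite rm leNgt => /negP; apply.
    apply: (@lt_le_trans _ _ 0); first by rewrite oppr_lt0.
    by rewrite mulr_ge0 ?(ltW g0) // -lerBlDl sub0r.
  rewrite distrC gtr0_norm ?subr_gt0 // in l1.
  rewrite ltr0_norm -?ltrBrDr ?sub0r // in l2.
  have -> : delta / L * eps = eps * delta / L by rewrite mulrC mulrA.
  have {}l1 : eps * delta / L <= 1 - mpd eps delta x by rewrite ler_pdivrMr // [leRHS]mulrC.
  have {}l2 : eps * delta / L <= - (mmd eps delta x + 1) by rewrite ler_pdivrMr // [leRHS]mulrC.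
  by move: l1 l2; move: (_ / L) (mpd _ _ _) (mmd _ _ _) => A p m l1 l2; split; lra.
- move=> eps delta x epsr /andP[d0 dd].
  have delr : `|- delta| <= dbar by rewrite normrN gtr0_norm.
  have epsr0 := sub _ epsr; have /andP[e0 _] := epsr; have ed0 : 0 < eps * delta by rewrite mulr_gt0.
  have [p1 p2 m1 m2'] := m2 eps (- delta) x epsr delr.
  have [rm rp] := pw_root Hqd epsr0 delr x; have [z1 z2] := nl_zero Hf x epsr0.
  rewrite mulrN opprK in rm rp.
  have [l1 l2] := lip1 eps (- delta) x epsr delr; rewrite normrN (gtr0_norm d0) in l1 l2.
  have pl1 : 1 < mpd eps (- delta) x.
    rewrite ltNge; apply/negP => H.
    have := nl_stable_right Hf x epsr0 (introT andP (conj p1 H)); rewrite rp leNgt => /negP; apply.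
    apply: le_lt_trans ed0; rewrite oppr_le0 mulr_ge0 ?(ltW g0) // subr_ge0 //.
  have ml1 : -1 < mmd eps (- delta) x.
    rewrite ltNge; apply/negP; rewrite le_eqVlt => /orP[/eqP E|H].
      by move: rm; rewrite E z2 => /eqP; rewrite eq_sym gt_eqF.
    by have := nl_neg Hf x epsr0 H; rewrite rm leNgt ed0.
  rewrite gtr0_norm ?subr_gt0 // in l1.
  rewrite gtr0_norm -?ltrBlDr ?sub0r // in l2.
  have -> : delta / L * eps = eps * delta / L by rewrite mulrC mulrA.
  have {}l1 : eps * delta / L <= mpd eps (- delta) x - 1 by rewrite ler_pdivrMr // [leRHS]mulrC.
  have {}l2 : eps * delta / L <= mmd eps (- delta) x + 1 by rewrite ler_pdivrMr // [leRHS]mulrC.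
  by move: l1 l2; move: (_ / L) (mpd _ _ _) (mmd _ _ _) => A p m l1 l2; split; lra.
Qed.

Section Barriers.
Variables (M L eps1 delta : R).
Hypothesis gap : wave_gap M L eps1.
Hypothesis delta01 : 0 < delta <= dbar.

Let delta0 : 0 < delta. Proof. by case/andP: delta01. Qed.
Let dpos : `|delta| <= dbar. Proof. by rewrite gtr0_norm //; case/andP: delta01. Qed.
Let dneg : `|- delta| <= dbar. Proof. by rewrite normrN. Qed.
Let eps1_gt0 : 0 < eps1. Proof. by case/andP: (wg_eps1 gap). Qed.
Let sub eps : 0 < eps < eps1 -> 0 < eps < eps0.
Proof. by case/andP: (wg_eps1 gap) => _ e /andP[-> H]; exact: lt_le_trans H e. Qed.
Let theta0 : 0 < delta / L. Proof. by rewrite divr_gt0 // (wg_L gap). Qed.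

Let near_gamma : \forall eps \near (0 : R)^'+, M * dbar * eps + 1 * eps <= gamma.
Proof.
have /andP[g0 _] := gamma01; have D0 : 0 < M * dbar + 1.
  by rewrite addr_gt0 // mulr_gt0 // (wg_M gap).
apply: filterS (near_eps (divr_gt0 g0 D0)) => eps /andP[_ /ltW].
by rewrite -mulrDl ler_pdivlMr // mulrC.
Qed.

Lemma direct_barrier : barrier_wave eps1 gamma delta (delta / L) f
  (fun eps r x => qd eps delta r x) (fun eps r x => d_q (qd eps delta) r x)
  (fun eps r x => d_q (d_q (qd eps delta)) r x) (fun eps x => cd eps delta x).
Proof.
split.
- by move=> eps r x /sub epsr; have := pw_eq Hqd epsr dpos r x.
- by move=> eps r x /sub epsr; exact: ltW (pw_slope Hqd epsr dpos r x).
- by move=> eps r x /sub epsr; have [H1 H2] := pw_sign Hqd epsr dpos r x; split.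
- move=> eps r x epsr; have /andP[_ H] := pw_range Hqd (sub epsr) dpos r x.
  by apply: (le_trans H); have [] := wg_pos gap x epsr delta01.
- move=> a a0; apply: filterS2 (near_eps eps1_gt0) (pw_tails eps0_gt0 Hqd dpos a0 theta0).
  move=> eps epsr H r x ra; have [_ H2] := H r x; apply: (le_trans (H2 ra)).
  by have [_] := wg_pos gap x epsr delta01; move: (mmd _ _ _) (_ * eps); move=> *; lra.
- move=> a a0; apply: filterS3 (near_eps eps1_gt0) (pw_tails eps0_gt0 Hqd dpos a0 ltr01) near_gamma.
  move=> eps epsr H g r x ra; have [H1 _] := H r x; apply: le_trans (H1 ra).
  have := wg_right gap x epsr dpos; rewrite ler_norml => /andP[_]; move: g.
  by move: (mpd _ _ _) (M * _ * _) (1 * eps); move=> *; lra.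
- move=> eps x rh t d /sub epsr drh.
  have dq := class_C2_dq (rh t) x (pw_C2 Hqd epsr dpos).
  exact: (@is_derive_comp R (qd eps delta ^~ x) rh t _ _ dq drh).
- move=> K G eta cK eta0; apply: filterS (pw_space eps0_gt0 k01 Hqd G dpos cK eta0).
  move=> eps H x i rh r1 r2 Kx jr r1G; have [d1 [d2 [jd le]]] := H x i rh r1 r2 Kx jr r1G.
  exists d1, d2; split=> //; move: le; rewrite ler_norml => /andP[le _].
  by move: le; move: (_ * r1 ^+ 2) (_ * r2) (eta / eps); move=> *; lra.
- by move=> eps /sub epsr; have [cQ _] := pw_C2 Hqd epsr dpos; move=> z; exact: cQ.
Qed.

(** Negating both the value and the wave variable keeps the profile increasing and changes the sign
    of the speed; the parameter [- delta] becomes a raise of the reflected nonlinearity by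
    [eps * delta]. *)
Lemma reflected_barrier : barrier_wave eps1 gamma delta (delta / L)
  (fun eps q x => - f eps (- q) x)
  (fun eps r x => - qd eps (- delta) (- r) x) (fun eps r x => d_q (qd eps (- delta)) (- r) x)
  (fun eps r x => - d_q (d_q (qd eps (- delta))) (- r) x) (fun eps x => - cd eps (- delta) x).
Proof.
have opp_div (a e : R) : - a / e = - (a / e) by rewrite mulNr.
split.
- move=> eps r x /sub epsr; have := pw_eq Hqd epsr dneg (- r) x; rewrite opprK mulrN.
  by move: (d_q _ _ _) (cd _ _ _) (f _ _ _) => A B C H; rewrite -[C](addrK (- (eps * delta))) -H; ring.
- by move=> eps r x /sub epsr; exact: ltW (pw_slope Hqd epsr dneg (- r) x).
- move=> eps r x /sub epsr; have [H1 H2] := pw_sign Hqd epsr dneg (- r) x.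
  rewrite mulrN in H1 H2; rewrite opprK; split=> r0.
    have := H2; rewrite oppr_le0 => /(_ r0); move: (f _ _ _) (eps * _); move=> *; lra.
  have := H1; rewrite oppr_ge0 => /(_ r0); move: (f _ _ _) (eps * _); move=> *; lra.
- move=> eps r x epsr; have /andP[H _] := pw_range Hqd (sub epsr) dneg (- r) x.
  have [_ H2] := wg_neg gap x epsr delta01; have := le_trans H2 H.
  by move: (qd _ _ _ _) (_ * eps); move=> *; lra.
- move=> a a0; apply: filterS2 (near_eps eps1_gt0) (pw_tails eps0_gt0 Hqd dneg a0 theta0).
  move=> eps epsr H r x ra; have [H2 _] := H (- r) x.
  rewrite opp_div lerNr in ra; have := H2 ra.
  by have [+ _] := wg_neg gap x epsr delta01; move: (mpd _ _ _) (_ * eps) (qd _ _ _ _); move=> *; lra.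
- move=> a a0; apply: filterS3 (near_eps eps1_gt0) (pw_tails eps0_gt0 Hqd dneg a0 ltr01) near_gamma.
  move=> eps epsr H g r x ra; have [_ H1] := H (- r) x.
  rewrite opp_div lerN2 in H1; have := H1 ra.
  have := wg_left gap x epsr dneg; rewrite ler_norml => /andP[_]; move: g.
  by move: (mmd _ _ _) (M * _ * _) (1 * eps) (qd _ _ _ _); move=> *; lra.
- move=> eps x rh t d /sub epsr drh.
  have dN : is_derive t 1 (fun s : R => - rh s) (- d : R) by exact: is_deriveN.
  have dq := class_C2_dq (- rh t) x (pw_C2 Hqd epsr dneg).
  have := is_derive_cstM (-1) (@is_derive_comp R (qd eps (- delta) ^~ x) (fun s => - rh s) t _ _ dq dN).
  rewrite mulN1r mulrN opprK; congr is_derive.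
  by apply/funext => s; rewrite mulN1r.
- move=> K G eta cK eta0; apply: filterS (pw_space eps0_gt0 k01 Hqd G dneg cK eta0).
  move=> eps H x i rh r1 r2 Kx jr r1G.
  have jN : jet2 (fun s => - rh s) (- r1) (- r2).
    by have := jet2_cstM (-1) jr; rewrite !mulN1r; congr jet2; apply/funext => s; rewrite mulN1r.
  have r1G' : `|- r1| <= G / eps by rewrite normrN.
  have [d1 [d2 [jd le]]] := H x i _ _ _ Kx jN r1G'.
  exists (- d1), (- d2); split.
    by have := jet2_cstM (-1) jd; rewrite !mulN1r; congr jet2; apply/funext => s; rewrite mulN1r.
  move: le; rewrite sqrrN ler_norml => /andP[_].
  move: (d_q (qd _ _) _ _) (d_q (d_q _) _ _) (eta / eps) => B A E.
  rewrite mulrN mulNr; move: (A * _) (B * _); move=> *; lra.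
- move=> eps /sub epsr; have [cQ _] := pw_C2 Hqd epsr dneg; move=> z; apply: cvgN.
  have cN : (fun p : R * 'rV[R]_n => - p.1) @ z --> - z.1 by apply: cvgN; exact: cvg_fst.
  have c2 : (fun p : R * 'rV[R]_n => p.2) @ z --> z.2 by exact: cvg_snd.
  exact: (@cvg_fun2 R R 'rV[R]_n _ (nbhs z) _ (fun p => qd eps (- delta) p.1 p.2) _ _ _ _ cN c2 (cQ _ I)).
Qed.

End Barriers.

End PerturbedBarriers.

Section UniformConvergence.
Context {R : realType} {T : topologicalType}.

Lemma cvg_unifP (K : set T) (v : R -> T -> R) (l : T -> R) :
  {uniform K, v @ 0^'+ --> l} <->
  (forall e : R, 0 < e -> \forall eps \near (0 : R)^'+, forall z, K z -> `|l z - v eps z| < e).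
Proof.
split=> [H e e0|H P].
  apply: (H [set h : T -> R | forall z, K z -> `|l z - h z| < e]).
  apply/uniform_nbhs; exists [set xy : R * R | ball xy.1 e xy.2]; split.
    exact: (entourage_ball _ (PosNum e0)).
  by move=> h Hh z Kz; have := Hh z Kz; rewrite /= -ball_normE.
move=> /uniform_nbhs[E [+ EP]]; rewrite -entourage_ballE => -[e /= e0 eE].
apply: filterS (H e e0) => eps Heps; apply: EP => z Kz; apply: eE => /=.
by rewrite -ball_normE /=; exact: Heps.
Qed.

End UniformConvergence.

(** * The limit velocity near the hypersurface *)

Section Hypersurface.
Context {R : realType} {n : nat}.
Implicit Types (G P N : set 'rV[R]_n) (x y : 'rV[R]_n).

Lemma dist_gt0 G x : closed G -> G !=set0 -> ~ G x -> 0 < dist x G.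
Proof.
move=> cG G0 nGx; have oG : \forall y \near x, (~` G) y.
  by apply: open_nbhs_nbhs; split=> //; exact: closed_openC.
have [r r0 Hr] := near_ball oG; apply: (lt_le_trans r0).
apply: lb_le_inf; first by case: G0 => y Gy; exists (enorm (x - y)), y.
move=> _ [y Gy <-]; rewrite leNgt; apply/negP => xy; apply: (Hr y) => //.
apply/rV_norm_lt => // i; rewrite !mxE distrC.
by apply: le_lt_trans xy; have := norm_le_enorm (x - y) 0 i; rewrite !mxE.
Qed.

(** Along a coordinate direction in which the derivative of [h] does not vanish, [h] takes both
    signs arbitrarily close to [p]. *)
Lemma hypersurface_sides G P N p (U : set 'rV[R]_n) : oriented_closed_hypersurface G P N ->
  G p -> nbhs p U -> (exists y, U y /\ P y) /\ (exists y, U y /\ N y).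
Proof.
move=> och Gp Up; have [h [Ch dh Hh]] := och_smooth och Gp.
have [i di] : exists i, 'D_(e_ i) h p != 0.
  apply: contrapT => nex; apply: dh; apply/rowP => i; rewrite !mxE; apply/eqP.
  by apply: contrapT => /negP di; apply: nex; exists i.
have hp : h p = 0 by have [+ _ _] := nbhs_singleton Hh => /iffLR; exact.
have [_ /(_ (e_ i))[dhi _]] := Ch 1%N.
pose d := 'D_(e_ i) h p; have d0 : 0 < `|d| / 2 by rewrite divr_gt0 // normr_gt0.
have ds : is_derive (0 : R) 1 (fun s => h (p + s *: e_ i)) d.
  have := @is_derive_line R _ h p (e_ i) 0; rewrite scale0r addr0; apply; exact: dhi.
have H1 := (is_derive_epsP _ _ _).1 ds _ d0.
have cl : (fun s : R => p + s *: e_ i) @ (0 : R) --> p.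
  rewrite -[X in _ --> X]addr0 -[X in _ + X](scale0r (e_ i)).
  by apply: cvgD; [exact: cvg_cst|apply: cvgZr_tmp; exact: cvg_id].
have H2 : \forall s \near (0 : R), U (p + s *: e_ i) by exact: cl.
have H3 : \forall s \near (0 : R), [/\ G (p + s *: e_ i) <-> h (p + s *: e_ i) = 0,
    P (p + s *: e_ i) <-> 0 < h (p + s *: e_ i) & N (p + s *: e_ i) <-> h (p + s *: e_ i) < 0].
  exact: (cl _ Hh).
have [r r0 Hr] := near0_itv (filterI (filterI H1 H2) H3).
have r2 : 0 < r / 2 by rewrite divr_gt0.
have step (s : R) : `|s| < r -> [/\ U (p + s *: e_ i),
    0 < d * s -> P (p + s *: e_ i) & d * s < 0 -> N (p + s *: e_ i)].
  move=> sr; have [[B Us] [_ Pp Np]] := Hr s sr.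
  move: B; rewrite add0r scale0r addr0 hp subr0 => B.
  have E : `|d| / 2 * `|s| = `|d * s| / 2 by rewrite normrM mulrAC.
  rewrite E ler_distl in B; move: B => /andP[B1 B2]; split=> // ds0.
    by apply/Pp; move: B1; rewrite (gtr0_norm ds0); move: (d * s) (h _) ds0 => a b; lra.
  by apply/Np; move: B2; rewrite (ltr0_norm ds0); move: (d * s) (h _) ds0 => a b; lra.
have rr : `|r / 2| < r by rewrite gtr0_norm // ltr_pdivrMr // ltr_pMr // ltr1n.
have rr' : `|- (r / 2)| < r by rewrite normrN.
have [U1 P1 N1] := step _ rr; have [U2 P2 N2] := step _ rr'.
have [dpos|dneg] := ltP 0 d.
  split; [exists (p + (r / 2) *: e_ i)|exists (p + (- (r / 2)) *: e_ i)]; split=> //.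
    by apply: P1; rewrite mulr_gt0.
  by apply: N2; rewrite mulrN oppr_lt0 mulr_gt0.
have dn : d < 0 by rewrite lt_neqAle di.
split; [exists (p + (- (r / 2)) *: e_ i)|exists (p + (r / 2) *: e_ i)]; split=> //.
  by apply: P2; rewrite mulrN oppr_gt0 nmulr_rlt0.
by apply: N1; rewrite nmulr_rlt0.
Qed.

Lemma locally_lipschitz_continuous (h : 'rV[R]_n -> R) : locally_lipschitz h -> continuous h.
Proof.
move=> lh x; have [U Ux /pinfty_ex_gt0[L L0 HL]] := lh x.
apply/(@cvgrPdist_lt R R^o _ (nbhs x) _ h (h x)) => e e0; have eL : 0 < e / L by rewrite divr_gt0.
have xe : \forall y \near x, `|x - y| < e / L.
  by apply/nbhs_ballP; exists (e / L) => // y; rewrite -ball_normE.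
have Ux0 := nbhs_singleton Ux; apply: filterS2 Ux xe => y Uy xy.
have := HL (x, y) (conj Ux0 Uy) => /= le.
by apply: (le_lt_trans le); rewrite mulrC -ltr_pdivlMr.
Qed.

(* On [G] the limit velocity jumps up to [m] along one side of [G], so that [m] is a value of
   its upper envelope there. *)
Lemma speed_bound (eps0 : R) G (beta m : 'rV[R]_n -> R) (v : R -> 'rV[R]_n -> R) x0 (b : R) :
  0 < eps0 -> closed G -> continuous m ->
  (forall x U, G x -> nbhs x U -> exists y, U y /\ beta y = m y) ->
  (forall eps x, 0 < eps < eps0 -> v eps x <= m x) ->
  cvg_loc_unif (~` G) v beta -> (usc_env setT beta x0 < b%:E)%E ->
  exists r b' : R, [/\ 0 < r, b' < b &
    \forall eps \near 0^'+, forall x, cube x0 r x -> v eps x <= b'].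
Proof.
move=> eps00 cG cm acc vm vc ub.
have [b1 [b1b ub1]] : exists b1 : R, b1 < b /\ (usc_env setT beta x0 < b1%:E)%E.
  move: ub; case: (usc_env _ _ _) => [s| |] //.
    by rewrite lte_fin => sb; exists ((s + b) / 2); rewrite lte_fin; split; lra.
  by move=> _; exists (b - 1); rewrite ltNyr; split=> //; rewrite ltrBlDr ltrDl.
have near_b1 : \forall y \near x0, beta y < b1.
  have H : \forall y \near x0, [set: 'rV[R]_n] y -> beta y < b1 := usc_env_lt ub1.
  by apply: filterS H => y; exact.
have [Gx|nGx] := pselect (G x0).
  have mb1 : m x0 <= b1.
    rewrite leNgt; apply/negP => b1m.
    have H : \forall y \near x0, b1 < m y by exact: (cvgr_gt _ (cm x0) _ b1m).
    have [y [[b1y y1] by_]] := acc _ _ Gx (filterI H near_b1).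
    by move: y1; rewrite by_ ltNge ltW.
  have mb' : m x0 < (b1 + b) / 2 by move: mb1 b1b; move: (m x0); move=> *; lra.
  have H : \forall y \near x0, m y < (b1 + b) / 2 by exact: (cvgr_lt _ (cm x0) _ mb').
  have [r r0 Hr] := near_cube_mem H.
  exists r, ((b1 + b) / 2); split=> //; first by lra.
  by apply: filterS (near_eps eps00) => eps epsr x cx; apply: (le_trans (vm _ _ epsr)); exact/ltW/Hr.
have oG : \forall y \near x0, (~` G) y.
  by apply: open_nbhs_nbhs; split=> //; exact: closed_openC.
have [r r0 Hr] := near_cube_mem (filterI oG near_b1).
have cr : cube x0 r `<=` ~` G by move=> y /Hr[].
have e0 : 0 < (b - b1) / 2 by rewrite divr_gt0 // subr_gt0.
have := (cvg_unifP _ _ _).1 (vc _ (@cube_compact R n x0 r) cr) _ e0.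
move=> Hv; exists r, ((b1 + b) / 2); split=> //; first by lra.
apply: filterS Hv => eps Heps x cx; have [_ bx] := Hr x cx; have := Heps x cx.
rewrite distrC ltr_distl => /andP[_]; move: bx.
by move: (beta x) (v eps x) => B V; lra.
Qed.

End Hypersurface.

Lemma continuous_oppf {R : realType} {T : topologicalType} (h : T -> R) :
  continuous h -> continuous (fun x => - h x).
Proof. by move=> ch x; have cx := ch x; exact: cvgN. Qed.

(** * Assembly of the two phases *)

Section Models.
Context {R : realType} {n : nat}.
Implicit Types (x : 'rV[R]_n) (z : 'rV[R]_n * R) (eps delta : R).

Lemma reaction_diffusion_opp eps (f : R -> 'rV[R]_n -> R) (g : 'rV[R]_n -> R) u :
  reaction_diffusion_sol eps f g u ->
  reaction_diffusion_sol eps (fun q x => - f (- q) x) (fun x => - g x) (fun z => - u z).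
Proof.
move=> [[cu bu] Cu eq_u u0]; split.
- by split; [exact: continuous_opp_within|exact: bounded_opp].
- exact: C21_opp.
- move=> z Qz; have [-> _ ->] := C21_oppE Cu Qz; have := eq_u z Qz.
  rewrite opprK raddfN /= mulrN; move: (dt u z) (\tr _) (eps ^- 2 * _) => a b d H.
  by rewrite -opprD -opprD H oppr0.
- by move=> x; rewrite u0.
Qed.

(** Common to both phases, [v] being [c / eps] for one and its opposite for the other. The waves are
    indexed by [delta] because it can only be fixed once the bound [b] on the speed is known. *)
Lemma build_model (eps1 gamma dbar M : R) (f : R -> R -> 'rV[R]_n -> R) (g beta : 'rV[R]_n -> R)
    (ue : R -> 'rV[R]_n * R -> R) (v : R -> 'rV[R]_n -> R) :
  0 < eps1 -> 0 < gamma < 1 -> 0 < dbar -> 0 < M ->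
  (forall eps, 0 < eps < eps1 -> reaction_diffusion_sol eps (f eps) g (ue eps)) ->
  (forall eps z, 0 < eps < eps1 -> Q0 z -> -1 <= ue eps z <= 1) ->
  (exists2 L : R, 0 < L & forall eps x (q q' : R), 0 < eps < eps1 ->
    -1 <= q <= 1 -> -1 <= q' <= 1 -> `|f eps q x - f eps q' x| <= L * `|q - q'|) ->
  (forall eps x (q : R), 0 < eps < eps1 -> 1 - gamma <= q <= 1 ->
    f eps q x <= - (gamma * (1 - q))) ->
  (forall (K : set 'rV[R]_n) (s s' : R), compact K -> 0 < s -> s' < 1 ->
    exists2 mu : R, 0 < mu & \forall eps \near 0^'+, forall x (q : R), K x ->
      s <= q <= s' -> f eps q x <= - mu) ->
  (forall delta, 0 < delta <= dbar -> exists theta Q Qr Qrr C, [/\ 0 < theta,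
    barrier_wave eps1 gamma delta theta f Q Qr Qrr C
    & forall eps x, 0 < eps < eps1 -> C eps x <= eps * (v eps x + M * delta)]) ->
  (forall x0 (b : R), (usc_env setT beta x0 < b%:E)%E -> exists r b' : R, [/\ 0 < r, b' < b &
    \forall eps \near 0^'+, forall x, cube x0 r x -> v eps x <= b']) ->
  (forall eps x, 0 < eps < eps1 -> v eps x <= 2) ->
  phase_model eps1 gamma f ue beta.
Proof.
move=> e10 g01 d0 M0 rd range lip stable react wave speed vle.
split => //.
- by move=> eps /rd[[]].
- by move=> eps /rd[].
- by move=> eps z /rd[_ _ + _] Qz; exact.
- move=> x0 b /speed[r [b' [r0 b'b Hv]]].
  (* [delta] is taken so small that the speed error [M * delta] fits between [b'] and [b]. *)
  have bM : 0 < (b - b') / M by rewrite divr_gt0 // subr_gt0.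
  have [delta [delta0 dd db]] := small_lt2 d0 bM.
  have dr : 0 < delta <= dbar by rewrite delta0 ltW.
  have [theta [Q [Qr [Qrr [C [th0 bw HC]]]]]] := wave delta dr.
  exists delta, theta, Q, Qr, Qrr, C, r; split=> //.
  apply: filterS2 (near_eps e10) Hv => eps epsr Heps x cx.
  apply: (le_trans (HC eps x epsr)); have /andP[eps0 _] := epsr; rewrite ler_pM2l //.
  have := Heps x cx; have : M * delta <= b - b' by rewrite mulrC -ler_pdivlMr // ltW.
  by move: (v _ _) (M * delta) => V D; lra.
- have dr : 0 < dbar <= dbar by rewrite d0 lexx.
  have [theta [Q [Qr [Qrr [C [th0 bw HC]]]]]] := wave dbar dr.
  exists dbar, theta, Q, Qr, Qrr, C, (2 + M * dbar); split=> //.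
    by rewrite addr_gt0 // mulr_gt0.
  move=> eps x epsr; apply: (le_trans (HC eps x epsr)); have /andP[eps0 _] := epsr.
  by rewrite ler_pM2l // lerD2r vle.
Qed.

End Models.

Theorem theorem5p1 (R : realType) (n : nat) (n_gt0 : (0 < n)%N)
    (eps0 rho gamma k dbar : R)
    (eps0_gt0 : 0 < eps0) (rho01 : 0 < rho < 1) (gamma01 : 0 < gamma < 1)
    (k01 : 0 <= k < 1) (dbar_gt0 : 0 < dbar)
    (* limit velocity *)
    (Gt Pt Nt : set 'rV[R]_n) (dtilde n1 n2 alpha : 'rV[R]_n -> R)
    (Halpha : limit_velocity rho Gt Pt Nt dtilde n1 n2 alpha)
    (* nonlinearity *)
    (f : R -> R -> 'rV[R]_n -> R) (mo : R -> 'rV[R]_n -> R)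
    (Hf : nonlinearity eps0 rho gamma k f mo)
    (* travelling waves *)
    (q : R -> R -> 'rV[R]_n -> R) (c : R -> 'rV[R]_n -> R)
    (Hq : waves eps0 k f mo q c)
    (mmd mzd mpd : R -> R -> 'rV[R]_n -> R)
    (qd : R -> R -> R -> 'rV[R]_n -> R) (cd : R -> R -> 'rV[R]_n -> R)
    (Hqd : perturbed_waves eps0 dbar k f c mmd mzd mpd qd cd)
    (* velocities *)
    (Hc : forall eps x, 0 < eps < eps0 ->
      [/\ 2 * rho <= n1 x, n1 x < c eps x / eps, c eps x / eps < n2 x
        & n2 x <= 2 * (1 - rho)])
    (Hcalpha : cvg_loc_unif (~` Gt) (fun eps x => c eps x / eps) alpha)
    (* initial datum *)
    (g : 'rV[R]_n -> R) (g_cont : continuous g)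
    (g_range : forall x, -1 <= g x <= 1)
    (g_zero : [set x | g x = 0] !=set0)
    (g_pos : [set x | 0 < g x] !=set0)
    (g_neg : [set x | g x < 0] !=set0)
    (* reaction-diffusion equation *)
    (ue : R -> 'rV[R]_n * R -> R)
    (Hue : forall eps, 0 < eps < eps0 ->
      reaction_diffusion_sol eps (f eps) g (ue eps) /\
      forall v, reaction_diffusion_sol eps (f eps) g v ->
        forall z, Q0 z -> v z = ue eps z)
    (* geometric equation *)
    (d_o : 'rV[R]_n -> R)
    (Hd_o : signed_distance [set x | g x = 0] [set x | 0 < g x]
              [set x | g x < 0] d_o)
    (u : 'rV[R]_n * R -> R)
    (Hu : continuous_viscosity_sol alpha d_o u)
    (Hu_unique : forall v, continuous_viscosity_sol alpha d_o v ->
      forall z, Q0 z -> v z = u z)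
    (Hcomp : @comparison_principle R n alpha) :
  let Upos := Qpos `&` [set z | 0 < u z] in
  let Uneg := Qpos `&` [set z | u z < 0] in
  let Uzero := Qpos `&` [set z | u z = 0] in
  [/\ cvg_loc_unif Upos ue (cst 1),
      cvg_loc_unif Uneg ue (cst (-1))
    & (* boundaries and closures are relative to R^n x ]0, +oo[ *)
      Uzero = Qpos `&` (closure Upos `\` interior Upos) /\
      Uzero = Qpos `&` (closure Uneg `\` interior Uneg) ->
      cvg_loc_unif Upos ue (cst 1) /\
      cvg_loc_unif (Qpos `\` closure Upos) ue (cst (-1))].
Proof.
move=> Upos Uneg Uzero; pose i0 := Ordinal n_gt0.
have [M [L [eps1 gap]]] := pw_gap eps0_gt0 gamma01 dbar_gt0 Hf Hqd.
have /andP[eps1_gt0 eps10] := wg_eps1 gap.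
have M0 := wg_M gap; have L0 := wg_L gap.
have sub (eps : R) : 0 < eps < eps1 -> 0 < eps < eps0.
  by move=> /andP[-> H]; exact: lt_le_trans H eps10.
have rd (eps : R) : 0 < eps < eps1 -> reaction_diffusion_sol eps (f eps) g (ue eps).
  by move=> /sub /Hue[].
have rdN (eps : R) : 0 < eps < eps1 -> reaction_diffusion_sol eps
    (fun q x => - f eps (- q) x) (fun x => - g x) (fun z => - ue eps z).
  by move=> /rd; exact: reaction_diffusion_opp.
have range (eps : R) (z : 'rV[R]_n * R) : 0 < eps < eps1 -> Q0 z -> -1 <= ue eps z <= 1.
  move=> epsr Qz; have /andP[e0 _] := epsr; apply/andP; split.
    have [[cu bu] Cu eq_u u0] := rdN eps epsr; rewrite lerNl.
    apply: (@solution_le1 R n eps (fun q x => - f eps (- q) x) (fun z => - ue eps z)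
      e0 cu bu Cu eq_u _ _ z Qz) => [x|s x s1].
      by rewrite u0 lerNl; case/andP: (g_range x).
    by rewrite oppr_ge0; apply: (nl_neg Hf x (sub _ epsr)); rewrite ltrN2.
  have [[cu bu] Cu eq_u u0] := rd eps epsr.
  apply: (solution_le1 e0 cu bu Cu eq_u) Qz => [x|s x s1].
    by rewrite u0; case/andP: (g_range x).
  exact: (nl_pos Hf x (sub _ epsr) s1).
have och := lv_hypersurface Halpha; have cG := och_closed och.
have G0 := och_nonempty och; have [PN PNG] := och_partition och.
have [dG dP dN] := lv_distance Halpha; have [lip1 lip2] := lv_lipschitz Halpha.
have sideP x U : Gt x -> nbhs x U -> exists y, U y /\ alpha y = n2 y.
  move=> Gx Ux; have [[y [Uy Py]] _] := hypersurface_sides och Gx Ux.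
  exists y; split=> //; apply: (lv_pos Halpha); rewrite dP //; apply: dist_gt0 => //.
  have : (Pt `|` Nt) y by left.
  by rewrite PNG.
have sideN x U : Gt x -> nbhs x U -> exists y, U y /\ - alpha y = - n1 y.
  move=> Gx Ux; have [_ [y [Uy Ny]]] := hypersurface_sides och Gx Ux.
  exists y; split=> //; congr (- _); apply: (lv_neg Halpha); rewrite dN // oppr_lt0.
  apply: dist_gt0 => //.
  have : (Pt `|` Nt) y by right.
  by rewrite PNG.
have HcalphaN : cvg_loc_unif (~` Gt) (fun eps x => - (c eps x / eps)) (fun x => - alpha x).
  move=> K cK KG; apply/cvg_unifP => e e0.
  apply: filterS ((cvg_unifP _ _ _).1 (Hcalpha K cK KG) e e0) => eps H x Kx.
  by rewrite -opprD normrN; exact: H.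
have n12 x : 0 <= n1 x /\ n2 x <= 2.
  have e2 : 0 < eps0 / 2 < eps0 by rewrite divr_gt0 //= ltr_pdivrMr // ltr_pMr // ltr1n.
  have /andP[r0 _] := rho01; have [A _ _ B] := Hc _ x e2; split.
    by apply: le_trans A; rewrite mulr_ge0 // ltW.
  by apply: (le_trans B); move: r0; lra.
have alpha_bound x : `|alpha x| <= 2.
  have : n1 x <= alpha x <= n2 x.
    have lt12 := lv_lt Halpha x; have [d0|d0|d0] := ltgtP (dtilde x) 0.
    - by rewrite (lv_neg Halpha d0) lexx ltW.
    - by rewrite (lv_pos Halpha d0) lexx ltW.
    - exact: (lv_zero Halpha d0).
  have [A B] := n12 x; move=> /andP[C D]; rewrite ger0_norm ?(le_trans A) //.
  exact: le_trans D B.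
have alpha_boundN x : `|- alpha x| <= 2 by rewrite normrN.
have cspeed (eps : R) (delta : R) x : 0 < eps < eps1 -> `|delta| <= dbar ->
    cd eps delta x <= eps * (c eps x / eps + M * `|delta|) /\
    - cd eps delta x <= eps * (- (c eps x / eps) + M * `|delta|).
  move=> epsr dr; have := wg_speed gap x epsr dr; have /andP[e0 _] := epsr.
  have E1 : eps * (c eps x / eps + M * `|delta|) = c eps x + M * `|delta| * eps.
    by field; rewrite gt_eqF.
  have E2 : eps * (- (c eps x / eps) + M * `|delta|) = - c eps x + M * `|delta| * eps.
    by field; rewrite gt_eqF.
  rewrite E1 E2 ler_distl => /andP[]; move: (M * _ * _) (c eps x) (cd _ _ _).
  by clear; move=> *; split; lra.
have pm : phase_model eps1 gamma f ue alpha.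
  apply: (@build_model R n eps1 gamma dbar M f g alpha ue (fun eps x => c eps x / eps)) => //.
  - have [C C0 HC] := nl_lipschitz Hf; exists C => // eps x s s' epsr /andP[s1 s2] /andP[s3 s4].
    by apply: (HC _ _ _ _ (sub _ epsr)); apply/andP; split; lra.
  - by move=> eps x s /sub epsr; exact: (nl_stable_right Hf x epsr).
  - move=> K s s' cK s0 s1; have [mu mu0 H] := nl_reaction Hf cK s0 s1.
    by exists mu => //; apply: filterS H => eps H x s2 Kx; have [] := H x s2 Kx.
  - move=> delta dr; have /andP[d0 _] := dr.
    exists (delta / L), (fun eps r x => qd eps delta r x), (fun eps r x => d_q (qd eps delta) r x),
      (fun eps r x => d_q (d_q (qd eps delta)) r x), (fun eps x => cd eps delta x); split.
    + by rewrite divr_gt0.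
    + exact: (direct_barrier eps0_gt0 gamma01 k01 dbar_gt0 Hqd gap dr).
    + move=> eps x epsr; have [|+ _] := cspeed eps delta x epsr; rewrite ?gtr0_norm //.
      by case/andP: dr.
  - move=> x0 b; apply: (speed_bound eps0_gt0 cG (locally_lipschitz_continuous lip2) sideP) => //.
    by move=> eps x /(Hc eps x)[_ _ /ltW].
  - move=> eps x /sub epsr; have [_ _ /ltW A _] := Hc eps x epsr.
    by apply: (le_trans A); case: (n12 x).
have pmN : phase_model eps1 gamma (fun eps q x => - f eps (- q) x) (fun eps z => - ue eps z)
    (fun x => - alpha x).
  apply: (@build_model R n eps1 gamma dbar M _ (fun x => - g x) _ _
    (fun eps x => - (c eps x / eps))) => //.
  - by move=> eps z epsr Qz; rewrite lerNr opprK lerNl andbC; exact: range.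
  - have [C C0 HC] := nl_lipschitz Hf; exists C => // eps x s s' epsr /andP[s1 s2] /andP[s3 s4].
    have H : `|f eps (- s) x - f eps (- s') x| <= C * `|- s - - s'|.
      by apply: (HC _ _ _ _ (sub _ epsr)); apply/andP; split; lra.
    by rewrite -opprD normrN; apply: (le_trans H); rewrite -opprD normrN.
  - move=> eps x s /sub epsr /andP[s1 s2]; rewrite lerN2.
    by apply: (nl_stable_left Hf x epsr); rewrite lerN2 s2 /= lerNl opprD opprK.
  - move=> K s s' cK s0 s1; have [mu mu0 H] := nl_reaction Hf cK s0 s1.
    exists mu => //; apply: filterS H => eps H x s2 Kx /andP[s3 s4]; rewrite lerN2.
    by have [_] := H x (- s2) Kx; apply; rewrite !lerN2 s3 s4.
  - move=> delta dr; have /andP[d0 _] := dr.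
    exists (delta / L), (fun eps r x => - qd eps (- delta) (- r) x),
      (fun eps r x => d_q (qd eps (- delta)) (- r) x),
      (fun eps r x => - d_q (d_q (qd eps (- delta))) (- r) x), (fun eps x => - cd eps (- delta) x).
    split.
    + by rewrite divr_gt0.
    + exact: (reflected_barrier eps0_gt0 gamma01 k01 dbar_gt0 Hqd gap dr).
    + move=> eps x epsr; have [|_] := cspeed eps (- delta) x epsr; rewrite normrN gtr0_norm //.
      by case/andP: dr.
  - move=> x0 b; have cn1 : continuous (fun x => - n1 x).
      exact: continuous_oppf (locally_lipschitz_continuous lip1).
    apply: (@speed_bound R n eps0 Gt (fun x => - alpha x) (fun x => - n1 x)
      (fun eps x => - (c eps x / eps)) x0 b eps0_gt0 cG cn1 sideN) => //.
    by move=> eps x /(Hc eps x)[_ /ltW + _ _]; rewrite lerN2.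
  - move=> eps x /sub epsr; have [_ /ltW A _ _] := Hc eps x epsr.
    have [B _] := n12 x; apply: (@le_trans _ _ 0) => //; rewrite oppr_le0; exact: le_trans A.
have [cu [subu superu] u0] := Hu.
have [do0 doP doN] := Hd_o.
have dist_ge0 (x : 'rV[R]_n) : 0 <= dist x [set x | g x = 0].
  apply: lb_le_inf; first by case: g_zero => y gy; exists (enorm (x - y)), y.
  by move=> _ [y _ <-]; exact: enorm_ge0.
have posS z : Upos z -> settled gamma ue z.
  move=> [Qz uz]; apply: (positive_settled pm g_cont _ i0 alpha_bound Hcomp cu subu _ Qz uz).
    by move=> eps x /rd[_ _ _ ->].
  move=> x gx; rewrite u0; have [gx0|gx0|gx0] := ltgtP (g x) 0.
  - by rewrite doN // oppr_le0.
  - by move: gx; rewrite leNgt gx0.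
  - by rewrite do0.
have negS z : Uneg z -> settled gamma (fun eps z => - ue eps z) z.
  move=> [Qz uz]; have gN_cont : continuous (fun x => - g x).
    exact: continuous_oppf g_cont.
  apply: (positive_settled pmN gN_cont _ i0 alpha_boundN (comparison_opp alpha_bound Hcomp)
    (continuous_opp_within cu) (viscosity_super_opp alpha_bound superu) _ Qz).
  - by move=> eps x /rd[_ _ _ ->].
  - move=> x gx; rewrite u0; have [gx0|gx0|gx0] := ltgtP (g x) 0.
    + by move: gx; rewrite oppr_le0 leNgt gx0.
    + by rewrite doP // oppr_le0.
    + by rewrite do0 // oppr0.
  - by rewrite oppr_gt0.
(* [settled_compact] with [theta = 1] gives [1 - eps <= ue], and [ue <= 1] closes the gap. *)
have cvgP : cvg_loc_unif Upos ue (cst 1).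
  move=> K cK KU; apply/cvg_unifP => e e0.
  have H := settled_compact pm ltr01 cK (fun z Kz => posS z (KU z Kz)).
  apply: filterS3 H (near_eps e0) (near_eps eps1_gt0) => eps H /andP[_ epse] epsr z Kz.
  have Qz : Q0 z by apply: Qpos_Q0; case: (KU z Kz).
  have := H z Kz; have /andP[_] := range eps z epsr Qz.
  by rewrite /cst mul1r; move: (ue eps z) => w ? ?; rewrite ger0_norm; lra.
have cvgN' : cvg_loc_unif Uneg ue (cst (-1)).
  move=> K cK KU; apply/cvg_unifP => e e0.
  have H := settled_compact pmN ltr01 cK (fun z Kz => negS z (KU z Kz)).
  apply: filterS3 H (near_eps e0) (near_eps eps1_gt0) => eps H /andP[_ epse] epsr z Kz.
  have Qz : Q0 z by apply: Qpos_Q0; case: (KU z Kz).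
  have := H z Kz; have /andP[+ _] := range eps z epsr Qz.
  by rewrite /cst mul1r; move: (ue eps z) => w ? ?; rewrite ler0_norm; lra.
(* Outside the closure of [Upos] zeroes of [u] are excluded, because [Uzero] is contained in that
   closure; only [u < 0] remains. *)
split=> // -[UzE _]; split=> // K cK KU; apply: cvgN' => // z /KU[Qz nz]; split=> //=.
have [//|uz|uz] := ltgtP (u z) 0.
  by exfalso; apply: nz; apply: subset_closure; split.
exfalso; apply: nz; have : Uzero z by split.
by rewrite UzE => -[_ []].
Qed.
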